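(* Let $n\ge2$, $\Omega\subset\mathbb{C}^n$ open, and $K\subset\Omega$ compact. The following are equivalent: (i) every $f\in\mathcal{H}(\Omega\setminus K)$ has a (unique) extension $\tilde f\in\mathcal{H}(\Omega)$; (i') every locally constant map $g:\Omega\setminus K\to\mathbb{C}$ has an extension $\tilde g\in\mathcal{H}(\Omega)$; (ii) the restriction map $\rho:\mathcal{H}(\Omega)\to\mathcal{H}(\Omega\setminus K)$, $\rho(f)=f|_{\Omega\setminus K}$, is an isomorphism of $\mathbb{C}$-algebras; (iii) $\mathbb{C}^n\setminus K$ is connected. In this case $f(\Omega)=f(\Omega\setminus K)$ for every $f\in\mathcal{H}(\Omega)$.
   Context: $\mathcal{H}(U)$ denotes the algebra of holomorphic functions $U\to\mathbb{C}$. *)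

(* Defs.v *)
From HB Require Import structures.
From mathcomp Require Import all_boot all_order all_algebra.
From mathcomp Require Import all_classical all_reals all_analysis.
From mathcomp Require Import complex.
Set Implicit Arguments. Unset Strict Implicit. Unset Printing Implicit Defensive.
Import Order.TTheory GRing.Theory Num.Theory.
Import numFieldNormedType.Exports.
Local Open Scope classical_set_scope.
Local Open Scope ring_scope.

(* The complex numbers: C = R[i] for a real type R (any realType is a model
   of the reals); as a normed space over itself we use the copy R[i]^o. *)

(* C^n, as row vectors, with the (max-)norm topology, normed over C. *)
Definition Cn (R : realType) (n : nat) : normedModType R[i] := 'rV[R[i]]_n.

(* f is holomorphic on U: complex (Frechet) differentiable at every point of U,
   i.e. its differential at each point is C-linear. *)
Definition holomorphic_on (R : realType) (n : nat) (U : set (Cn R n))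
  (f : Cn R n -> (R[i])^o) : Prop :=
  forall x, U x -> differentiable f x.

Definition locally_constant_on (R : realType) (n : nat) (D : set (Cn R n))
  (g : Cn R n -> (R[i])^o) : Prop :=
  forall x, D x -> \forall y \near x, g y = g x.

(* The algebra H(U), with each element represented canonically by the
   total function that vanishes outside U (so equality in H(U) is equality
   of functions); operations are pointwise, unit is the indicator of U. *)
Definition Hol (R : realType) (n : nat) (U : set (Cn R n)) :
  set (Cn R n -> (R[i])^o) :=
  [set f | holomorphic_on U f /\ (forall x, ~ U x -> f x = 0)].

Definition Hol_one (R : realType) (n : nat) (U : set (Cn R n)) :
  Cn R n -> (R[i])^o :=
  fun x => if `[< U x >] then 1 else 0.

Definition restr (R : realType) (n : nat) (V : set (Cn R n))
  (f : Cn R n -> (R[i])^o) : Cn R n -> (R[i])^o :=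
  fun x => if `[< V x >] then f x else 0.

(* Main.v *)
(* For f holomorphic on Omega \ K, decompose f = F - u with F holomorphic on Omega and u
   holomorphic on C^n \ K: on each complex line in the first coordinate, F and -u are the two
   parts of a Laurent-type splitting, given by Cauchy integrals over the boundaries of two
   nested unions of grid squares around the slice of K. By Liouville's theorem u is the unique
   principal part tending to 0 at infinity, so that the local constructions agree. It vanishes
   on the lines that miss K; these exist because n >= 2, and the identity theorem yields u = 0
   as soon as C^n \ K is connected.
   Conversely, if C^n \ K splits into two open parts, the extension to Omega of the indicator
   of one of them glues to an entire function h such that h (h - 1) has compact support, hence
   vanishes; then h is constant, a contradiction.
   Only complex differentiability is assumed, so Cauchy's theory is derived from Goursat's
   theorem, with the integral along a segment taken as a limit of dyadic Riemann sums. *)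
Require Import Defs.
From HB Require Import structures.
From mathcomp Require Import all_boot all_order all_algebra.
From mathcomp Require Import all_classical all_reals all_analysis.
From mathcomp Require Import complex.
From mathcomp Require Import ring lra zify.
Import Order.TTheory GRing.Theory Num.Theory.
Import numFieldNormedType.Exports.
Local Open Scope classical_set_scope.
Local Open Scope ring_scope.

Set Implicit Arguments.
Unset Strict Implicit.
Unset Printing Implicit Defensive.

(** * Norms with real values, limits and bisection *)

(** One contour around the slice would not suffice, because its Cauchy integral represents only one
    of the two parts, and only on one side. With two nested unions of squares, [Tsq] covering [K]
    and the thicker [Ssq] inside [Omega], the two integrals differ between the contours by
    [cauchy_const] times [f]. The principal part thus has one formula away from [Tsq] and another
    within [Ssq], and they agree on the overlap. The grid is fixed over a whole cylinder of
    neighbouring lines, so that the contours do not move with the point. Holomorphy of these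
    integrals in the parameter comes from the dyadic sums: they are finite sums of holomorphic
    functions with a common bound, and a pointwise limit of such sums is holomorphic, because Cauchy
    estimates bound all second-order remainders by one constant. The number 2 pi i appears only as
    [cauchy_const], shown to be independent of the pole and nonzero. Compactness of segments and
    squares always enters through bisection. *)

Section RealNorm.
Context {R : realType} {V : normedZmodType R[i]}.
Implicit Types x y z : V.

(** Norms over [R[i]] are elements of [R[i]], whose order is partial; the real part loses nothing
    and makes linear arithmetic available. *)
Definition rnorm x : R := complex.Re `|x|.

Lemma normE x : `|x| = (rnorm x)%:C%C.
Proof. by rewrite /rnorm RRe_real // normr_real. Qed.

Lemma rnorm_ge0 x : 0 <= rnorm x.
Proof. by rewrite -lecR -normE normr_ge0. Qed.

Lemma rnorm0 : rnorm (0 : V) = 0.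
Proof. by rewrite /rnorm normr0. Qed.

Lemma rnorm_eq0 x : (rnorm x == 0) = (x == 0).
Proof.
by rewrite -(inj_eq (@complexI R)) -normE normr_eq0.
Qed.

Lemma rnorm_gt0 x : (0 < rnorm x) = (x != 0).
Proof. by rewrite lt_neqAle rnorm_ge0 andbT eq_sym rnorm_eq0. Qed.

Lemma ler_rnormD x y : rnorm (x + y) <= rnorm x + rnorm y.
Proof. by rewrite -lecR rmorphD /= -!normE ler_normD. Qed.

Lemma rnormN x : rnorm (- x) = rnorm x.
Proof. by rewrite /rnorm normrN. Qed.

Lemma rdistC x y : rnorm (x - y) = rnorm (y - x).
Proof. by rewrite -rnormN opprB. Qed.

Lemma ler_rnormB x y : rnorm (x - y) <= rnorm x + rnorm y.
Proof. by rewrite -(rnormN y) ler_rnormD. Qed.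

Lemma ler_rdistD z x y : rnorm (x - y) <= rnorm (x - z) + rnorm (z - y).
Proof. by rewrite -{1}(subrK z x) -addrA ler_rnormD. Qed.

Lemma ler_rdist x y : rnorm x <= rnorm y + rnorm (x - y).
Proof. by rewrite -{1}(subrK y x) addrC ler_rnormD. Qed.

Lemma rnorm_small x : (forall e, 0 < e -> rnorm x <= e) -> x = 0.
Proof.
move=> h; apply/eqP; rewrite -rnorm_eq0 eq_le rnorm_ge0 andbT.
by apply/ler_addgt0Pl => e e0; rewrite addr0; apply: h.
Qed.

End RealNorm.

Section ComplexNorm.
Context {R : realType}.
Local Notation C := (R[i]).
Implicit Types (x y z : C) (r : R).

Lemma rnormM x y : rnorm (x * y) = rnorm x * rnorm y.
Proof. by apply: (@complexI R); rewrite rmorphM /= -!normE normrM. Qed.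

Lemma rnormV x : rnorm x^-1 = (rnorm x)^-1.
Proof. by apply: (@complexI R); rewrite fmorphV /= -!normE normfV. Qed.

Lemma rnormX x n : rnorm (x ^+ n) = rnorm x ^+ n.
Proof. by apply: (@complexI R); rewrite rmorphXn /= -!normE normrX. Qed.

Lemma rnormR r : rnorm (r%:C%C : C) = `|r|.
Proof.
apply: (@complexI R); rewrite -normE normc_def /= expr0n addr0.
by rewrite sqrtr_sqr.
Qed.

Lemma rnorm1 : rnorm (1 : C) = 1.
Proof. by rewrite -[1]/(1%:C%C) rnormR normr1. Qed.

Lemma rnorm_i : rnorm ('i%C : C) = 1.
Proof.
by apply: (@complexI R); rewrite -normE normc_def /= expr0n expr1n add0r sqrtr1.
Qed.

Lemma normr_Re_le z : `|complex.Re z| <= rnorm z.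
Proof. by rewrite -lecR -normE; apply: normc_ge_Re. Qed.

Lemma normr_Im_le z : `|complex.Im z| <= rnorm z.
Proof.
have -> : complex.Im z = complex.Re (- ('i%C * z)).
  by case: z => a b /=; lra.
by apply: le_trans (normr_Re_le _) _; rewrite rnormN rnormM rnorm_i mul1r.
Qed.

Lemma rnorm_le_ReIm z : rnorm z <= `|complex.Re z| + `|complex.Im z|.
Proof.
rewrite {1}(complexE z); apply: le_trans (ler_rnormD _ _) _.
by rewrite rnormM rnorm_i mul1r !rnormR.
Qed.

Lemma rnormZ (V : normedModType C) (c : C) (v : V) :
  rnorm (c *: v) = rnorm c * rnorm v.
Proof. by apply: (@complexI R); rewrite rmorphM /= -!normE normrZ. Qed.

Lemma mulCi_i : ('i%C : C) * 'i%C = -1.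
Proof. by rewrite -expr2 sqr_i. Qed.

End ComplexNorm.

Section Limits.
Context {R : realType}.
Local Notation C := (R[i]).
Implicit Types (u v : nat -> C) (l : C).

Definition scvg u l := forall e : R, 0 < e ->
  exists n0, forall n, (n0 <= n)%N -> rnorm (u n - l) <= e.

Definition slim u : C := xget 0 [set l | scvg u l].

Lemma scvg_unique u l l' : scvg u l -> scvg u l' -> l = l'.
Proof.
move=> h h'; apply/eqP; rewrite -subr_eq0; apply/eqP/rnorm_small => e e0.
have e20 : 0 < e / 2 by lra.
have [n hn] := h _ e20; have [n' hn'] := h' _ e20.
have := hn _ (leq_maxl n n'); have := hn' _ (leq_maxr n n').
have := ler_rdistD (u (maxn n n')) l l'; rewrite (rdistC l (u _)); lra.
Qed.

Lemma slimE u l : scvg u l -> slim u = l.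
Proof. by move=> h; apply: xget_unique => // l' /scvg_unique; apply. Qed.

Lemma scvg_cst l : scvg (fun=> l) l.
Proof. by move=> e e0; exists 0%N => n _; rewrite subrr rnorm0 ltW. Qed.

Lemma scvgD u v l l' : scvg u l -> scvg v l' -> scvg (fun n => u n + v n) (l + l').
Proof.
move=> h h' e e0; have e20 : 0 < e / 2 by lra.
have [n hn] := h _ e20; have [n' hn'] := h' _ e20.
exists (maxn n n') => m; rewrite geq_max => /andP[/hn m1 /hn' m2].
have := ler_rnormD (u m - l) (v m - l').
rewrite (_ : u m - l + (v m - l') = u m + v m - (l + l')); last by ring.
lra.
Qed.

Lemma scvgM u (c l : C) : scvg u l -> scvg (fun n => c * u n) (c * l).
Proof.
move=> h e e0; have c0 := rnorm_ge0 c.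
have e20 : 0 < e / (rnorm c + 1) by apply: divr_gt0; lra.
have [n hn] := h _ e20; exists n => m /hn hm.
rewrite -mulrBr rnormM; apply: le_trans (ler_wpM2l c0 hm) _.
rewrite mulrCA; apply: ler_piMr; first exact: ltW.
by rewrite ler_pdivrMr; lra.
Qed.

Lemma scvg_unshift u l : scvg (fun n => u n.+1) l -> scvg u l.
Proof. by move=> h e /h [n hn]; exists n.+1 => -[//|m] nm; apply: hn. Qed.

Lemma scvg_le u l (M : R) : scvg u l -> (forall n, rnorm (u n) <= M) -> rnorm l <= M.
Proof.
move=> h hM; apply/ler_addgt0Pl => e e0; have [n /(_ _ (leqnn n)) hn] := h _ e0.
by have := ler_rdist l (u n); have := hM n; rewrite (rdistC l (u _)); lra.
Qed.

Lemma real_cauchy_cvg (u : R^nat) :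
  (forall e : R, 0 < e -> exists n0, forall m n, (n0 <= m)%N -> (n0 <= n)%N ->
     `|u m - u n| <= e) ->
  exists l : R, forall e : R, 0 < e -> exists n0, forall n, (n0 <= n)%N -> `|u n - l| <= e.
Proof.
move=> h.
have : cvg (u @ \oo).
  apply/cauchy_cvgP/cauchy_exP => e e0.
  have [n hn] := h (e / 2) ltac:(lra).
  exists (u n); exists n => // m /= nm; rewrite -ball_normE /=.
  by have := hn n m (leqnn _) nm; lra.
move=> /cvg_ex [l /cvgrPdist_le hl]; exists l => e /hl [n _ hn].
by exists n => m nm; rewrite distrC; apply: hn.
Qed.

Lemma complex_cauchy_cvg u :
  (forall e : R, 0 < e -> exists n0, forall m n, (n0 <= m)%N -> (n0 <= n)%N ->
     rnorm (u m - u n) <= e) -> exists l, scvg u l.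
Proof.
move=> h.
have ReB (x y : C) : complex.Re x - complex.Re y = complex.Re (x - y).
  by case: x y => ? ? [].
have ImB (x y : C) : complex.Im x - complex.Im y = complex.Im (x - y).
  by case: x y => ? ? [].
have [a ha] : exists l : R, forall e : R, 0 < e -> exists n0, forall n, (n0 <= n)%N ->
    `|complex.Re (u n) - l| <= e.
  apply: real_cauchy_cvg => e /h [n hn]; exists n => p q pn qn.
  by rewrite ReB; apply: le_trans (normr_Re_le _) (hn _ _ pn qn).
have [b hb] : exists l : R, forall e : R, 0 < e -> exists n0, forall n, (n0 <= n)%N ->
    `|complex.Im (u n) - l| <= e.
  apply: real_cauchy_cvg => e /h [n hn]; exists n => p q pn qn.
  by rewrite ImB; apply: le_trans (normr_Im_le _) (hn _ _ pn qn).
exists (a +i* b)%C => e e0; have e20 : 0 < e / 2 by lra.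
have [n hn] := ha _ e20; have [n' hn'] := hb _ e20.
exists (maxn n n') => m; rewrite geq_max => /andP[/hn m1 /hn' m2].
apply: le_trans (rnorm_le_ReIm _) _; rewrite -ReB -ImB /=; lra.
Qed.

Lemma half_pow_small (a e : R) : 0 < e -> exists k : nat, a / 2 ^+ k < e.
Proof.
move=> e0; have [n hn] : exists n : nat, a / e < n%:R.
  by exists (Num.bound `|a / e|); apply: le_lt_trans (ler_norm _) (archi_boundP (normr_ge0 _)).
exists n; rewrite ltr_pdivrMr ?exprn_gt0 // mulrC -ltr_pdivrMr //.
apply: (lt_le_trans hn); rewrite -natrX ler_nat; exact: ltnW (ltn_expl _ _).
Qed.

End Limits.

(** * Bisection of squares and intervals *)

Section Cousin.
Context {R : realType}.

(** A square that fails [P] has a failing quarter; nested failing quarters shrink to a point, where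
    the local hypothesis is violated. *)
Lemma cousin2 (P : R -> R -> R -> Prop) :
  (forall s t h, 0 < h -> P s t (h / 2) -> P (s + h / 2) t (h / 2) ->
     P s (t + h / 2) (h / 2) -> P (s + h / 2) (t + h / 2) (h / 2) -> P s t h) ->
  (forall s t, 0 <= s <= 1 -> 0 <= t <= 1 -> exists2 d, 0 < d &
     forall s' t' h, 0 <= s' -> s' + h <= 1 -> 0 <= t' -> t' + h <= 1 ->
       s' <= s <= s' + h -> t' <= t <= t' + h -> 0 < h -> h < d -> P s' t' h) ->
  P 0 0 1.
Proof.
move=> Psplit Ploc; apply: contrapT => nP.
pose bad (x : R * R * R) := ~ P x.1.1 x.1.2 x.2.
pose child (x y : R * R * R) := [/\ y.2 = x.2 / 2,
  y.1.1 = x.1.1 \/ y.1.1 = x.1.1 + x.2 / 2 & y.1.2 = x.1.2 \/ y.1.2 = x.1.2 + x.2 / 2].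
(* The implications sit under the existential so that [choice] yields a total function [next]. *)
have bad_child x : exists y, bad x -> 0 < x.2 -> child x y /\ bad y.
  apply: contrapT => H; have {}H y : ~ (bad x -> 0 < x.2 -> child x y /\ bad y).
    by move=> Hy; apply: H; exists y.
  have badx : bad x by apply: contrapT => nb; apply: (H x).
  have x0 : 0 < x.2 by apply: contrapT => nb; apply: (H x).
  have Q y : child x y -> P y.1.1 y.1.2 y.2.
    by move=> cy; apply: contrapT => by_; apply: (H y).
  apply: badx; apply: Psplit => //.
  - by apply: (Q (x.1.1, x.1.2, x.2 / 2)); split => //=; left.
  - by apply: (Q (x.1.1 + x.2 / 2, x.1.2, x.2 / 2)); split => //=; [right|left].
  - by apply: (Q (x.1.1, x.1.2 + x.2 / 2, x.2 / 2)); split => //=; [left|right].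
  - by apply: (Q (x.1.1 + x.2 / 2, x.1.2 + x.2 / 2, x.2 / 2)); split => //=; right.
have [next hnext] := choice bad_child.
pose x k := iter k next (0, 0, 1).
have hx k : bad (x k) /\ (x k).2 = 2^-1 ^+ k.
  elim: k => [|k [bk ek]]; first by rewrite expr0.
  have k0 : 0 < (x k).2 by rewrite ek exprn_gt0 // invr_gt0.
  have [[-> _ _] bk'] := hnext _ bk k0; split => //.
  by rewrite exprSr ek.
have xpos k : 0 < (x k).2 by rewrite (hx k).2 exprn_gt0 // invr_gt0.
have hc k : child (x k) (x k.+1) by have [] := hnext _ (hx k).1 (xpos k).
(* In each coordinate left endpoints increase and right endpoints decrease, so the supremum of the
   left ones lies in all the intervals. *)
have mono (c : R * R * R -> R) : (forall k, c (x k.+1) = c (x k) \/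
     c (x k.+1) = c (x k) + (x k).2 / 2) -> c (x 0%N) = 0 -> exists2 s, 0 <= s <= 1 &
    forall k, [/\ 0 <= c (x k), c (x k) + (x k).2 <= 1 & c (x k) <= s <= c (x k) + (x k).2].
  move=> cS c0.
  have step k : c (x k) <= c (x k.+1) /\ c (x k.+1) + (x k.+1).2 <= c (x k) + (x k).2.
    have [-> _ _] := hc k; have := xpos k; case: (cS k) => ->; split; lra.
  have up k m : c (x k) <= c (x (k + m)%N).
    elim: m => [|m IH]; first by rewrite addn0.
    by rewrite addnS (le_trans IH) // (step _).1.
  have dn k m : c (x (k + m)%N) + (x (k + m)%N).2 <= c (x k) + (x k).2.
    elim: m => [|m IH]; first by rewrite addn0.
    by rewrite addnS; apply: le_trans (step _).2 IH.
  have key k l : c (x k) <= c (x l) + (x l).2.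
    apply: le_trans (up k l) _.
    apply: le_trans (_ : _ <= c (x (k + l)%N) + (x (k + l)%N).2) _.
      by have := xpos (k + l)%N; lra.
    by rewrite addnC; apply: dn.
  have x01 : (x 0%N).2 = 1 by [].
  pose S := [set c (x k) | k in setT].
  have Sk k : S (c (x k)) by exists k.
  have Sub k : ubound S (c (x k) + (x k).2) by move=> _ [l _ <-]; apply: key.
  have Sne : S !=set0 by exists (c (x 0%N)).
  have Ssup : has_sup S by split => //; exists (c (x 0%N) + (x 0%N).2); apply: Sub.
  have le_s k : c (x k) <= sup S by apply: ub_le_sup (Sk k); case: Ssup.
  have s_le k : sup S <= c (x k) + (x k).2 by apply: ge_sup.
  exists (sup S); first by have := le_s 0%N; have := s_le 0%N; rewrite c0 x01 add0r => -> ->.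
  move=> k; rewrite le_s s_le; split => //.
    by have := up 0%N k; rewrite add0n c0.
  by have := dn 0%N k; rewrite add0n c0 x01 add0r.
have [s s01 hs] := mono (fun y => y.1.1) (fun k => let: And3 _ h _ := hc k in h) erefl.
have [t t01 ht] := mono (fun y => y.1.2) (fun k => let: And3 _ _ h := hc k in h) erefl.
have [d d0 hd] := Ploc _ _ s01 t01.
have [k hk] := half_pow_small 1 d0.
have [s1 s2 s3] := hs k; have [t1 t2 t3] := ht k.
apply: (hx k).1; apply: hd => //; rewrite (hx k).2 //.
by rewrite exprVn -div1r.
Qed.

Lemma cousin1 (P : R -> R -> Prop) :
  (forall s h, 0 < h -> P s (h / 2) -> P (s + h / 2) (h / 2) -> P s h) ->
  (forall s, 0 <= s <= 1 -> exists2 d, 0 < d &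
     forall s' h, 0 <= s' -> s' + h <= 1 ->
       s' <= s <= s' + h -> 0 < h -> h < d -> P s' h) ->
  P 0 1.
Proof.
move=> Psplit Ploc; apply: (@cousin2 (fun s _ h => P s h)).
  by move=> s _ h h0 p1 p2 _ _; apply: Psplit.
move=> s t s01 _; have [d d0 hd] := Ploc _ s01; exists d => // s' t' h ? ? _ _ ? _.
exact: hd.
Qed.

End Cousin.

(** * Complex differentiability *)

Section Epsilon.
Context {R : realType}.
Local Notation C := (R[i]).

Lemma complex_gt0E (e : C) : 0 < e -> exists2 r : R, 0 < r & e = r%:C%C.
Proof.
move=> e0; exists (complex.Re e); last by rewrite RRe_real // gtr0_real.
by move: e0; rewrite ltcE => /andP[].
Qed.

Context {V : normedModType C}.
Implicit Types (x y h : V) (P : set V).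

Lemma nbhs_rnormP x P : nbhs x P <->
  exists2 d : R, 0 < d & forall y, rnorm (y - x) < d -> P y.
Proof.
split.
  move=> /nbhs_normP [e /= e0 he]; have [r r0 er] := complex_gt0E e0.
  by exists r => // y hy; apply: he; rewrite /= er distrC normE ltcR.
move=> [d d0 hd]; apply/nbhs_normP; exists (d%:C%C); first by rewrite /= ltcR.
by move=> y /=; rewrite distrC normE ltcR => /hd.
Qed.

Definition ctn (f : V -> C) x := forall e : R, 0 < e ->
  exists2 d : R, 0 < d & forall y, rnorm (y - x) < d -> rnorm (f y - f x) <= e.

(** The interface to the library's differential: little-o over [R[i]] becomes an estimate with real
    [e] and [d], and continuity of the linear part becomes the bound [B]. *)
Lemma diff_epsP (f : V -> C^o) x : differentiable f x <->
  exists L : V -> C, [/\ {morph L : u v / u + v}, forall c u, L (c *: u) = c * L u,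
    exists B, forall u, rnorm (L u) <= B * rnorm u &
    forall e : R, 0 < e -> exists2 d : R, 0 < d &
      forall h, rnorm h < d -> rnorm (f (x + h) - f x - L h) <= e * rnorm h].
Proof.
split.
  move=> /diff_locallyP [Lc /eqaddoP df]; exists ('d f x); split.
  - by move=> u v; rewrite linearD.
  - by move=> c u; rewrite linearZ.
  - have := Lc 0; move/cvgrPdist_le => /(_ 1 ltr01) /nbhs_rnormP [d d0 hd].
    exists (2 / d) => u; have [->|u0] := eqVneq u 0.
      by rewrite linear0 !rnorm0 mulr0.
    have nu : 0 < rnorm u by rewrite rnorm_gt0.
    (* Rescaled to length [d / 2], the vector [u] lies in the ball where the differential is at most
       1; hence the bound [2 / d]. *)
    pose c : R := d / (2 * rnorm u).
    have c0 : 0 < c by rewrite divr_gt0 // mulr_gt0.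
    have := hd (c%:C%C *: u); rewrite subr0 linear0 linearZ sub0r normrN.
    rewrite rnormZ rnormR gtr0_norm //.
    have -> : c * rnorm u = d / 2 by rewrite /c; field; rewrite gt_eqF.
    move=> /(_ ltac:(lra)). rewrite normrZ !normE rnormR gtr0_norm //.
    rewrite -rmorphM /= lecR => h.
    rewrite -(ler_pM2l c0); apply: (le_trans h).
    by rewrite /c le_eqVlt; apply/orP; left; apply/eqP; field; rewrite !gt_eqF.
  - move=> e e0; have /df /nbhs_rnormP [d d0 hd] : 0 < (e%:C%C : C) by rewrite ltcR.
    exists d => // h hh; have := hd h; rewrite subr0 => /(_ hh) /=.
    rewrite /= !normE -rmorphM lecR; apply: le_trans.
    rewrite /= [x + h]addrC !fctE /= [f x + _]addrC opprD addrA addrAC.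
    by rewrite le_eqVlt eqxx.
move=> [L [LD LZ [B LB] Ld]].
have Llin : linear (L : V -> C^o) by move=> c u v; rewrite LD LZ.
pose Lm : {linear V -> C^o} := HB.pack (L : V -> C^o)
  (@GRing.isLinear.Build C V C^o *:%R (L : V -> C^o) Llin).
have Lc : continuous Lm.
  move=> y; apply/cvgrPdist_le => e /complex_gt0E [r r0 ->].
  apply/nbhs_rnormP; exists (r / (`|B| + 1)); first by rewrite divr_gt0 // ltr_wpDl.
  move=> z hz; rewrite -linearB /= normE lecR (le_trans (LB _)) // rdistC.
  apply: le_trans (ler_wpM2r (rnorm_ge0 _) (ler_norm B)) _.
  apply: le_trans (ler_wpM2l (normr_ge0 _) (ltW hz)) _.
  rewrite mulrCA; apply: ler_piMr; first exact: ltW.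
  by rewrite ler_pdivrMr ?mul1r ?ltr_wpDl // lerDl.
have H : f \o shift x = cst (f x) + Lm +o_ 0 id.
  apply/eqaddoP => e /complex_gt0E [r r0 ->]; have [d d0 hd] := Ld _ r0.
  apply/nbhs_rnormP; exists d => // h; rewrite subr0 => hh.
  rewrite /= !normE -rmorphM lecR; apply: le_trans (hd _ hh).
  rewrite /= [x + h]addrC !fctE /= opprD addrA.
  by rewrite le_eqVlt eqxx.
apply/diff_locallyP; have -> := diff_unique Lc H; split => //.
Qed.

Lemma diff_ctn (f : V -> C^o) x : differentiable f x -> ctn f x.
Proof.
move=> /differentiable_continuous /cvgrPdist_le fc e e0.
have /fc /nbhs_rnormP [d d0 hd] : 0 < (e%:C%C : C) by rewrite ltcR.
by exists d => // y /hd; rewrite normE lecR rdistC.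
Qed.

Lemma near_eq_differentiable (f g : V -> C^o) x :
  (exists2 d : R, 0 < d & forall y, rnorm (y - x) < d -> f y = g y) ->
  differentiable f x -> differentiable g x.
Proof.
move=> [d d0 fg] /diff_epsP [L [? ? ? Ld]]; apply/diff_epsP; exists L; split => //.
move=> e /Ld [d' d'0 hd']; exists (Num.min d d'); first by rewrite lt_min d0.
move=> h; rewrite lt_min => /andP[h1 h2].
by rewrite -!fg ?hd' // ?subrr ?rnorm0 // addrC addKr.
Qed.

End Epsilon.

Section OneVariable.
Context {R : realType}.
Local Notation C := (R[i]).
Implicit Types (g f : C -> C) (a b p w z : C).

Definition cdiff g a := differentiable (g : C^o -> C^o) (a : C^o).

Lemma cdiffP g a : cdiff g a ->
  exists l, forall e : R, 0 < e -> exists2 d : R, 0 < d & forall b, rnorm (b - a) < d ->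
      rnorm (g b - g a - l * (b - a)) <= e * rnorm (b - a).
Proof.
move=> /diff_epsP [L [LD LZ _ Ld]]; exists (L 1) => e /Ld [d d0 hd]; exists d => // b /hd.
rewrite [a + _]addrC subrK.
have -> : L (b - a) = L 1 * (b - a).
  by rewrite mulrC -LZ; congr L; rewrite -[RHS]/(_ * _) mulr1.
by [].
Qed.

Lemma cdiff_ctn g a : cdiff g a -> ctn (g : C^o -> C) (a : C^o).
Proof. exact: diff_ctn. Qed.

Lemma cdiff_cst c a : cdiff (fun=> c) a.
Proof. exact: differentiable_cst. Qed.

Lemma cdiff_id a : cdiff id a.
Proof. by have [] := @is_diff_id C C^o a. Qed.

Lemma cdiffB g f a : cdiff g a -> cdiff f a -> cdiff (fun z => g z - f z) a.
Proof. exact: differentiableB. Qed.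

Lemma cdiffM g f a : cdiff g a -> cdiff f a -> cdiff (fun z => g z * f z) a.
Proof. exact: differentiableM. Qed.

Lemma cdiffV g a : g a != 0 -> cdiff g a -> cdiff (fun z => (g z)^-1) a.
Proof. by move=> g0 dg; exact: (@differentiableV C C^o (g : C^o -> C) (a : C^o) dg g0). Qed.

Lemma cdiff_div g f a : f a != 0 -> cdiff g a -> cdiff f a -> cdiff (fun z => g z / f z) a.
Proof. by move=> f0 dg df; exact: (cdiffM dg (cdiffV f0 df)). Qed.

Lemma cdiff_subr b a : cdiff (fun z => z - b) a.
Proof. by apply: cdiffB; [exact: cdiff_id | exact: cdiff_cst]. Qed.

Lemma cdiff_line (V : normedModType C) (f : V -> C^o) (x v : V) a :
  differentiable f (x + a *: v) -> cdiff (fun z => f (x + z *: v)) a.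
Proof.
by move=> df; apply: (@differentiable_comp C C^o V C^o (fun z : C^o => x + z *: v) f).
Qed.

End OneVariable.

(** * Integration along segments *)

Section Integral.
Context {R : realType}.
Local Notation C := (R[i]).
Local Notation "r %:C" := (r%:C%C : C).
Implicit Types (g f : C -> C) (a b p w v z : C) (s t h e M : R).

(** The mean of [g] at the left endpoints of 2^k equal pieces of the segment from [p] to [p + w];
    the recursion by halves fits bisection. *)
Fixpoint dsum k g p w : C :=
  if k is k'.+1 then (dsum k' g p (w / 2) + dsum k' g (p + w / 2) (w / 2)) / 2 else g p.

(* The integral of [g] along the segment from [p] to [p + w], as the limit of the dyadic
   left Riemann sums; a junk value if these do not converge. *)
Definition cint g p w := w * slim (fun k => dsum k g p w).

Definition cseg g p w := forall s, 0 <= s <= 1 -> ctn (g : C^o -> C) (p + s%:C * w : C^o).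

Lemma halfC : (2^-1)%:C = 2^-1.
Proof. by rewrite fmorphV rmorph_nat. Qed.

Lemma left_half s p w : p + s%:C * (w / 2) = p + (s / 2)%:C * w.
Proof. by rewrite rmorphM /= halfC; ring. Qed.

Lemma right_half s p w : p + w / 2 + s%:C * (w / 2) = p + ((1 + s) / 2)%:C * w.
Proof. by rewrite rmorphM /= halfC rmorphD /=; field. Qed.

Lemma seg_half (P : C -> Prop) p w : (forall s, 0 <= s <= 1 -> P (p + s%:C * w)) ->
  (forall s, 0 <= s <= 1 -> P (p + s%:C * (w / 2))) /\
  (forall s, 0 <= s <= 1 -> P (p + w / 2 + s%:C * (w / 2))).
Proof.
move=> h; split=> s s01; first by rewrite left_half; apply: h; lra.
by rewrite right_half; apply: h; lra.
Qed.

Lemma dsum_avg k g p w v e : (forall s, 0 <= s <= 1 -> rnorm (g (p + s%:C * w) - v) <= e) ->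
  rnorm (dsum k g p w - v) <= e.
Proof.
elim: k p w => [|k IH] p w h /=.
  by have := h 0; rewrite mul0r addr0 lexx ler01 => /(_ isT).
have [/IH h1 /IH h2] := seg_half (P := fun z => rnorm (g z - v) <= e) h.
set A := dsum _ _ _ _ in h1 *; set B := dsum _ _ _ _ in h2 *.
have -> : (A + B) / 2 - v = ((A - v) + (B - v)) * (2^-1)%:C.
  by rewrite halfC; field.
rewrite rnormM rnormR gtr0_norm ?invr_gt0 //.
have := ler_rnormD (A - v) (B - v); lra.
Qed.

Lemma dsum_ext k g f p w : (forall s, 0 <= s <= 1 -> g (p + s%:C * w) = f (p + s%:C * w)) ->
  dsum k g p w = dsum k f p w.
Proof.
elim: k p w => [|k IH] p w h /=.
  by have := h 0; rewrite mul0r addr0 lexx ler01 => /(_ isT).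
have [/IH -> /IH ->] := seg_half (P := fun z => g z = f z) h.
by [].
Qed.

Lemma cint_ext g f p w : (forall s, 0 <= s <= 1 -> g (p + s%:C * w) = f (p + s%:C * w)) ->
  cint g p w = cint f p w.
Proof. by move=> h; congr (_ * slim _); apply/funext => k; apply: dsum_ext. Qed.

Lemma dsum_cauchy_small g p w x e :
  (forall s, 0 <= s <= 1 -> rnorm (g (p + s%:C * w) - g x) <= e / 2) ->
  forall m n, rnorm (dsum m g p w - dsum n g p w) <= e.
Proof.
move=> h m n; have := dsum_avg m h; have := dsum_avg n h.
have := ler_rdistD (g x) (dsum m g p w) (dsum n g p w).
rewrite (rdistC (g x)); lra.
Qed.

Lemma seg_small g p w s0 e : ctn (g : C^o -> C) (p + s0%:C * w : C^o) -> 0 < e ->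
  exists2 d : R, 0 < d & forall s h, s <= s0 <= s + h -> 0 < h -> h < d ->
    forall t, 0 <= t <= 1 ->
    rnorm (g (p + s%:C * w + t%:C * (h%:C * w)) - g (p + s0%:C * w)) <= e.
Proof.
move=> cg e0; have [d d0 hd] := cg _ e0.
have w0 := rnorm_ge0 w.
exists (d / (rnorm w + 1)); first by rewrite divr_gt0 //; lra.
move=> s h ss h0 hlt t t01; apply: hd.
have -> : p + s%:C * w + t%:C * (h%:C * w) - (p + s0%:C * w) = (s + t * h - s0)%:C * w.
  by rewrite rmorphB rmorphD rmorphM /=; ring.
rewrite rnormM rnormR.
have : `|s + t * h - s0| <= h.
  have : t * h <= h by rewrite ler_piMl //; lra.
  have : 0 <= t * h by apply: mulr_ge0 => //; lra.
  by rewrite ler_norml; lra.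
move=> /(ler_wpM2r w0) /le_lt_trans; apply.
move: hlt; rewrite ltr_pdivlMr; last by lra.
by apply: le_lt_trans; rewrite ler_pM2l //; lra.
Qed.

Lemma seg_splitE s h p w : p + (s + h / 2)%:C * w = p + s%:C * w + (h%:C * w) / 2.
Proof. by rewrite rmorphD rmorphM /= halfC; ring. Qed.

Lemma half_mulE h w : (h / 2)%:C * w = h%:C * w / 2.
Proof. by rewrite rmorphM /= halfC; ring. Qed.

(** Bisection on the Cauchy property with a fixed [e]: the next sum is the average of the sums over
    the halves, so [e] is not doubled, and on a short piece all values of [g] are within [e / 2] of
    a single one. *)
Lemma dsum_cvg g p w : cseg g p w -> exists l, scvg (fun k => dsum k g p w) l.
Proof.
move=> cg; apply: complex_cauchy_cvg => e e0.
pose P s h := exists n0, forall m n, (n0 <= m)%N -> (n0 <= n)%N ->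
  rnorm (dsum m g (p + s%:C * w) (h%:C * w) - dsum n g (p + s%:C * w) (h%:C * w)) <= e.
suff : P 0 1 by rewrite /P rmorph0 rmorph1 mul0r mul1r addr0.
apply: cousin1.
  move=> s h h0; rewrite /P seg_splitE half_mulE => -[n1 h1] [n2 h2].
  exists (maxn n1 n2).+1 => -[//|m] [//|n]; rewrite !ltnS !geq_max.
  move=> /andP[m1 m2] /andP[k1 k2] /=.
  have := h1 _ _ m1 k1; have := h2 _ _ m2 k2.
  set A := dsum _ _ _ _; set B := dsum _ _ _ _; set A' := dsum _ _ _ _; set B' := dsum _ _ _ _.
  move=> hA hA'.
  have -> : (A' + A) / 2 - (B' + B) / 2 = ((A' - B') + (A - B)) * (2^-1)%:C.
    by rewrite halfC; field.
  rewrite rnormM rnormR gtr0_norm ?invr_gt0 //.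
  have := ler_rnormD (A' - B') (A - B); lra.
move=> s0 s01; have e2 : 0 < e / 2 by lra.
have [d d0 hd] := seg_small (cg _ s01) e2.
exists d => // s h _ _ ss h0 hlt; exists 0%N => m n _ _.
by apply: dsum_cauchy_small; apply: hd.
Qed.

Lemma cint_scvg g p w : cseg g p w ->
  scvg (fun k => w * dsum k g p w) (cint g p w).
Proof. by move=> /dsum_cvg [l hl]; rewrite /cint (slimE hl); apply: scvgM. Qed.

Lemma cint_eq g p w l : scvg (fun k => dsum k g p w) l -> cint g p w = w * l.
Proof. by rewrite /cint => /slimE ->. Qed.

Lemma dsumD k g f p w : dsum k (fun z => g z + f z) p w = dsum k g p w + dsum k f p w.
Proof. by elim: k p w => [//|k IH] p w /=; rewrite !IH; ring. Qed.

Lemma dsumZ k c g p w : dsum k (fun z => c * g z) p w = c * dsum k g p w.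
Proof. by elim: k p w => [//|k IH] p w /=; rewrite !IH; ring. Qed.

Lemma cintD g f p w : cseg g p w -> cseg f p w ->
  cint (fun z => g z + f z) p w = cint g p w + cint f p w.
Proof.
move=> /dsum_cvg [l hl] /dsum_cvg [l' hl'].
rewrite (cint_eq hl) (cint_eq hl') -mulrDr; apply: cint_eq.
rewrite (_ : (fun k => _) = fun k => dsum k g p w + dsum k f p w); first exact: scvgD.
by apply/funext => k; rewrite dsumD.
Qed.

Lemma cintZ c g p w : cseg g p w -> cint (fun z => c * g z) p w = c * cint g p w.
Proof.
move=> /dsum_cvg [l hl].
rewrite (cint_eq hl) mulrCA; apply: cint_eq.
rewrite (_ : (fun k => _) = fun k => c * dsum k g p w); first exact: scvgM.
by apply/funext => k; rewrite dsumZ.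
Qed.

Lemma cint_cst c p w : cint (fun=> c) p w = w * c.
Proof.
apply: cint_eq; rewrite (_ : (fun k => _) = fun=> c); first exact: scvg_cst.
apply/funext => k; elim: k p w => [//|k IH] p w /=; rewrite !IH.
by field.
Qed.

Lemma cint_id p w : cint id p w = w * (p + w / 2).
Proof.
apply: cint_eq => e e0; have [k hk] := half_pow_small (rnorm (w / 2)) e0.
exists k => n kn.
have -> : dsum n id p w = p + w / 2 - (w / 2) * (2^-1 ^+ n).
  elim: n p w {hk kn} => [|n IH] p w /=; first by rewrite expr0; ring.
  by rewrite !IH exprS; field.
have -> : (2^-1 ^+ n : C) = (2^-1 ^+ n)%:C by rewrite rmorphXn /= halfC.
rewrite addrAC subrr sub0r rnormN rnormM rnormR.
rewrite ger0_norm ?exprn_ge0 ?invr_ge0 // exprVn.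
apply: le_trans (ltW hk); rewrite ler_wpM2l ?rnorm_ge0 // lef_pV2 ?posrE ?exprn_gt0 //.
by apply: ler_weXn2l => //; rewrite ler1n.
Qed.

Lemma cseg_half g p w : cseg g p w -> cseg g p (w / 2) /\ cseg g (p + w / 2) (w / 2).
Proof. exact: (@seg_half (fun z => ctn (g : C^o -> C) (z : C^o))). Qed.

Lemma cint_halves g p w : cseg g p w ->
  cint g p w = cint g p (w / 2) + cint g (p + w / 2) (w / 2).
Proof.
move=> /cseg_half [/dsum_cvg [l hl] /dsum_cvg [l' hl']].
rewrite (cint_eq hl) (cint_eq hl') -mulrDr.
have -> : w / 2 * (l + l') = w * (2^-1 * (l + l')) by ring.
apply: cint_eq; apply: scvg_unshift => /=.
rewrite (_ : (fun k => _) = fun k => 2^-1 * (dsum k g p (w / 2) + dsum k g (p + w / 2) (w / 2))).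
  by apply: scvgM; apply: scvgD.
by apply/funext => k; rewrite mulrC.
Qed.

Lemma cint_le g p w M : cseg g p w -> (forall s, 0 <= s <= 1 -> rnorm (g (p + s%:C * w)) <= M) ->
  rnorm (cint g p w) <= rnorm w * M.
Proof.
move=> /cint_scvg hc hM; apply: scvg_le hc _ => k.
rewrite rnormM ler_wpM2l ?rnorm_ge0 //.
rewrite -[dsum _ _ _ _]subr0; apply: dsum_avg => s /hM; by rewrite subr0.
Qed.

Lemma cint_scale g a v p w : cint g (a + v * p) (v * w) = v * cint (fun z => g (a + v * z)) p w.
Proof.
rewrite /cint -mulrA; congr (v * (w * slim _)); apply/funext => k.
elim: k p w => [//|k IH] p w /=.
by rewrite -IH -IH mulrDr addrA -!mulrA.
Qed.

End Integral.

(** * Squares and Goursat's theorem *)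

Section Continuity.
Context {R : realType} {V : normedModType R[i]}.
Local Notation C := (R[i]).
Implicit Types (g f : V -> C) (x : V).

Lemma ctnP g x : ctn g x <-> (g : V -> C^o) @ x --> (g x : C^o).
Proof.
split=> [cg|/cvgrPdist_le cg e e0].
  apply/cvgrPdist_le => e /complex_gt0E [r r0 ->]; have [d d0 hd] := cg _ r0.
  by apply/nbhs_rnormP; exists d => // y /hd; rewrite normE lecR rdistC.
have /cg /nbhs_rnormP [d d0 hd] : 0 < (e%:C%C : C) by rewrite ltcR.
by exists d => // y /hd; rewrite normE lecR rdistC.
Qed.

Lemma ctn_cst (c : C) x : ctn (fun=> c) x.
Proof. by apply/ctnP; exact: cvg_cst. Qed.

Lemma ctnD g f x : ctn g x -> ctn f x -> ctn (fun z => g z + f z) x.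
Proof. by move=> /ctnP cg /ctnP cf; apply/ctnP; exact: (@cvgD C C^o _ _ _ g f _ _ cg cf). Qed.

Lemma ctnM g f x : ctn g x -> ctn f x -> ctn (fun z => g z * f z) x.
Proof. by move=> /ctnP cg /ctnP cf; apply/ctnP; exact: (@cvgM C _ _ _ g f _ _ cg cf). Qed.

Lemma ctnB g f x : ctn g x -> ctn f x -> ctn (fun z => g z - f z) x.
Proof. by move=> /ctnP cg /ctnP cf; apply/ctnP; exact: (@cvgB C C^o _ _ _ g f _ _ cg cf). Qed.

End Continuity.

Section Square.
Context {R : realType}.
Local Notation C := (R[i]).
Local Notation "r %:C" := (r%:C%C : C).
Local Notation I := ('i%C : C).
Implicit Types (g f : C -> C) (a b p w v z : C) (s t h e M : R).

(** The counterclockwise boundary integral of the square with corner [p] and first side [w]; the far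
    edge and the last edge run backwards, hence the signs. *)
Definition sq g p w := cint g p w + cint g (p + w) (I * w)
  - cint g (p + I * w) w - cint g p (I * w).

Definition onedges (P : C -> Prop) p w := forall s, 0 <= s <= 1 ->
  [/\ P (p + s%:C * w), P (p + w + s%:C * (I * w)),
      P (p + I * w + s%:C * w) & P (p + s%:C * (I * w))].

Definition csq g p w := onedges (fun z => ctn (g : C^o -> C) (z : C^o)) p w.

Definition pt p w s t : C := p + (s +i* t)%C * w.

Definition onsq (P : C -> Prop) p w := forall s t, 0 <= s <= 1 -> 0 <= t <= 1 -> P (pt p w s t).

Lemma cplxE s t : (s +i* t)%C = s%:C + I * t%:C.
Proof. exact: complexE. Qed.

Lemma ptE p w s t : pt p w s t = p + s%:C * w + t%:C * (I * w).
Proof. by rewrite /pt (cplxE s t); ring. Qed.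

Lemma pt_sub p w s t h s' t' :
  pt (pt p w s t) (h%:C * w) s' t' = pt p w (s + h * s') (t + h * t').
Proof. by rewrite !ptE !rmorphD !rmorphM /=; ring. Qed.

Lemma onedges_onsq (P : C -> Prop) p w : onsq P p w -> onedges P p w.
Proof.
move=> h s s01; have z01 : 0 <= (0 : R) <= 1 by rewrite lexx ler01.
have o01 : 0 <= (1 : R) <= 1 by rewrite lexx ler01.
split.
- by have := h s 0 s01 z01; rewrite ptE rmorph0 mul0r addr0.
- by have := h 1 s o01 s01; rewrite ptE rmorph1 mul1r.
- by have := h s 1 s01 o01; rewrite ptE rmorph1 mul1r addrAC.
- by have := h 0 s z01 s01; rewrite ptE rmorph0 mul0r addr0.
Qed.

Lemma onedges_sub (P Q : C -> Prop) p w : (forall z, P z -> Q z) -> onedges P p w -> onedges Q p w.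
Proof. by move=> PQ h s /h [? ? ? ?]; split; apply: PQ. Qed.

Lemma onsq_sub (P : C -> Prop) p w s t h : 0 <= s -> 0 <= t -> 0 <= h -> s + h <= 1 -> t + h <= 1 ->
  onsq P p w -> onsq P (pt p w s t) (h%:C * w).
Proof.
move=> s0 t0 h0 sh th H s' t' s'01 t'01; rewrite pt_sub; apply: H.
  have : h * s' <= h by rewrite ler_piMr //; lra.
  have : 0 <= h * s' by apply: mulr_ge0 => //; lra.
  lra.
have : h * t' <= h by rewrite ler_piMr //; lra.
have : 0 <= h * t' by apply: mulr_ge0 => //; lra.
lra.
Qed.

Lemma csq_segs g p w : csq g p w ->
  [/\ cseg g p w, cseg g (p + w) (I * w), cseg g (p + I * w) w & cseg g p (I * w)].
Proof. by move=> h; split=> s /h []. Qed.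

Lemma sq_ext g f p w : onedges (fun z => g z = f z) p w -> sq g p w = sq f p w.
Proof.
by move=> h; rewrite /sq; congr (_ + _ - _ - _); apply: cint_ext => s /h [].
Qed.

Lemma sqD g f p w : csq g p w -> csq f p w -> sq (fun z => g z + f z) p w = sq g p w + sq f p w.
Proof.
by move=> /csq_segs [? ? ? ?] /csq_segs [? ? ? ?]; rewrite /sq !cintD //; ring.
Qed.

Lemma sqZ c g p w : csq g p w -> sq (fun z => c * g z) p w = c * sq g p w.
Proof. by move=> /csq_segs [? ? ? ?]; rewrite /sq !cintZ //; ring. Qed.

Lemma sqB g f p w : csq g p w -> csq f p w -> sq (fun z => g z - f z) p w = sq g p w - sq f p w.
Proof.
move=> cg cf; rewrite -[sq f p w]mul1r -mulNr -sqZ // -sqD //.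
  by apply: sq_ext => s _; split; ring.
by move=> s /cf [? ? ? ?]; split; apply: ctnM => //; apply: ctn_cst.
Qed.

Lemma sq_le g p w M : csq g p w -> onedges (fun z => rnorm (g z) <= M) p w ->
  rnorm (sq g p w) <= 4 * rnorm w * M.
Proof.
move=> /csq_segs [c1 c2 c3 c4] h.
have wI : rnorm (I * w) = rnorm w by rewrite rnormM rnorm_i mul1r.
have h1 : rnorm (cint g p w) <= rnorm w * M by apply: cint_le => // s /h [].
have h2 : rnorm (cint g (p + w) (I * w)) <= rnorm w * M.
  by rewrite -wI; apply: cint_le => // s /h [].
have h3 : rnorm (cint g (p + I * w) w) <= rnorm w * M by apply: cint_le => // s /h [].
have h4 : rnorm (cint g p (I * w)) <= rnorm w * M.
  by rewrite -wI; apply: cint_le => // s /h [].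
rewrite /sq.
have := ler_rnormB (cint g p w + cint g (p + w) (I * w) - cint g (p + I * w) w) (cint g p (I * w)).
have := ler_rnormB (cint g p w + cint g (p + w) (I * w)) (cint g (p + I * w) w).
have := ler_rnormD (cint g p w) (cint g (p + w) (I * w)).
lra.
Qed.

(** The integral of an affine function along a segment is explicit, and the four edges cancel
    because [I * I = -1]. *)
Lemma sq_affine (c l : C) p w : sq (fun z => c + l * z) p w = 0.
Proof.
have cl q v : cint (fun z => c + l * z) q v = v * c + l * (v * (q + v / 2)).
  rewrite cintD ?cintZ ?cint_cst ?(cint_id q v) //.
  - by move=> s _; exact: (cdiff_ctn (cdiff_id _)).
  - by move=> s _; exact: ctn_cst.
  - move=> s _; apply: ctnM; first exact: ctn_cst.
    exact: (cdiff_ctn (cdiff_id _)).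
rewrite /sq !cl.
have iw q : I * w * (q + I * w / 2) = I * w * q - w * w / 2.
  by transitivity (I * w * q + (I * I) * (w * w / 2)); [ring|rewrite mulCi_i; ring].
rewrite !iw.
by field.
Qed.

Lemma sq_scale g a v p w : sq g (a + v * p) (v * w) = v * sq (fun z => g (a + v * z)) p w.
Proof.
rewrite /sq.
have -> : a + v * p + v * w = a + v * (p + w) by ring.
have -> : I * (v * w) = v * (I * w) by ring.
have -> : a + v * p + v * (I * w) = a + v * (p + I * w) by ring.
by rewrite !cint_scale; ring.
Qed.

Lemma sq_quarters g p w : csq g p w -> cseg g (p + I * (w / 2)) w -> cseg g (p + w / 2) (I * w) ->
  sq g p w = sq g p (w / 2) + sq g (p + w / 2) (w / 2) + sq g (p + I * (w / 2)) (w / 2)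
    + sq g (p + w / 2 + I * (w / 2)) (w / 2).
Proof.
move=> /csq_segs [c1 c2 c3 c4] cm cv.
rewrite /sq (cint_halves c1) (cint_halves c2) (cint_halves c3) (cint_halves c4).
have := cint_halves cm; have := cint_halves cv.
have -> : I * w / 2 = I * (w / 2) by ring.
have -> : p + I * (w / 2) + w / 2 = p + w / 2 + I * (w / 2) by ring.
have -> : p + w / 2 + w / 2 = p + w by field.
have -> : p + I * (w / 2) + I * (w / 2) = p + I * w by field.
have -> : p + w / 2 + I * (w / 2) + w / 2 = p + w + I * (w / 2) by field.
have -> : p + w / 2 + I * (w / 2) + I * (w / 2) = p + I * w + w / 2 by field.
by move=> _ _; ring.
Qed.

Lemma onsq_midlines (P : C -> Prop) p w : onsq P p w ->
  (forall s, 0 <= s <= 1 -> P (p + I * (w / 2) + s%:C * w)) /\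
  (forall s, 0 <= s <= 1 -> P (p + w / 2 + s%:C * (I * w))).
Proof.
move=> h; have z01 : 0 <= (2^-1 : R) <= 1 by rewrite invr_ge0 ler0n invf_le1 ?ler1n.
split=> s s01; first by have := h s _ s01 z01; rewrite ptE halfC [2^-1 * _]mulrC -mulrA addrAC.
by have := h _ s z01 s01; rewrite ptE halfC [2^-1 * _]mulrC.
Qed.

Definition cnt1 (s h x : R) : R := ((s <= x) && (x < s + h))%:R + ((s < x) && (x <= s + h))%:R.

Lemma cnt1_half s h x : 0 < h -> cnt1 s h x = cnt1 s (h / 2) x + cnt1 (s + h / 2) (h / 2) x.
Proof.
move=> h0; rewrite /cnt1 (_ : s + h / 2 + h / 2 = s + h); last by lra.
case: (ltgtP s x) => sx; case: (ltgtP x (s + h)) => xh; case: (ltgtP x (s + h / 2)) => xm /=;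
  rewrite ?addr0 ?add0r //; lra.
Qed.

Lemma cnt1_ge0 s h x : 0 <= cnt1 s h x.
Proof. by rewrite addr_ge0 ?ler0n. Qed.

Lemma cnt1_ge1 s h x : 0 < h -> s <= x <= s + h -> 1 <= cnt1 s h x.
Proof.
move=> h0 /andP[]; rewrite /cnt1.
by case: (ltgtP s x) => sx; case: (ltgtP x (s + h)) => xh //= _ _; lra.
Qed.

Lemma cnt1_le2 s h x : cnt1 s h x <= 2.
Proof.
rewrite -[2]/(1 + 1)%:R natrD lerD // ?lern1; by case: (_ && _).
Qed.

(* [cnt1 s h x] counts [x] in [s, s+h) and in (s, s+h]: an exactly additive set function that
   is at least 1 on every closed interval containing [x]; it pays for the exceptional point. *)
Lemma goursat g p w s0 t0 : onsq (fun z => ctn (g : C^o -> C) (z : C^o)) p w ->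
  (forall s t, 0 <= s <= 1 -> 0 <= t <= 1 -> (s, t) <> (s0, t0) -> cdiff g (pt p w s t)) ->
  sq g p w = 0.
Proof.
move=> cg dg.
have W0 := rnorm_ge0 w; set W := rnorm w in W0 *.
suff H e : 0 < e -> rnorm (sq g p w) <= e + e * (2 * 2).
  apply: rnorm_small => e e0; apply: le_trans (H (e / 5) _) _; lra.
move=> e0.
pose cn s t h := cnt1 s h s0 * cnt1 t h t0.
(* Both terms are additive under quartering, the area as well as [cn], whose total on the unit
   square is at most 4. *)
pose P s t h := 0 <= s -> 0 <= t -> s + h <= 1 -> t + h <= 1 ->
  rnorm (sq g (pt p w s t) (h%:C * w)) <= e * h ^+ 2 + e * cn s t h.
suff : P 0 0 1.
  rewrite /P ptE rmorph1 mul1r !mul0r !addr0 add0r lexx expr1n mulr1 => /(_ isT isT (lexx _) (lexx _)).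
  move/le_trans; apply; rewrite lerD2l ler_pM2l //.
  by apply: ler_pM; rewrite ?cnt1_ge0 ?cnt1_le2.
apply: cousin2.
  move=> s t h h0 P1 P2 P3 P4 s1 t1 sh th.
  have hh : s + h / 2 + h / 2 = s + h by lra.
  have hh' : t + h / 2 + h / 2 = t + h by lra.
  have {}P1 := P1 s1 t1 ltac:(lra) ltac:(lra).
  have {}P2 := P2 ltac:(lra) t1 ltac:(lra) ltac:(lra).
  have {}P3 := P3 s1 ltac:(lra) ltac:(lra) ltac:(lra).
  have {}P4 := P4 ltac:(lra) ltac:(lra) ltac:(lra) ltac:(lra).
  have {}cg := onsq_sub s1 t1 (ltW h0) sh th cg.
  have [cm cv] := onsq_midlines cg.
  rewrite (sq_quarters (onedges_onsq cg) cm cv) /cn (cnt1_half s s0 h0) (cnt1_half t t0 h0).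
  have -> : pt p w s t + h%:C * w / 2 = pt p w (s + h / 2) t.
    by rewrite !ptE rmorphD rmorphM /= halfC; ring.
  have -> : pt p w s t + I * (h%:C * w / 2) = pt p w s (t + h / 2).
    by rewrite !ptE rmorphD rmorphM /= halfC; ring.
  have -> : pt p w (s + h / 2) t + I * (h%:C * w / 2) = pt p w (s + h / 2) (t + h / 2).
    by rewrite !ptE !rmorphD rmorphM /= halfC; ring.
  rewrite -half_mulE.
  move: P1 P2 P3 P4; rewrite /cn.
  set A := sq _ _ _; set B := sq _ _ _; set D := sq _ _ _; set E := sq _ _ _.
  have := ler_rnormD (A + B + D) E; have := ler_rnormD (A + B) D; have := ler_rnormD A B.
  move: (rnorm _) (rnorm _) (rnorm _) (rnorm _) (rnorm _) (rnorm _) (rnorm _) => *.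
  nra.
move=> s t s01 t01; have := cg s t s01 t01.
have box (s' t' h x y : R) : s' <= s <= s' + h -> t' <= t <= t' + h ->
    0 <= x <= 1 -> 0 <= y <= 1 -> 0 < h ->
    rnorm (pt (pt p w s' t') (h%:C * w) x y - pt p w s t) <= 2 * h * W.
  move=> hs ht x01 y01 h0; rewrite pt_sub.
  have -> : pt p w (s' + h * x) (t' + h * y) - pt p w s t =
      ((s' + h * x - s) +i* (t' + h * y - t))%C * w.
    by rewrite !ptE (cplxE (s' + h * x - s)) !rmorphB !rmorphD /=; ring.
  rewrite rnormM ler_wpM2r //; apply: le_trans (rnorm_le_ReIm _) _ => /=.
  have ? : h * x <= h by rewrite ler_piMr //; lra.
  have ? : 0 <= h * x by apply: mulr_ge0; lra.
  have ? : h * y <= h by rewrite ler_piMr //; lra.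
  have ? : 0 <= h * y by apply: mulr_ge0; lra.
  have : `|s' + h * x - s| <= h by rewrite ler_norml; lra.
  have : `|t' + h * y - t| <= h by rewrite ler_norml; lra.
  lra.
set x := pt p w s t in box *; move=> cx.
have [[ss tt]|ne] := pselect ((s, t) = (s0, t0)).
  (* At the exceptional point only continuity is available: [g] is bounded by [M] nearby, and a
     small [h] makes [4 * (h * W) * M] at most [e], which is paid for by [cn >= 1]. *)
  have [d d0 hd] := cx _ ltr01; set M := rnorm (g x) + 1.
  have M0 : 0 < M by rewrite /M; have := rnorm_ge0 (g x); lra.
  have k0 : 0 < 2 * (W + 1) by lra.
  have m0 : 0 < 4 * (W + 1) * M by rewrite !mulr_gt0 //; lra.
  exists (Num.min (d / (2 * (W + 1))) (e / (4 * (W + 1) * M))).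
    by rewrite lt_min !divr_gt0.
  move=> s' t' h s'0 sh t'0 th hs ht h0; rewrite lt_min ltr_pdivlMr // ltr_pdivlMr // => /andP[h1 h2].
  move=> _ _ _ _.
  have {}cg := onsq_sub s'0 t'0 (ltW h0) sh th cg.
  apply: (le_trans (sq_le (M := M) (onedges_onsq cg) _)).
    apply: onedges_onsq => a b a01 b01; rewrite /M.
    have := hd (pt (pt p w s' t') (h%:C * w) a b).
    have := ler_rdist (g (pt (pt p w s' t') (h%:C * w) a b)) (g x).
    have := box s' t' h a b hs ht a01 b01 h0 => hb h3 /(_ _); rewrite -/x.
    move=> h4; apply: le_trans h3 _; rewrite lerD2l; apply: h4; nra.
  rewrite rnormM rnormR gtr0_norm // -/W.
  have : 1 <= cn s' t' h.
    rewrite /cn -[1]mulr1; apply: ler_pM; rewrite ?ler01 //; apply: cnt1_ge1 => //.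
      by rewrite -ss.
    by rewrite -tt.
  move: (cn _ _ _) => c c1.
  have : 4 * (h * W) * M <= e by nra.
  have : e <= e * c by rewrite ler_pMr.
  have : 0 <= e * h ^+ 2 by rewrite mulr_ge0 ?sqr_ge0 // ltW.
  lra.
have [l hl] := cdiffP (dg s t s01 t01 ne); rewrite -/x in hl.
(* A remainder of [e' * (2 * h * W)] on a perimeter of [4 * h * W] gives [8 * e' * W ^+ 2 * h ^+ 2];
   the [+ 1] covers [W = 0]. *)
pose e' := e / (8 * (W ^+ 2 + 1)).
have W2 : 0 < 8 * (W ^+ 2 + 1) by have := sqr_ge0 W; lra.
have e'0 : 0 < e' by rewrite divr_gt0.
have [d d0 hd] := hl _ e'0.
have k0 : 0 < 2 * (W + 1) by lra.
exists (d / (2 * (W + 1))); first by rewrite divr_gt0.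
move=> s' t' h s'0 sh t'0 th hs ht h0; rewrite ltr_pdivlMr // => h1 _ _ _ _.
have {}cg := onsq_sub s'0 t'0 (ltW h0) sh th cg.
(* The first-order expansion integrates to 0, so only the remainder is left. *)
pose A z := (g x - l * x) + l * z.
have cA z : ctn (A : C^o -> C) (z : C^o).
  by apply: ctnD; [exact: ctn_cst|apply: ctnM; [exact: ctn_cst|exact: (cdiff_ctn (cdiff_id z))]].
have cr : onsq (fun z => ctn ((fun z => g z - A z) : C^o -> C) (z : C^o)) (pt p w s' t') (h%:C * w).
  by move=> a b a01 b01; apply: ctnB; [exact: cg|exact: cA].
have -> : sq g (pt p w s' t') (h%:C * w) = sq (fun z => g z - A z) (pt p w s' t') (h%:C * w).
  by rewrite sqB ?sq_affine ?subr0 //; apply: onedges_onsq.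
apply: (le_trans (sq_le (M := e' * (2 * h * W)) (onedges_onsq cr) _)).
  apply: onedges_onsq => a b a01 b01.
  have hb := box s' t' h a b hs ht a01 b01 h0.
  set z := pt (pt p w s' t') (h%:C * w) a b in hb *.
  have -> : g z - A z = g z - g x - l * (z - x) by rewrite /A; ring.
  apply: le_trans (hd _ _) _; first by nra.
  by rewrite ler_pM2l.
rewrite rnormM rnormR gtr0_norm // -/W.
have : 0 <= e * cn s' t' h by rewrite mulr_ge0 ?mulr_ge0 ?cnt1_ge0 // ltW.
have -> : 4 * (h * W) * (e' * (2 * h * W)) = e * h ^+ 2 * (W ^+ 2 / (W ^+ 2 + 1)).
  by rewrite /e'; field; rewrite !gt_eqF //; have := sqr_ge0 W; lra.
have : W ^+ 2 / (W ^+ 2 + 1) <= 1.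
  by rewrite ler_pdivrMr; have := sqr_ge0 W; lra.
have : 0 <= e * h ^+ 2 by rewrite mulr_ge0 ?sqr_ge0 // ltW.
move: (e * h ^+ 2) (W ^+ 2 / _) => u v u0 v1 c0.
have : u * v <= u by rewrite ler_piMr.
lra.
Qed.

End Square.

(** * Cauchy's formula *)

Section Cauchy.
Context {R : realType}.
Local Notation C := (R[i]).
Local Notation "r %:C" := (r%:C%C : C).
Local Notation I := ('i%C : C).
Implicit Types (g f : C -> C) (a b p w v z : C) (s t h e M r : R).

Lemma goursat0 g p w : onsq (cdiff g) p w -> sq g p w = 0.
Proof.
(* The parameters (2, 2) lie outside the unit square: no point is exceptional. *)
move=> dg; apply: (@goursat _ g p w 2 2) => s t s01 t01; first exact: cdiff_ctn (dg _ _ s01 t01).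
by move=> _; exact: dg.
Qed.

Lemma cdiff_near_eq g f a : (exists2 d : R, 0 < d & forall z, rnorm (z - a) < d -> g z = f z) ->
  cdiff g a -> cdiff f a.
Proof. exact: (@near_eq_differentiable R C^o g f (a : C^o)). Qed.

Lemma pt_inj p w s t s' t' : w != 0 -> pt p w s t = pt p w s' t' -> s = s' /\ t = t'.
Proof. by move=> w0 /addrI /(mulIf w0) []. Qed.

Lemma cdiff_kernel b z : z != b -> cdiff (fun z => (z - b)^-1) z.
Proof. by move=> zb; apply: cdiffV; [rewrite subr_eq0|exact: cdiff_subr]. Qed.

Lemma cdiff_div_kernel g b z : z != b -> cdiff g z -> cdiff (fun z => g z / (z - b)) z.
Proof. by move=> zb dg; apply: cdiffM dg (cdiff_kernel zb). Qed.

Lemma onedges_neq p w s t : w != 0 -> 0 < s < 1 -> 0 < t < 1 ->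
  onedges (fun z => z != pt p w s t) p w.
Proof.
move=> w0 s01 t01 r r01; split; apply/eqP.
- have -> : p + r%:C * w = pt p w r 0 by rewrite ptE rmorph0 mul0r addr0.
  by move=> /(pt_inj w0) []; lra.
- have -> : p + w + r%:C * (I * w) = pt p w 1 r by rewrite ptE rmorph1 mul1r.
  by move=> /(pt_inj w0) []; lra.
- have -> : p + I * w + r%:C * w = pt p w r 1 by rewrite ptE rmorph1 mul1r addrAC.
  by move=> /(pt_inj w0) []; lra.
- have -> : p + r%:C * (I * w) = pt p w 0 r by rewrite ptE rmorph0 mul0r addr0.
  by move=> /(pt_inj w0) []; lra.
Qed.

Definition kernel_sq b p w := sq (fun z => (z - b)^-1) p w.

Lemma kernel_csq b p w : onedges (fun z => z != b) p w -> csq (fun z => (z - b)^-1) p w.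
Proof. by apply: onedges_sub => z zb; apply: cdiff_ctn; apply: cdiff_kernel. Qed.

Lemma kernel_sq_scale b a p v w : v != 0 -> onedges (fun z => z != b) p w ->
  kernel_sq (a + v * b) (a + v * p) (v * w) = kernel_sq b p w.
Proof.
move=> v0 hb; rewrite /kernel_sq sq_scale.
rewrite -[RHS](mulVKf v0); congr (_ * _); rewrite -sqZ; last exact: kernel_csq.
apply: sq_ext => s _.
by split; rewrite -invfM; congr (_^-1); ring.
Qed.

Lemma kernel_quarter b p w :
  (forall s t, 0 <= s <= 1 -> 0 <= t <= 1 -> pt p (w / 2) s t != b) -> kernel_sq b p (w / 2) = 0.
Proof. by move=> h; apply: goursat0 => s t s01 t01; apply: cdiff_kernel; apply: h. Qed.

(** Classically 2 pi i for every pole inside the unit square. *)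
Definition kappa s t := kernel_sq (pt 0 1 s t) 0 1.

Lemma kappaE p w s t : w != 0 -> 0 < s < 1 -> 0 < t < 1 -> kernel_sq (pt p w s t) p w = kappa s t.
Proof.
move=> w0 s01 t01.
have := kernel_sq_scale p w0 (onedges_neq 0 (oner_neq0 C) s01 t01).
by rewrite mulr0 addr0 mulr1 {1}/pt add0r mulr1 [w * _]mulrC.
Qed.

Lemma pt01_midlines s t : 0 < s < 1 -> 0 < t < 1 -> s != 1 / 2 -> t != 1 / 2 ->
  cseg (fun z => (z - pt 0 1 s t)^-1) (0 + I * (1 / 2)) 1 /\
  cseg (fun z => (z - pt 0 1 s t)^-1) (0 + 1 / 2) (I * 1).
Proof.
move=> s01 t01 s2 t2; have o := oner_neq0 C; split=> r r01; apply: cdiff_ctn; apply: cdiff_kernel; apply/eqP.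
  have -> : 0 + I * (1 / 2) + r%:C * 1 = pt 0 1 r (1 / 2).
    by rewrite ptE !mul1r halfC; ring.
  by move=> /(pt_inj o) [_ e]; rewrite e eqxx in t2.
have -> : 0 + 1 / 2 + r%:C * (I * 1) = pt 0 1 (1 / 2) r.
  by rewrite ptE !mul1r halfC; ring.
by move=> /(pt_inj o) [e _]; rewrite e eqxx in s2.
Qed.

Lemma pt_half_quarters s t :
  [/\ pt 0 (1 / 2) s t = pt 0 1 (s / 2) (t / 2) :> C,
      pt (0 + 1 / 2) (1 / 2) s t = pt 0 1 ((1 + s) / 2) (t / 2) :> C,
      pt (0 + I * (1 / 2)) (1 / 2) s t = pt 0 1 (s / 2) ((1 + t) / 2) :> C &
      pt (0 + 1 / 2 + I * (1 / 2)) (1 / 2) s t = pt 0 1 ((1 + s) / 2) ((1 + t) / 2) :> C].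
Proof. by split; rewrite !ptE !rmorphM /= ?rmorphD /= halfC; ring. Qed.

(** For a pole in the lower left quarter the other quarters contribute 0 by Goursat, and rescaling
    gives [kappa s t = kappa (s / 2) (t / 2)]; the upper right quarter gives a similar identity.
    Each of these contractions fixes a corner, but their composite fixes the interior point (2/3,
    2/3). *)
Lemma kappa_step s t : 0 < s < 1 -> 0 < t < 1 -> kappa s t = kappa (s / 4 + 1 / 2) (t / 4 + 1 / 2).
Proof.
move=> s01 t01; have o := oner_neq0 C.
have h0 : 1 / 2 != 0 :> C by rewrite mul1r invr_eq0 pnatr_eq0.
have s2 : s / 2 != 1 / 2 by apply/eqP; lra.
have t2 : t / 2 != 1 / 2 by apply/eqP; lra.
have s3 : (1 + s / 2) / 2 != 1 / 2 by apply/eqP; lra.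
have t3 : (1 + t / 2) / 2 != 1 / 2 by apply/eqP; lra.
transitivity (kappa (s / 2) (t / 2)).
  have [c1 c2] := pt01_midlines (s := s / 2) (t := t / 2) ltac:(lra) ltac:(lra) s2 t2.
  rewrite {2}/kappa /kernel_sq (sq_quarters _ c1 c2); last first.
    by apply: kernel_csq; apply: onedges_neq => //; lra.
  rewrite -!/(kernel_sq _ _ _) -(kappaE 0 h0 s01 t01).
  have [-> _ _ _] := pt_half_quarters s t.
  rewrite !(@kernel_quarter _ (_ + _)) ?addr0 // => s' t' s'01 t'01; apply/eqP;
    have [_ e2 e3 e4] := pt_half_quarters s' t'; rewrite ?e2 ?e3 ?e4 => /(pt_inj o) []; lra.
have -> : s / 4 + 1 / 2 = (1 + s / 2) / 2 by lra.
have -> : t / 4 + 1 / 2 = (1 + t / 2) / 2 by lra.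
have [c1 c2] := pt01_midlines (s := (1 + s / 2) / 2) (t := (1 + t / 2) / 2) ltac:(lra) ltac:(lra) s3 t3.
rewrite {2}/kappa /kernel_sq (sq_quarters _ c1 c2); last first.
  by apply: kernel_csq; apply: onedges_neq => //; lra.
rewrite -!/(kernel_sq _ _ _).
set b := pt 0 1 _ _.
have eb : b = pt (0 + 1 / 2 + I * (1 / 2)) (1 / 2) (s / 2) (t / 2).
  by have [_ _ _ ->] := pt_half_quarters (s / 2) (t / 2).
have e00 : kernel_sq b 0 (1 / 2) = 0.
  apply: kernel_quarter => s' t' s'01 t'01; apply/eqP.
  by have [-> _ _ _] := pt_half_quarters s' t' => /(pt_inj o) []; lra.
have e10 : kernel_sq b (0 + 1 / 2) (1 / 2) = 0.
  apply: kernel_quarter => s' t' s'01 t'01; apply/eqP.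
  by have [_ -> _ _] := pt_half_quarters s' t' => /(pt_inj o) []; lra.
have e01 : kernel_sq b (0 + I * (1 / 2)) (1 / 2) = 0.
  apply: kernel_quarter => s' t' s'01 t'01; apply/eqP.
  by have [_ _ -> _] := pt_half_quarters s' t' => /(pt_inj o) []; lra.
have s4 : 0 < s / 2 < 1 by lra.
have t4 : 0 < t / 2 < 1 by lra.
by rewrite e00 e10 e01 eb (kappaE _ h0 s4 t4) !add0r.
Qed.

(** The poles stay at distance at least 1/6 from the boundary, so the kernel changes by at most 6 *
    6 times the displacement; the perimeter 4 gives 144. *)
Lemma kappa_close s t : `|s - 2 / 3| <= 1 / 12 -> `|t - 2 / 3| <= 1 / 12 ->
  rnorm (kappa s t - kappa (2 / 3) (2 / 3)) <= 144 * (`|s - 2 / 3| + `|t - 2 / 3|).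
Proof.
move=> hs ht; have o := oner_neq0 C.
have s01 : 0 < s < 1 by move: hs; rewrite ler_norml; lra.
have t01 : 0 < t < 1 by move: ht; rewrite ler_norml; lra.
have q01 : 0 < (2 / 3 : R) < 1 by lra.
have c1 := kernel_csq (onedges_neq 0 o s01 t01).
have c2 := kernel_csq (onedges_neq 0 o q01 q01).
rewrite /kappa /kernel_sq -sqB //.
have far x y : x = 0 \/ x = 1 \/ y = 0 \/ y = 1 ->
    rnorm ((pt 0 1 x y - pt 0 1 s t)^-1 - (pt 0 1 x y - pt 0 1 (2 / 3) (2 / 3))^-1) <=
    36 * (`|s - 2 / 3| + `|t - 2 / 3|).
  move=> xy.
  have dE s' t' : pt 0 1 x y - pt 0 1 s' t' = ((x - s') +i* (y - t'))%C.
    by rewrite !ptE (cplxE (x - s')) !rmorphB /=; ring.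
  have lo s' t' : `|s' - 2 / 3| <= 1 / 12 -> `|t' - 2 / 3| <= 1 / 12 ->
      1 / 6 <= rnorm (pt 0 1 x y - pt 0 1 s' t').
    rewrite dE !ler_norml => hs' ht'.
    have hR := normr_Re_le ((x - s') +i* (y - t'))%C.
    have hI := normr_Im_le ((x - s') +i* (y - t'))%C.
    rewrite /= in hR hI.
    case: xy => [xe|[xe|[ye|ye]]]; [apply: le_trans hR|apply: le_trans hR|apply: le_trans hI|apply: le_trans hI];
      rewrite ?xe ?ye ler_normr; apply/orP; lra.
  have h1 := lo _ _ hs ht.
  have h2 : 1 / 6 <= rnorm (pt 0 1 x y - pt 0 1 (2 / 3) (2 / 3)).
    by apply: lo; rewrite subrr normr0; lra.
  move: h1 h2; set A := pt 0 1 x y - pt 0 1 s t; set B := pt 0 1 x y - pt 0 1 (2 / 3) (2 / 3).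
  move=> h1 h2.
  have A0 : A != 0 by rewrite -rnorm_gt0; lra.
  have B0 : B != 0 by rewrite -rnorm_gt0; lra.
  have -> : A^-1 - B^-1 = (B - A) * (A^-1 * B^-1) by field; rewrite A0 B0.
  rewrite !rnormM !rnormV mulrC.
  have hBA : rnorm (B - A) <= `|s - 2 / 3| + `|t - 2 / 3|.
    have -> : B - A = ((s - 2 / 3) +i* (t - 2 / 3))%C.
      by rewrite /A /B !ptE (cplxE (s - _)) !rmorphB /=; ring.
    exact: rnorm_le_ReIm.
  have inv6 (u : R) : 1 / 6 <= u -> u^-1 <= 6.
    by move=> hx; rewrite invf_ple ?posrE; lra.
  have iA := inv6 _ h1; have iB := inv6 _ h2.
  apply: ler_pM => //; rewrite ?rnorm_ge0 ?mulr_ge0 ?invr_ge0 ?rnorm_ge0 //.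
  have -> : (36 : R) = 6 * 6 by lra.
  by apply: ler_pM; rewrite ?invr_ge0 ?rnorm_ge0.
apply: (le_trans (sq_le (M := 36 * (`|s - 2 / 3| + `|t - 2 / 3|)) _ _)).
- by move=> r r01; have [? ? ? ?] := c1 r r01; have [? ? ? ?] := c2 r r01; split; apply: ctnB.
- move=> r _; split.
  + rewrite (_ : 0 + r%:C * 1 = pt 0 1 r 0); first by apply: far; tauto.
    by rewrite ptE rmorph0 mul0r addr0.
  + rewrite (_ : 0 + 1 + r%:C * (I * 1) = pt 0 1 1 r); first by apply: far; tauto.
    by rewrite ptE rmorph1 mul1r.
  + rewrite (_ : 0 + I * 1 + r%:C * 1 = pt 0 1 r 1); first by apply: far; tauto.
    by rewrite ptE rmorph1 mul1r addrAC.
  + rewrite (_ : 0 + r%:C * (I * 1) = pt 0 1 0 r); first by apply: far; tauto.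
    by rewrite ptE rmorph0 mul0r addr0.
by rewrite rnorm1; lra.
Qed.

(* [kappa] is invariant under a contraction of the open unit square with fixed point
   (2/3, 2/3), where it is continuous. *)
Lemma kappa_const s t : 0 < s < 1 -> 0 < t < 1 -> kappa s t = kappa (2 / 3) (2 / 3).
Proof.
move=> s01 t01; apply/eqP; rewrite -subr_eq0; apply/eqP/rnorm_small => e e0.
pose it k x : R := 2 / 3 + (x - 2 / 3) * (4^-1) ^+ k.
have p01 k : 0 < (4^-1 : R) ^+ k <= 1.
  by rewrite exprn_gt0 ?invr_gt0 // exprn_ile1 // ?invr_ge0 // invf_le1 // ler1n.
have it01 k x : 0 < x < 1 -> 0 < it k x < 1.
  move=> x01; have := p01 k; rewrite /it; move: (_ ^+ k) => q q01; nra.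
have itS k x : it k.+1 x = it k x / 4 + 1 / 2 by rewrite /it exprSr; field.
have kit k : kappa s t = kappa (it k s) (it k t).
  elim: k => [|k ->]; first by rewrite /it expr0 !mulr1 !(addrC (2 / 3)) !subrK.
  by rewrite !itS; apply: kappa_step; apply: it01.
(* [1 / 12] is the range of [kappa_close], whose constant 144 on two displacements of [e / 288]
   gives [e]. *)
have e1 : 0 < Num.min (1 / 12) (e / 288) by rewrite lt_min; apply/andP; split; lra.
have [k] := half_pow_small 1 e1; rewrite lt_min => /andP[k1 k2].
have small x : 0 < x < 1 -> `|it k x - 2 / 3| <= 1 / 2 ^+ k.
  move=> x01; rewrite /it addrAC subrr add0r normrM.
  have q0 : 0 <= (4^-1 : R) ^+ k by have /andP[/ltW] := p01 k.
  rewrite [X in _ * X]ger0_norm // -[1 / _]mul1r.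
  have hx : `|x - 2 / 3| <= 1 by rewrite ler_norml; lra.
  apply: ler_pM => //.
  by rewrite div1r -exprVn lerXn2r ?nnegrE ?invr_ge0 // lef_pV2 ?posrE // ler_nat.
have ss := small _ s01; have st := small _ t01.
rewrite (kit k); apply: le_trans (kappa_close _ _) _; lra.
Qed.

Lemma Im_dsum_ge k g p w u M : (forall s, 0 <= s <= 1 -> M <= complex.Im (u * g (p + s%:C * w))) ->
  M <= complex.Im (u * dsum k g p w).
Proof.
elim: k p w => [|k IH] p w h /=.
  by have := h 0; rewrite mul0r addr0 lexx ler01 => /(_ isT).
have [/IH h1 /IH h2] := seg_half (P := fun z => M <= complex.Im (u * g z)) h.
set A := dsum _ _ _ _ in h1 *; set B := dsum _ _ _ _ in h2 *.
have -> : u * ((A + B) / 2) = (2^-1)%:C * (u * A + u * B) by rewrite halfC; ring.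
move: h1 h2; case: (u * A) => a1 a2; case: (u * B) => b1 b2 /=.
lra.
Qed.

Lemma Im_cint_ge g p w u M : cseg g p w ->
  (forall s, 0 <= s <= 1 -> M <= complex.Im (u * w * g (p + s%:C * w))) ->
  M <= complex.Im (u * cint g p w).
Proof.
move=> /cint_scvg /(scvgM u) hc h; apply/ler_addgt0Pl => e e0.
have [n /(_ _ (leqnn n)) hn] := hc _ e0.
have := Im_dsum_ge n h; have := le_trans (normr_Im_le _) hn.
rewrite -mulrA; case: (u * (w * _)) => a1 a2; case: (u * cint _ _ _) => b1 b2 /=.
rewrite ler_norml; lra.
Qed.

Definition cauchy_const : C := kappa (2 / 3) (2 / 3).

(** With the pole at the centre, each of the four oriented edges contributes an imaginary part of at
    least 1 (classically pi / 2). *)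
Lemma cauchy_const_neq0 : cauchy_const != 0.
Proof.
rewrite /cauchy_const -(@kappa_const (1 / 2) (1 / 2)); try lra.
have h12 : 0 < (1 / 2 : R) < 1 by lra.
have c := kernel_csq (onedges_neq 0 (oner_neq0 C) h12 h12).
have [c1 c2 c3 c4] := csq_segs c.
have ptc : pt 0 1 (1 / 2) (1 / 2) = ((1 / 2) +i* (1 / 2))%C :> C.
  by rewrite /pt add0r mulr1.
have ImV x y : complex.Im ((x +i* y)%C^-1 : C) = - y / (x ^+ 2 + y ^+ 2) by rewrite mulNr.
have ReV x y : complex.Re ((x +i* y)%C^-1 : C) = x / (x ^+ 2 + y ^+ 2) by [].
have ImI (z : C) : complex.Im (I * z) = complex.Re z by case: z => x y /=; lra.
have ImN (z : C) : complex.Im (- z) = - complex.Im z by case: z.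
have key (x : R) : -1 / 2 <= x <= 1 / 2 -> 1 <= (1 / 2) / (x ^+ 2 + (1 / 2) ^+ 2).
  by move=> hx; rewrite ler_pdivlMr; nra.
have key' (x : R) : -1 / 2 <= x <= 1 / 2 -> 1 <= (1 / 2) / ((1 / 2) ^+ 2 + x ^+ 2).
  by move=> hx; rewrite addrC; apply: key.
have i1 : 1 <= complex.Im (1 * cint (fun z => (z - pt 0 1 (1 / 2) (1 / 2))^-1) 0 1).
  apply: Im_cint_ge => // s s01; rewrite mul1r mul1r ptc.
  have -> : 0 + s%:C * 1 - ((1 / 2) +i* (1 / 2))%C = ((s - 1 / 2) +i* (- (1 / 2)))%C.
    by rewrite (cplxE (s - _)) (cplxE (1 / 2)) rmorphB rmorphN /=; ring.
  by rewrite ImV opprK sqrrN; apply: key; lra.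
have i2 : 1 <= complex.Im (1 * cint (fun z => (z - pt 0 1 (1 / 2) (1 / 2))^-1) (0 + 1) (I * 1)).
  apply: Im_cint_ge => // s s01; rewrite mul1r mulr1 ptc ImI.
  have -> : 0 + 1 + s%:C * I - ((1 / 2) +i* (1 / 2))%C = ((1 / 2) +i* (s - 1 / 2))%C.
    by rewrite (cplxE (1 / 2) (1 / 2)) (cplxE (1 / 2)) rmorphB /= !mul1r halfC; field.
  by rewrite ReV; apply: key'; lra.
have i3 : 1 <= complex.Im (- 1 * cint (fun z => (z - pt 0 1 (1 / 2) (1 / 2))^-1) (0 + I * 1) 1).
  apply: Im_cint_ge => // s s01; rewrite mulr1 mulN1r ptc.
  have -> : 0 + I * 1 + s%:C * 1 - ((1 / 2) +i* (1 / 2))%C = ((s - 1 / 2) +i* (1 / 2))%C.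
    by rewrite (cplxE (s - _)) (cplxE (1 / 2)) rmorphB /= !mul1r halfC; field.
  by rewrite ImN ImV mulNr opprK; apply: key; lra.
have i4 : 1 <= complex.Im (- 1 * cint (fun z => (z - pt 0 1 (1 / 2) (1 / 2))^-1) 0 (I * 1)).
  apply: Im_cint_ge => // s s01; rewrite mulr1 mulN1r mulNr ptc ImN ImI.
  have -> : 0 + s%:C * I - ((1 / 2) +i* (1 / 2))%C = ((- (1 / 2)) +i* (s - 1 / 2))%C.
    by rewrite (cplxE (- _)) (cplxE (1 / 2)) rmorphB rmorphN /= !mul1r halfC; field.
  by rewrite ReV mulNr opprK sqrrN; apply: key'; lra.
apply/eqP => k0; move: i1 i2 i3 i4 (congr1 (@complex.Im R) k0).
rewrite /kappa /kernel_sq /sq !mul1r !mulN1r.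
case: (cint _ 0 1) => a1 a2; case: (cint _ (0 + 1) _) => b1 b2.
case: (cint _ (0 + I * 1) _) => d1 d2; case: (cint _ 0 _) => f1 f2 /=.
lra.
Qed.

(** The difference quotient at the pole, completed by the derivative, is continuous, and holomorphic
    elsewhere; Goursat with one exceptional point makes its integral vanish. *)
Lemma cauchy_formula g p w s t : w != 0 -> 0 < s < 1 -> 0 < t < 1 -> onsq (cdiff g) p w ->
  sq (fun z => g z / (z - pt p w s t)) p w = cauchy_const * g (pt p w s t).
Proof.
move=> w0 s01 t01 dg; set a := pt p w s t.
have [s01' t01'] : 0 <= s <= 1 /\ 0 <= t <= 1 by split; lra.
have [l hl] := cdiffP (dg s t s01' t01'); rewrite -/a in hl.
pose q z := if z == a then l else (g z - g a) / (z - a).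
have qE z : z != a -> q z = (g z - g a) / (z - a) by rewrite /q => /negPf ->.
have edge_a := onedges_neq p w0 s01 t01; rewrite -/a in edge_a.
have dq s' t' : 0 <= s' <= 1 -> 0 <= t' <= 1 -> pt p w s' t' != a -> cdiff q (pt p w s' t').
  move=> h1 h2 za; apply: (@cdiff_near_eq (fun z => (g z - g a) / (z - a))).
    exists (rnorm (pt p w s' t' - a)); first by rewrite rnorm_gt0 subr_eq0.
    move=> y hy; rewrite qE //; apply/eqP => ya; move: hy; rewrite ya rdistC ltxx //.
  apply: cdiff_div; first by rewrite subr_eq0.
    by apply: cdiffB; [exact: dg|exact: cdiff_cst].
  exact: cdiff_subr.
have cq : onsq (fun z => ctn (q : C^o -> C) (z : C^o)) p w.
  move=> s' t' h1 h2; have [->|za] := eqVneq (pt p w s' t') a; last exact: cdiff_ctn (dq _ _ h1 h2 za).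
  move=> e e0; have [d d0 hd] := hl _ e0; exists d => // y /hd hy; rewrite /q eqxx.
  case: eqVneq => [_|ya]; first by rewrite subrr rnorm0 ltW.
  have -> : (g y - g a) / (y - a) - l = (g y - g a - l * (y - a)) / (y - a).
    by field; rewrite subr_eq0.
  by rewrite rnormM rnormV ler_pdivrMr // rnorm_gt0 subr_eq0.
have q0 : sq q p w = 0.
  apply: (@goursat _ q p w s t) => // s' t' h1 h2 ne; apply: dq => //.
  by apply/eqP => /(pt_inj w0) [e1 e2]; apply: ne; rewrite e1 e2.
have cg : csq (fun z => g z / (z - a)) p w.
  move=> r r01; have [? ? ? ?] := onedges_onsq dg r01; have [? ? ? ?] := edge_a r r01.
  by split; apply: cdiff_ctn; exact: cdiff_div_kernel.
have ck := kernel_csq edge_a.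
have : sq q p w = sq (fun z => g z / (z - a) - g a * (z - a)^-1) p w.
  apply: sq_ext => r r01; have [? ? ? ?] := edge_a r r01.
  by split; rewrite qE // mulrBl.
rewrite q0 sqB //; last first.
  by move=> r /ck [? ? ? ?]; split; apply: ctnM => //; exact: ctn_cst.
rewrite sqZ // => /esym /eqP; rewrite subr_eq0 => /eqP ->.
by rewrite mulrC -/(kernel_sq a p w) /a kappaE // kappa_const.
Qed.

End Cauchy.

(** * Consequences of Cauchy's formula *)

Section Disc.
Context {R : realType}.
Local Notation C := (R[i]).
Local Notation "r %:C" := (r%:C%C : C).
Local Notation I := ('i%C : C).
Implicit Types (g f : C -> C) (a b p w v z : C) (s t h e M r : R).

(* The square of centre [a] and half-side [r]. *)
Definition corner a r : C := a - (r +i* r)%C.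
Definition side r : C := (2 * r)%:C.

Lemma pt_center a r s t :
  pt (corner a r) (side r) s t - a = (((2 * s - 1) * r) +i* ((2 * t - 1) * r))%C.
Proof.
rewrite /pt /corner /side (cplxE s) (cplxE r) (cplxE ((2 * s - 1) * r)).
by rewrite !rmorphM !rmorphB !rmorphM /= !rmorph_nat rmorph1; ring.
Qed.

Lemma side_neq0 r : 0 < r -> side r != 0.
Proof. by move=> r0; rewrite /side -rnorm_gt0 rnormR gtr0_norm; lra. Qed.

Lemma rnorm_side r : 0 < r -> rnorm (side r) = 2 * r.
Proof. by move=> r0; rewrite /side rnormR gtr0_norm //; lra. Qed.

Lemma center_onsq a r : 0 < r -> onsq (fun z => rnorm (z - a) <= 2 * r) (corner a r) (side r).
Proof.
move=> r0 s t s01 t01; rewrite pt_center; apply: le_trans (rnorm_le_ReIm _) _ => /=.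
rewrite !normrM (gtr0_norm r0) -mulrDl ler_pM2r //.
have : `|2 * s - 1| <= 1 by rewrite ler_norml; lra.
have : `|2 * t - 1| <= 1 by rewrite ler_norml; lra.
lra.
Qed.

Lemma center_onedges a r : 0 < r -> onedges (fun z => r <= rnorm (z - a)) (corner a r) (side r).
Proof.
move=> r0 s s01; set p := corner a r; set w := side r.
have re t t' : `|2 * t - 1| = 1 -> r <= rnorm (pt p w t t' - a).
  move=> h; rewrite pt_center; apply: le_trans (normr_Re_le _) => /=.
  by rewrite normrM h mul1r ler_norm.
have im t t' : `|2 * t' - 1| = 1 -> r <= rnorm (pt p w t t' - a).
  move=> h; rewrite pt_center; apply: le_trans (normr_Im_le _) => /=.
  by rewrite normrM h mul1r ler_norm.
have h0 : `|2 * 0 - 1 : R| = 1 by rewrite mulr0 sub0r normrN normr1.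
have h1 : `|2 * 1 - 1 : R| = 1 by rewrite mulr1 (_ : 2 - 1 = 1) ?normr1 //; lra.
split.
- have -> : p + s%:C * w = pt p w s 0 by rewrite ptE rmorph0 mul0r addr0.
  exact: im.
- have -> : p + w + s%:C * (I * w) = pt p w 1 s by rewrite ptE rmorph1 mul1r.
  exact: re.
- have -> : p + I * w + s%:C * w = pt p w s 1 by rewrite ptE rmorph1 mul1r addrAC.
  exact: im.
- have -> : p + s%:C * (I * w) = pt p w 0 s by rewrite ptE rmorph0 mul0r addr0.
  exact: re.
Qed.

Lemma onedges_and (P Q : C -> Prop) p w : onedges P p w -> onedges Q p w ->
  onedges (fun z => P z /\ Q z) p w.
Proof. by move=> hP hQ s s01; have [? ? ? ?] := hP s s01; have [? ? ? ?] := hQ s s01. Qed.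

Lemma center_edge a r : 0 < r ->
  onedges (fun z => r <= rnorm (z - a) /\ rnorm (z - a) <= 2 * r) (corner a r) (side r).
Proof.
by move=> r0; apply: onedges_and (center_onedges a r0) (onedges_onsq (center_onsq a r0)).
Qed.

(** The square of half-side [r] lies between the discs of radius [r] and [2 * r]. *)
Lemma cauchy_disc g a r b : 0 < r -> (forall z, rnorm (z - a) <= 2 * r -> cdiff g z) ->
  rnorm (b - a) < r ->
  sq (fun z => g z / (z - b)) (corner a r) (side r) = cauchy_const * g b.
Proof.
move=> r0 dg br.
have dsq : onsq (cdiff g) (corner a r) (side r).
  by move=> s t s01 t01; apply: dg; apply: center_onsq.
have hR := le_lt_trans (normr_Re_le _) br; have hI := le_lt_trans (normr_Im_le _) br.
pose s := (complex.Re (b - a) / r + 1) / 2; pose t := (complex.Im (b - a) / r + 1) / 2.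
have rr : r != 0 by rewrite gt_eqF.
have inside x : `|x| < r -> 0 < (x / r + 1) / 2 < 1.
  rewrite ltr_norml => /andP[x1 x2].
  have : x / r < 1 by rewrite ltr_pdivrMr // mul1r.
  have : -1 < x / r by rewrite ltr_pdivlMr // mulN1r.
  lra.
have <- : pt (corner a r) (side r) s t = b.
  apply: (addIr (- a)); rewrite pt_center /s /t.
  have aux x : (2 * ((x / r + 1) / 2) - 1) * r = x by field.
  by rewrite !aux; case: (b - a).
by apply: cauchy_formula; [exact: side_neq0|exact: inside|exact: inside|exact: dsq].
Qed.

(** 16 is 8, from the perimeter [8 * r], times 2, from [rnorm (z - t) >= r / 2] on the contour when
    [rnorm t <= r / 2]. *)
Definition est_const : R := 16 / rnorm (cauchy_const : C).

Lemma rcauchy_gt0 : 0 < rnorm (cauchy_const : C).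
Proof. by rewrite rnorm_gt0; exact: cauchy_const_neq0. Qed.

Lemma est_const_ge0 : 0 <= est_const.
Proof. by rewrite divr_ge0 ?rnorm_ge0. Qed.

(** The remainder bound depends on [g] only through [M]; this uniformity is what [weierstrass] lives
    on. *)
Lemma taylor1 g r M : 0 < r -> (forall z, rnorm z <= 2 * r -> cdiff g z) ->
  (forall z, rnorm z <= 2 * r -> rnorm (g z) <= M) ->
  exists l, forall t : C, rnorm t <= r / 2 ->
    rnorm (g t - g 0 - l * t) <= est_const * M / r ^+ 2 * rnorm t ^+ 2.
Proof.
move=> r0 dg gM; set p := corner 0 r; set w := side r.
have k0 := rcauchy_gt0; set K := cauchy_const in k0 *.
have kn : K != 0 by rewrite -rnorm_gt0.
have ed : onedges (fun z => [/\ r <= rnorm z, z != 0, cdiff g z & rnorm (g z) <= M]) p w.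
  apply: onedges_sub (center_edge 0 r0) => z; rewrite !subr0 => -[z1 z2].
  by split => //; [rewrite -rnorm_gt0; apply: lt_le_trans z1|exact: dg|exact: gM].
exists (K^-1 * sq (fun z => g z / (z - 0) / (z - 0)) p w) => t tr.
have dg' z : rnorm (z - 0) <= 2 * r -> cdiff g z by rewrite subr0; exact: dg.
have f0 : sq (fun z => g z / (z - 0)) p w = K * g 0.
  by apply: cauchy_disc => //; rewrite subrr rnorm0.
have ft : sq (fun z => g z / (z - t)) p w = K * g t.
  by apply: cauchy_disc => //; rewrite subr0; lra.
have edt : onedges (fun z => [/\ z != t & r / 2 <= rnorm (z - t)]) p w.
  apply: onedges_sub ed => z [z1 _ _ _].
  have h : r / 2 <= rnorm (z - t) by have := ler_rdist z t; lra.
  by split => //; rewrite -subr_eq0 -rnorm_gt0; lra.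
pose h z := g z / (z - 0) / (z - 0) / (z - t).
have c0 : csq (fun z => g z / (z - 0)) p w.
  by apply: onedges_sub ed => z [_ ? ? _]; apply: cdiff_ctn; exact: cdiff_div_kernel.
have c1 : csq (fun z => g z / (z - 0) / (z - 0)) p w.
  apply: onedges_sub ed => z [_ z0 dz _]; apply: cdiff_ctn.
  exact: (cdiff_div_kernel z0 (cdiff_div_kernel z0 dz)).
have c2 : csq h p w.
  apply: onedges_sub (onedges_and ed edt) => z [[_ z0 dz _] [zt _]]; apply: cdiff_ctn.
  exact: (cdiff_div_kernel zt (cdiff_div_kernel z0 (cdiff_div_kernel z0 dz))).
have cZ c f : csq f p w -> csq (fun z => c * f z) p w.
  by apply: onedges_sub => z; apply: ctnM; exact: ctn_cst.
have cD f f' : csq f p w -> csq f' p w -> csq (fun z => f z + f' z) p w.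
  move=> hf hf'; apply: onedges_sub (onedges_and hf hf') => z [? ?]; exact: ctnD.
(* The expansion 1/(z - t) = 1/z + t/z^2 + t^2/(z^2 (z - t)) on the contour. *)
have e1 : sq (fun z => g z / (z - t)) p w =
    sq (fun z => g z / (z - 0) + (t * (g z / (z - 0) / (z - 0)) + t ^+ 2 * h z)) p w.
  apply: sq_ext; apply: onedges_sub (onedges_and ed edt) => z [[_ z0 _ _] [zt _]].
  by rewrite /h; field; rewrite !subr_eq0 zt z0.
rewrite (sqD c0 (cD _ _ (cZ t _ c1) (cZ (t ^+ 2) _ c2))) in e1.
rewrite (sqD (cZ t _ c1) (cZ (t ^+ 2) _ c2)) (sqZ t c1) (sqZ (t ^+ 2) c2) ft f0 in e1.
have -> : g t - g 0 - K^-1 * sq (fun z => g z / (z - 0) / (z - 0)) p w * t = t ^+ 2 * (K^-1 * sq h p w).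
  move: e1; set S := sq _ p w; set T := sq h p w => e1.
  have -> : g t = K^-1 * (K * g t) by rewrite mulKf.
  by rewrite e1; field.
rewrite (rnormM (t ^+ 2)) (rnormM K^-1) rnormX rnormV mulrC ler_wpM2r ?exprn_ge0 ?rnorm_ge0 //.
have hb : rnorm (sq h p w) <= 4 * rnorm w * (2 * M / r ^+ 3).
  apply: sq_le => //; apply: onedges_sub (onedges_and ed edt) => z [[z1 _ _ gz] [_ zt]].
  rewrite /h !subr0 !rnormM !rnormV.
  have M0 : 0 <= M by apply: le_trans gz; exact: rnorm_ge0.
  have i1 : (rnorm z)^-1 <= r^-1 by rewrite lef_pV2 ?posrE //; apply: lt_le_trans z1.
  have i2 : (rnorm (z - t))^-1 <= 2 / r.
    rewrite -[2 / r]invrK lef_pV2 ?posrE ?invf_div //; first by apply: lt_le_trans zt; lra.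
    by rewrite divr_gt0.
  have -> : 2 * M / r ^+ 3 = M * r^-1 * r^-1 * (2 / r) by field; rewrite gt_eqF.
  by rewrite !ler_pM ?mulr_ge0 ?invr_ge0 ?rnorm_ge0.
rewrite rnorm_side // in hb.
have -> : est_const * M / r ^+ 2 = (rnorm K)^-1 * (4 * (2 * r) * (2 * M / r ^+ 3)).
  by rewrite /est_const; field; rewrite !gt_eqF.
by rewrite ler_pM2l ?invr_gt0.
Qed.

(** Derivatives are unique, so the bound of [taylor1] holds for any given derivative [l]. *)
Lemma cauchy_estimate g r M l : 0 < r -> (forall z, rnorm z <= 2 * r -> cdiff g z) ->
  (forall z, rnorm z <= 2 * r -> rnorm (g z) <= M) ->
  (forall e, 0 < e -> exists2 d : R, 0 < d & forall t : C, rnorm t < d ->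
     rnorm (g t - g 0 - l * t) <= e * rnorm t) ->
  forall t : C, rnorm t <= r / 2 ->
    rnorm (g t - g 0 - l * t) <= est_const * M / r ^+ 2 * rnorm t ^+ 2.
Proof.
move=> r0 dg gM hl; have [b hb] := taylor1 r0 dg gM.
suff -> : l = b by [].
apply/eqP; rewrite -subr_eq0; apply/eqP/rnorm_small => e e0.
set A := est_const * M / r ^+ 2 in hb.
have A0 : 0 <= A.
  have := gM 0; rewrite rnorm0 => /(_ ltac:(lra)) /(le_trans (rnorm_ge0 _)) M0.
  apply: divr_ge0; last exact: sqr_ge0.
  by apply: mulr_ge0 => //; exact: est_const_ge0.
have e20 : 0 < e / 2 by lra.
have [d d0 hd] := hl _ e20.
pose x := Num.min (d / 2) (Num.min (r / 2) (e / (2 * (A + 1)))).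
have x0 : 0 < x.
  by rewrite !lt_min; apply/and3P; split; [lra|lra|apply: divr_gt0; lra].
have xd : x <= d / 2 by rewrite ge_min lexx.
have xr : x <= r / 2 by rewrite !ge_min lexx orbT.
have xe : x <= e / (2 * (A + 1)) by rewrite !ge_min lexx !orbT.
have nx : rnorm (x%:C) = x by rewrite rnormR gtr0_norm.
have := hd x%:C; rewrite nx => /(_ ltac:(lra)) h1.
have := hb x%:C; rewrite nx => /(_ xr) h2.
have := ler_rnormB (g x%:C - g 0 - b * x%:C) (g x%:C - g 0 - l * x%:C).
have -> : g x%:C - g 0 - b * x%:C - (g x%:C - g 0 - l * x%:C) = (l - b) * x%:C by ring.
rewrite rnormM nx => h3.
rewrite -(ler_pM2r x0); apply: (le_trans h3).
apply: (le_trans (lerD h2 h1)).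
have : A * x <= e / 2.
  have : x * (2 * (A + 1)) <= e by rewrite -ler_pdivlMr //; lra.
  have : 0 <= x by exact: ltW.
  nra.
by move=> h4; rewrite expr2; nra.
Qed.

Lemma cseg_bounded g p w : cseg g p w ->
  exists M : R, forall s, 0 <= s <= 1 -> rnorm (g (p + s%:C * w)) <= M.
Proof.
move=> cg.
pose P s h := exists M : R, forall t, s <= t <= s + h -> rnorm (g (p + t%:C * w)) <= M.
suff : P 0 1 by case=> M hM; exists M => s s01; apply: hM; lra.
apply: cousin1.
  move=> s h h0 [M1 h1] [M2 h2]; exists (Num.max M1 M2) => t st; rewrite le_max.
  have [th|th] := leP t (s + h / 2); apply/orP; [left; apply: h1|right; apply: h2]; lra.
move=> s0 s01; have [d d0 hd] := seg_small (cg _ s01) ltr01.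
exists d => // s h s1 sh ss h0 hlt; exists (rnorm (g (p + s0%:C * w)) + 1) => t st.
have := hd s h ss h0 hlt ((t - s) / h).
have -> : p + s%:C * w + ((t - s) / h)%:C * (h%:C * w) = p + t%:C * w.
  rewrite mulrA -rmorphM /= mulfVK ?gt_eqF // rmorphB /=; ring.
have h1 : 0 <= (t - s) / h <= 1.
  by rewrite ler_pdivrMr // divr_ge0 //=; lra.
move=> /(_ h1); have := ler_rdist (g (p + t%:C * w)) (g (p + s0%:C * w)); lra.
Qed.

Lemma csq_bounded g p w : csq g p w -> exists M : R, onedges (fun z => rnorm (g z) <= M) p w.
Proof.
move=> /csq_segs [/cseg_bounded [M1 h1] /cseg_bounded [M2 h2] /cseg_bounded [M3 h3] /cseg_bounded [M4 h4]].
exists (Num.max (Num.max M1 M2) (Num.max M3 M4)) => s s01.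
by split; rewrite !le_max ?h1 ?h2 ?h3 ?h4 ?orbT.
Qed.

(* Dividing [g] by z^m for large m: the maximum over the contour beats the growth. *)
Lemma zero_propagation g r d : 0 < r -> 0 < d -> (forall z, rnorm z <= 2 * r -> cdiff g z) ->
  (forall z, rnorm z < d -> g z = 0) -> forall t : C, rnorm t < r -> g t = 0.
Proof.
move=> r0 d0 dg g0 t tr.
have k0 := rcauchy_gt0; set K := cauchy_const in k0 *.
have [->|tn0] := eqVneq t 0; first by apply: g0; rewrite rnorm0.
have tp : 0 < rnorm t by rewrite rnorm_gt0.
set p := corner 0 r; set w := side r.
have ed : onedges (fun z => [/\ r <= rnorm z, z != 0 & cdiff g z]) p w.
  apply: onedges_sub (center_edge 0 r0) => z; rewrite !subr0 => -[z1 z2].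
  by split => //; [rewrite -rnorm_gt0; apply: lt_le_trans z1|exact: dg].
have [M hM] : exists M : R, onedges (fun z => rnorm (g z) <= M) p w.
  by apply: csq_bounded; apply: onedges_sub ed => z [_ _ dz]; exact: cdiff_ctn.
apply: rnorm_small => e e0.
pose q := rnorm t / r.
have q01 : 0 < q < 1 by rewrite /q divr_gt0 //= ltr_pdivrMr ?mul1r.
(* The perimeter is [8 * r] and the kernel is at most [1 / (r - rnorm t)]; the powers of [z] are
   left to [q ^+ m]. *)
pose A := (rnorm K)^-1 * (8 * r * (M / (r - rnorm t))).
have bound m : rnorm (g t) <= A * q ^+ m.
  (* [gm] vanishes near 0 together with [g], hence is holomorphic on the whole disc. *)
  pose gm z := g z / z ^+ m.
  have dgm z : rnorm (z - 0) <= 2 * r -> cdiff gm z.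
    rewrite subr0 => zr; have [->|z0] := eqVneq z 0.
      apply: (@cdiff_near_eq _ (fun=> 0)); last exact: cdiff_cst.
      by exists d => // y; rewrite subr0 => /g0 gy; rewrite /gm gy mul0r.
    apply: cdiff_div; [by rewrite expf_neq0|exact: dg|].
    elim: m {gm} => [|m IH]; first exact: cdiff_cst.
    rewrite (_ : (fun z => z ^+ m.+1) = fun z => z * z ^+ m); last by apply/funext => y; rewrite exprS.
    exact: cdiffM (cdiff_id _) IH.
  have tr' : rnorm (t - 0) < r by rewrite subr0.
  have := cauchy_disc r0 dgm tr'.
  rewrite -/p -/w -/K => hC.
  have hs : rnorm (sq (fun z => gm z / (z - t)) p w) <= 4 * rnorm w * (M / r ^+ m / (r - rnorm t)).
    have edt : onedges (fun z => r - rnorm t <= rnorm (z - t)) p w.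
      by apply: onedges_sub ed => z [z1 _ _]; have := ler_rdist z t; lra.
    apply: sq_le.
      apply: onedges_sub (onedges_and ed edt) => z [[z1 z0 dz] zt].
      apply: cdiff_ctn; apply: cdiff_div_kernel.
        by rewrite -subr_eq0 -rnorm_gt0; apply: lt_le_trans zt; lra.
      apply: cdiff_div; [by rewrite expf_neq0|exact: dz|].
      elim: m {gm dgm hC} => [|m IH]; first exact: cdiff_cst.
      rewrite (_ : (fun z => z ^+ m.+1) = fun z => z * z ^+ m); last by apply/funext => y; rewrite exprS.
      exact: cdiffM (cdiff_id _) IH.
    apply: onedges_sub (onedges_and (onedges_and ed hM) edt) => z [[[z1 z0 dz] gz] zt].
    have rt : 0 < r - rnorm t by lra.
    rewrite /gm !rnormM !rnormV rnormX.
    have i1 : (rnorm z ^+ m)^-1 <= (r ^+ m)^-1.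
      rewrite lef_pV2 ?posrE ?exprn_gt0 ?rnorm_gt0 //.
      by rewrite lerXn2r ?nnegrE ?rnorm_ge0 // ltW.
    have i2 : (rnorm (z - t))^-1 <= (r - rnorm t)^-1.
      by rewrite lef_pV2 ?posrE //; apply: lt_le_trans zt.
    by rewrite !ler_pM ?mulr_ge0 ?invr_ge0 ?exprn_ge0 ?rnorm_ge0.
  rewrite hC /gm !rnormM rnormV rnormX rnorm_side // in hs.
  rewrite -(ler_pM2l k0).
  have tm : 0 < rnorm t ^+ m by rewrite exprn_gt0.
  rewrite -(ler_pM2r (_ : 0 < (rnorm t ^+ m)^-1)) ?invr_gt0 //.
  rewrite -mulrA; apply: (le_trans hs).
  rewrite /A /q expr_div_n le_eqVlt; apply/orP; left; apply/eqP.
  by field; rewrite !gt_eqF ?exprn_gt0 //; lra.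
have A0 : 0 <= A by have := bound 0%N; rewrite expr0 mulr1; apply: le_trans; exact: rnorm_ge0.
have : (fun m => A * q ^+ m) @ \oo --> A * 0.
  by apply: cvgMr; apply: cvg_expr; rewrite gtr0_norm; lra.
rewrite mulr0 => /cvgrPdist_le /(_ _ e0) [m _ /(_ m (leqnn m))].
rewrite /= sub0r normrN ger0_norm; first exact: le_trans.
by rewrite mulr_ge0 ?exprn_ge0 //; lra.
Qed.

Lemma liouville0 g : (forall z, cdiff g z) ->
  (forall e, 0 < e -> exists B : R, forall z, B < rnorm z -> rnorm (g z) <= e) ->
  forall a, g a = 0.
Proof.
move=> dg dec a; have k0 := rcauchy_gt0; set K := cauchy_const in k0 *.
apply: rnorm_small => e e0.
(* Perimeter [8 * r] times the kernel bound [1 / r] is 8, while Cauchy's formula produces [K] times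
   the value. *)
have e1 : 0 < e * rnorm K / 8 by rewrite divr_gt0 // mulr_gt0.
have [B hB] := dec _ e1.
pose r := `|B| + rnorm a + 1.
have r0 : 0 < r by rewrite /r; have := rnorm_ge0 a; have := normr_ge0 B; lra.
set p := corner a r; set w := side r.
have ed := center_onedges a r0; rewrite -/p -/w in ed.
have := @cauchy_disc g a r a r0 (fun z _ => dg z).
rewrite subrr rnorm0 => /(_ r0); rewrite -/p -/w -/K => hC.
have : rnorm (sq (fun z => g z / (z - a)) p w) <= 4 * rnorm w * (e * rnorm K / 8 / r).
  apply: sq_le.
    apply: onedges_sub ed => z zr; apply: cdiff_ctn; apply: cdiff_div_kernel => //.
    by rewrite -subr_eq0 -rnorm_gt0; lra.
  apply: onedges_sub ed => z zr; rewrite rnormM rnormV.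
  apply: ler_pM; rewrite ?invr_ge0 ?rnorm_ge0 //.
    apply: hB; have := ler_rnormB z a; have := ler_norm B; rewrite /r in zr; lra.
  by rewrite lef_pV2 ?posrE //; lra.
rewrite hC rnormM rnorm_side //.
have -> : 4 * (2 * r) * (e * rnorm K / 8 / r) = rnorm K * e by field; rewrite gt_eqF.
by rewrite ler_pM2l.
Qed.

End Disc.

(** * Weierstrass' theorem and parametric integrals *)

Section Weierstrass.
Context {R : realType} {V : normedModType R[i]}.
Local Notation C := (R[i]).
Local Notation "r %:C" := (r%:C%C : C).

Lemma scvgB (u v : nat -> C) (l l' : C) : scvg u l -> scvg v l' ->
  scvg (fun n => u n - v n) (l - l').
Proof.
move=> hu hv; rewrite -mulN1r.
rewrite (_ : (fun n => _) = fun n => u n + -1 * v n); last first.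
  by apply/funext => n; rewrite mulN1r.
by apply: scvgD => //; apply: scvgM.
Qed.

(** The one-variable estimate on the line [x + z *: h]. The radius [r1 = r / (4 * rnorm h)] keeps
    the disc of radius [2 * r1] within [r / 2] of [x], whence the factor 16, and [z = 1] is allowed
    once [rnorm h <= r / 8]. *)
Lemma directional_estimate (F : V -> C^o) (x : V) (L : V -> C) (r M : R) : 0 < r ->
  (forall y, rnorm (y - x) < r -> differentiable F y) ->
  (forall y, rnorm (y - x) < r -> rnorm (F y) <= M) ->
  (forall c u, L (c *: u) = c * L u) ->
  (forall e : R, 0 < e -> exists2 d : R, 0 < d &
      forall h, rnorm h < d -> rnorm (F (x + h) - F x - L h) <= e * rnorm h) ->
  forall h, rnorm h <= r / 8 ->
    rnorm (F (x + h) - F x - L h) <= 16 * est_const * M / r ^+ 2 * rnorm h ^+ 2.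
Proof.
move=> r0 dF bF LZ Ld h hr; have [->|h0] := eqVneq h 0.
  have -> : L 0 = 0 by rewrite -(scale0r 0) LZ mul0r.
  by rewrite addr0 subrr subr0 !rnorm0 expr0n mulr0.
have hp : 0 < rnorm h by rewrite rnorm_gt0.
pose r1 := r / (4 * rnorm h).
have r10 : 0 < r1 by rewrite divr_gt0 // mulr_gt0.
have near z : rnorm z <= 2 * r1 -> rnorm (x + z *: h - x) < r.
  move=> zr; rewrite addrC addKr rnormZ.
  apply: le_lt_trans (ler_wpM2r (rnorm_ge0 _) zr) _.
  have -> : 2 * r1 * rnorm h = r / 2 by rewrite /r1; field; rewrite gt_eqF.
  lra.
have := @cauchy_estimate _ (fun z => F (x + z *: h)) r1 M (L h) r10
  (fun z zr => cdiff_line (dF _ (near z zr))) (fun z zr => bF _ (near z zr)).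
move=> /(_ _ 1) /=; rewrite rnorm1 expr1n mulr1 scale0r addr0 scale1r mulr1.
have -> : est_const * M / r1 ^+ 2 = 16 * est_const * M / r ^+ 2 * rnorm h ^+ 2.
  by rewrite /r1; field; rewrite !gt_eqF.
apply.
  move=> e e0; have [d d0 hd] := Ld _ (divr_gt0 e0 hp).
  exists (d / rnorm h); first by rewrite divr_gt0.
  move=> t; rewrite ltr_pdivlMr // -rnormZ => /hd.
  rewrite LZ rnormZ [t * _]mulrC.
  have -> : e / rnorm h * (rnorm t * rnorm h) = e * rnorm t by field; rewrite gt_eqF.
  by [].
by rewrite /r1 ler_pdivlMr // ler_pdivlMr ?mulr_gt0 //; lra.
Qed.

(** The quadratic remainders have one constant [D] for all [k]. Comparing increments at [s *: h]
    bounds [s] times the distance of [L m h] and [L n h] by pointwise errors plus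
    [2 * D * (s * rnorm h) ^+ 2]; so the differentials converge, and the remainder bound passes to
    the limit. *)
Lemma weierstrass (F : nat -> V -> C^o) (G : V -> C^o) (x : V) (r M : R) : 0 < r ->
  (forall k y, rnorm (y - x) < r -> differentiable (F k) y) ->
  (forall k y, rnorm (y - x) < r -> rnorm (F k y) <= M) ->
  (forall y, rnorm (y - x) < r -> scvg (fun k => F k y) (G y)) -> differentiable G x.
Proof.
move=> r0 dF bF cF.
have xx : rnorm (x - x) < r by rewrite subrr rnorm0.
have exL k : exists L : V -> C, [/\ {morph L : u v / u + v}, forall c u, L (c *: u) = c * L u &
    forall e : R, 0 < e -> exists2 d : R, 0 < d &
      forall h, rnorm h < d -> rnorm (F k (x + h) - F k x - L h) <= e * rnorm h].
  by have /diff_epsP [L [LD LZ _ Ld]] := dF k x xx; exists L.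
have [L hL] := choice exL.
have M0 : 0 <= M by apply: le_trans (bF 0%N x xx); exact: rnorm_ge0.
pose D := 16 * est_const * M / r ^+ 2.
have D0 : 0 <= D.
  apply: divr_ge0; last exact: sqr_ge0.
  by apply: mulr_ge0 => //; apply: mulr_ge0 => //; exact: est_const_ge0.
have est k h : rnorm h <= r / 8 -> rnorm (F k (x + h) - F k x - L k h) <= D * rnorm h ^+ 2.
  have [_ LZ Ld] := hL k; move=> hr.
  exact: (directional_estimate r0 (dF k) (bF k) LZ Ld hr).
have in_ball h : rnorm h <= r / 8 -> rnorm (x + h - x) < r by rewrite addrC addKr; lra.
have Lcvg h : exists l, scvg (fun k => L k h) l.
  apply: complex_cauchy_cvg => e e0.
  have h0 := rnorm_ge0 h; set H := rnorm h in h0 *.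
  (* Chosen before the indices: [s *: h] stays in range and each of the two remainders is at most
     [s * e / 4]; four pointwise errors of [s * e / 8] then complete the total [s * e]. *)
  pose s := Num.min (r / (8 * (H + 1))) (e / (4 * (D * H ^+ 2 + 1))).
  have DH : 0 <= D * H ^+ 2 by rewrite mulr_ge0 ?sqr_ge0.
  have s0 : 0 < s by rewrite lt_min; apply/andP; split; apply: divr_gt0; lra.
  have s1 : s * H <= r / 8.
    have : s <= r / (8 * (H + 1)) by rewrite ge_min lexx.
    rewrite ler_pdivlMr; last by lra.
    by have : 0 <= s by [exact: ltW]; nra.
  have s2 : s * (D * H ^+ 2) <= e / 4.
    have : s <= e / (4 * (D * H ^+ 2 + 1)) by rewrite ge_min lexx orbT.
    rewrite ler_pdivlMr; last by lra.
    by have : 0 <= s by [exact: ltW]; move: (D * _) DH => q q0; nra.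
  have ns : rnorm (s%:C *: h) = s * H by rewrite rnormZ rnormR gtr0_norm.
  have sh : rnorm (s%:C *: h) <= r / 8 by rewrite ns.
  have es : 0 < s * e / 8 by rewrite divr_gt0 // mulr_gt0.
  have [n1 h1] := cF _ (in_ball _ sh) _ es; have [n2 h2] := cF _ xx _ es.
  exists (maxn n1 n2) => m n; rewrite !geq_max => /andP[m1 m2] /andP[k1 k2].
  have := est m _ sh; have := est n _ sh.
  have [_ LZm _] := hL m; have [_ LZn _] := hL n; rewrite LZm LZn ns.
  have := h1 _ m1; have := h1 _ k1; have := h2 _ m2; have := h2 _ k2.
  set a1 := F m (x + _); set a2 := F n (x + _); set b1 := F m x; set b2 := F n x.
  set g1 := G (x + _); set g2 := G x; set l1 := L m h; set l2 := L n h.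
  move=> q1 q2 q3 q4 q5 q6.
  rewrite -(ler_pM2l s0) -[X in X * rnorm _](_ : rnorm (s%:C) = s); last by rewrite rnormR gtr0_norm.
  rewrite -rnormM.
  have -> : s%:C * (l1 - l2) = ((a2 - b2 - s%:C * l2) - (a1 - b1 - s%:C * l1)) +
     (((a1 - g1) - (a2 - g1)) - ((b1 - g2) - (b2 - g2))) by ring.
  have t1 := ler_rnormD ((a2 - b2 - s%:C * l2) - (a1 - b1 - s%:C * l1))
     (((a1 - g1) - (a2 - g1)) - ((b1 - g2) - (b2 - g2))).
  have t2 := ler_rnormB (a2 - b2 - s%:C * l2) (a1 - b1 - s%:C * l1).
  have t3 := ler_rnormB ((a1 - g1) - (a2 - g1)) ((b1 - g2) - (b2 - g2)).
  have t4 := ler_rnormB (a1 - g1) (a2 - g1).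
  have t5 := ler_rnormB (b1 - g2) (b2 - g2).
  have t6 : D * (s * H) ^+ 2 <= s * (e / 4).
    by rewrite (_ : D * (s * H) ^+ 2 = s * (s * (D * H ^+ 2))) ?ler_pM2l //; ring.
  lra.
have [L' hL'] := choice Lcvg.
have L'est h : rnorm h <= r / 8 -> rnorm (G (x + h) - G x - L' h) <= D * rnorm h ^+ 2.
  move=> hr; apply: (@scvg_le _ (fun k => F k (x + h) - F k x - L k h)); last by move=> k; exact: est.
  by apply: scvgB => //; apply: scvgB; apply: cF => //; exact: in_ball.
have L'Z c u : L' (c *: u) = c * L' u.
  apply: (scvg_unique (hL' _)); have := scvgM c (hL' u).
  rewrite (_ : (fun n => _) = fun n => L n (c *: u)) //.
  by apply/funext => k; have [_ -> _] := hL k.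
have L'D : {morph L' : u v / u + v}.
  move=> u v; apply: (scvg_unique (hL' _)); have := scvgD (hL' u) (hL' v).
  rewrite (_ : (fun n => _) = fun n => L n (u + v)) //.
  by apply/funext => k; have [-> _ _] := hL k.
have GM y : rnorm (y - x) < r -> rnorm (G y) <= M.
  by move=> yr; apply: scvg_le (cF y yr) _ => k; exact: bF.
apply/diff_epsP; exists L'; split => //.
  (* The remainder bound at a vector of length [r / 8], with [G] bounded by [M], rescaled by
     homogeneity. *)
  pose B := 8 / r * (2 * M + D * (r / 8) ^+ 2).
  exists B => u; have [->|u0] := eqVneq u 0.
    by rewrite -(scale0r 0) L'Z mul0r scale0r !rnorm0 mulr0.
  have up : 0 < rnorm u by rewrite rnorm_gt0.
  pose s := r / 8 / rnorm u; have s0 : 0 < s by rewrite !divr_gt0.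
  have ns : rnorm (s%:C *: u) = r / 8.
    by rewrite rnormZ rnormR gtr0_norm // divfK ?gt_eqF.
  have sr : rnorm (s%:C *: u) <= r / 8 by rewrite ns.
  have := L'est _ sr; rewrite ns L'Z => h1.
  have h2 := GM _ (in_ball _ sr); have h3 := GM _ xx.
  have h4 := ler_rnormB (G (x + s%:C *: u) - G x) (G (x + s%:C *: u) - G x - s%:C * L' u).
  have h5 := ler_rnormB (G (x + s%:C *: u)) (G x).
  move: h4; rewrite opprB addrC subrK rnormM rnormR gtr0_norm // => h4.
  have h6 : s * rnorm (L' u) <= 2 * M + D * (r / 8) ^+ 2 by lra.
  rewrite -(ler_pM2l s0); apply: (le_trans h6).
  rewrite le_eqVlt; apply/orP; left; apply/eqP; rewrite /B /s; field.
  by rewrite !gt_eqF.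
move=> e e0; exists (Num.min (r / 8) (e / (D + 1))).
  by rewrite lt_min; apply/andP; split; apply: divr_gt0; lra.
move=> h; rewrite lt_min => /andP[/ltW h1 h2]; apply: le_trans (L'est _ h1) _.
rewrite expr2 mulrA ler_wpM2r ?rnorm_ge0 //.
have : rnorm h * (D + 1) < e by rewrite -ltr_pdivlMr //; lra.
by have := rnorm_ge0 h; nra.
Qed.

(** The dyadic sums are differentiable in [y], bounded by [rnorm w * M] and pointwise convergent, so
    [weierstrass] applies. *)
Lemma cint_param (h : V -> C -> C) (p w : C) (x : V) (r M : R) : 0 < r ->
  (forall y, rnorm (y - x) < r -> forall s : R, 0 <= s <= 1 ->
     differentiable (fun y => h y (p + s%:C * w) : C^o) y /\ rnorm (h y (p + s%:C * w)) <= M) ->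
  (forall y, rnorm (y - x) < r -> cseg (h y) p w) ->
  differentiable (fun y => cint (h y) p w : C^o) x.
Proof.
move=> r0 H ch.
apply: (@weierstrass (fun k y => w * dsum k (h y) p w) _ x r (rnorm w * M) r0).
- move=> k y yr; apply: differentiableM; first exact: differentiable_cst.
  have {}H := fun s s01 => (H y yr s s01).1.
  elim: k p w H {ch} => [|k IH] p w H /=.
    by have := H 0; rewrite mul0r addr0; apply; rewrite lexx ler01.
  have [h1 h2] := seg_half (P := fun z => differentiable (fun y => h y z : C^o) y) H.
  apply: differentiableM; last exact: differentiable_cst.
  by apply: differentiableD; apply: IH.
- move=> k y yr; rewrite rnormM ler_wpM2l ?rnorm_ge0 //.
  rewrite -[dsum _ _ _ _]subr0; apply: dsum_avg => s s01; rewrite subr0.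
  by have [] := H y yr s s01.
- by move=> y yr; apply: cint_scvg; exact: ch.
Qed.

End Weierstrass.

(** * Coordinates *)

Section Coordinates.
Context {R : realType} {n : nat} (i0 : 'I_n).
Local Notation C := (R[i]).
Local Notation V := ('rV[C]_n).
Local Notation W := (Cn R n).
Local Notation "r %:C" := (r%:C%C : C).
Implicit Types (y z : V) (t u : C).

(** Replaces coordinate [i0] by [t]; written as an affine line in [t], so that [cdiff_line] applies
    directly. *)
Definition setc z t : V := (z - z 0 i0 *: delta_mx 0 i0) + t *: delta_mx 0 i0.

Lemma setc_coord z t : setc z t 0 i0 = t.
Proof. by rewrite !mxE !eqxx !mulr1 subrr add0r. Qed.

Lemma setc_other z t i : i != i0 -> setc z t 0 i = z 0 i.
Proof. by move=> ii0; rewrite !mxE (negPf ii0) !andbF !mulr0 subr0 addr0. Qed.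

Lemma setcC z t u : setc (setc z t) u = setc z u.
Proof. by rewrite {1}/setc setc_coord /setc addrK. Qed.

Lemma setc_id z : setc z (z 0 i0) = z.
Proof. by rewrite /setc subrK. Qed.

Lemma rnorm_coord z i : rnorm (z 0 i) <= rnorm z.
Proof.
rewrite -lecR -!normE [leRHS]/(Num.norm _) /= mx_normE.
by rewrite -[leLHS]nngE num_le; apply: (le_bigmax _ _ (0, i)).
Qed.

Lemma rnorm_delta : rnorm (delta_mx 0 i0 : V) <= 1.
Proof.
rewrite -lecR -!normE [leLHS]/(Num.norm _) /= mx_normE.
rewrite rmorph1 (_ : 1 = (1%:nng : {nonneg C})%:num) // num_le.
apply/bigmax_leP; split=> [|[i j] _]; rewrite -num_le /= ?ler01 // mxE.
by case: (_ && _); rewrite ?normr1 ?normr0 ?ler01.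
Qed.

Lemma rnorm_setcB y z u t :
  rnorm (setc y u - setc z t) <= 2 * rnorm (y - z) + rnorm (u - t).
Proof.
have -> : setc y u - setc z t = (y - z) + ((u - t) - (y - z) 0 i0) *: delta_mx 0 i0.
  by apply/rowP => i; rewrite !mxE; ring.
apply: le_trans (ler_rnormD _ _) _; rewrite rnormZ.
have h1 : rnorm (u - t - (y - z) 0 i0) * rnorm (delta_mx 0 i0 : V) <= rnorm (u - t - (y - z) 0 i0).
  by rewrite ler_piMr ?rnorm_ge0 ?rnorm_delta.
have := ler_rnormB (u - t) ((y - z) 0 i0); have := rnorm_coord (y - z) i0; lra.
Qed.

Lemma differentiable_setc t z : differentiable (fun y : W => setc y t : W) (z : W).
Proof.
apply: differentiableD; last exact: differentiable_cst.
apply: differentiableB; first by have [] := @is_diff_id C W z.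
apply: (@differentiableZl C W W (fun y : W => (y : V) 0 i0)); exact: differentiable_coord.
Qed.

Lemma cdiff_setc (f : W -> C^o) z t : differentiable f (setc z t : W) -> cdiff (fun u => f (setc z u)) t.
Proof. exact: cdiff_line. Qed.

(** Bisection along the segment makes the neighbourhood of [z], the bound and the distance from the
    pole uniform, as [cint_param] requires. *)
Lemma edge_differentiable (f : W -> C^o) (U : V -> Prop) p w z :
  (forall x, U x -> exists2 d : R, 0 < d & forall y, rnorm (y - x) < d -> U y) ->
  (forall x, U x -> differentiable f (x : W)) ->
  (forall s : R, 0 <= s <= 1 -> p + s%:C * w != z 0 i0 /\ U (setc z (p + s%:C * w))) ->
  differentiable (fun y : W => cint (fun t => f (setc y t) / (t - (y : V) 0 i0)) p w : C^o) (z : W).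
Proof.
move=> Uo Ud hU.
pose P s h := exists2 r : R, 0 < r & exists M : R, forall y, rnorm (y - z) < r ->
  forall t : R, s <= t <= s + h -> [/\ p + t%:C * w != y 0 i0, U (setc y (p + t%:C * w)) &
    rnorm (f (setc y (p + t%:C * w)) / (p + t%:C * w - y 0 i0)) <= M].
have : P 0 1.
  apply: cousin1.
    move=> s h h0 [r1 r10 [M1 h1]] [r2 r20 [M2 h2]].
    exists (Num.min r1 r2); first by rewrite lt_min r10.
    exists (Num.max M1 M2) => y; rewrite lt_min => /andP[y1 y2] t st.
    have [th|th] := leP t (s + h / 2).
      by have [|? ? ?] := h1 y y1 t; [lra|split => //; rewrite le_max; apply/orP; left].
    by have [|? ? ?] := h2 y y2 t; [lra|split => //; rewrite le_max; apply/orP; right].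
  move=> s0 s01; have [zs Us] := hU s0 s01; set q := p + s0%:C * w in zs Us.
  have [d1 d10 hd1] := Uo _ Us; have [d2 d20 hd2] := diff_ctn (Ud _ Us) ltr01.
  pose c := rnorm (q - z 0 i0).
  have c0 : 0 < c by rewrite rnorm_gt0 subr_eq0.
  pose d := Num.min (Num.min d1 d2) c.
  have d0 : 0 < d by rewrite !lt_min d10 d20.
  have dd1 : d <= d1 by rewrite !ge_min lexx.
  have dd2 : d <= d2 by rewrite !ge_min lexx orbT.
  have dc : d <= c by rewrite ge_min lexx orbT.
  have w0 := rnorm_ge0 w.
  (* Moving [y] and the point of the segment by [d / 4] each moves [setc] by at most [3 * d / 4],
     and the denominator by at most [c / 2]. *)
  exists (d / (4 * (rnorm w + 1))); first by apply: divr_gt0; lra.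
  move=> s h s1 sh ss h0; rewrite ltr_pdivlMr; last by lra.
  move=> hh; exists (d / 4); first by lra.
  exists ((rnorm (f (setc z q)) + 1) / (c / 2)) => y yz t st.
  have tq : rnorm (p + t%:C * w - q) <= d / 4.
    have -> : p + t%:C * w - q = (t - s0)%:C * w by rewrite /q rmorphB /=; ring.
    rewrite rnormM rnormR.
    have ht : `|t - s0| <= h by rewrite ler_norml; lra.
    apply: le_trans (ler_wpM2r w0 ht) _; nra.
  have close : rnorm (setc y (p + t%:C * w) - setc z q) < d.
    by apply: le_lt_trans (rnorm_setcB _ _ _ _) _; lra.
  have far : c / 2 <= rnorm (p + t%:C * w - y 0 i0).
    have := rnorm_coord (y - z) i0; rewrite !mxE => h1.
    have := ler_rdistD (p + t%:C * w - y 0 i0) (q - z 0 i0) 0; rewrite !subr0.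
    have -> : q - z 0 i0 - (p + t%:C * w - y 0 i0) = (y 0 i0 - z 0 i0) - (p + t%:C * w - q) by ring.
    have := ler_rnormB (y 0 i0 - z 0 i0) (p + t%:C * w - q).
    rewrite -/c; lra.
  split.
  - by rewrite -subr_eq0 -rnorm_gt0; lra.
  - by apply: hd1; lra.
  - rewrite rnormM rnormV ler_pM ?invr_ge0 ?rnorm_ge0 //.
      have := hd2 (setc y (p + t%:C * w)) ltac:(lra).
      have := ler_rdist (f (setc y (p + t%:C * w))) (f (setc z q)); lra.
    by rewrite lef_pV2 ?posrE //; lra.
move=> [r r0 [M hM]].
apply: (@cint_param _ W (fun y t => f (setc y t) / (t - (y : V) 0 i0)) p w z r M r0).
  move=> y yr s s01; have [|q1 q2 q3] := hM y yr s; first by rewrite add0r.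
  split => //; apply: differentiableM.
    by apply: (differentiable_comp (differentiable_setc _ _)); exact: Ud.
  apply: differentiableV; last by rewrite subr_eq0.
  by apply: differentiableB; [exact: differentiable_cst|exact: differentiable_coord].
move=> y yr s s01; have [|q1 q2 q3] := hM y yr s; first by rewrite add0r.
apply: cdiff_ctn; apply: cdiff_div_kernel => //; apply: cdiff_setc; exact: Ud.
Qed.

End Coordinates.

(** * Functions tending to 0 at infinity *)

Section Decay.
Context {R : realType}.
Local Notation C := (R[i]).
Local Notation "r %:C" := (r%:C%C : C).

Definition decays (g : C -> C) := forall e : R, 0 < e ->
  exists B : R, forall t, B < rnorm t -> rnorm (g t) <= e.

Lemma decays0 : decays (fun=> 0).
Proof. by move=> e e0; exists 0 => t _; rewrite rnorm0 ltW. Qed.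

Lemma decaysD g h : decays g -> decays h -> decays (fun t => g t + h t).
Proof.
move=> hg hh e e0; have e20 : 0 < e / 2 by lra.
have [B1 h1] := hg _ e20; have [B2 h2] := hh _ e20.
exists (Num.max B1 B2) => t; rewrite gt_max => /andP[/h1 t1 /h2 t2].
by have := ler_rnormD (g t) (h t); lra.
Qed.

Lemma decaysM c g : decays g -> decays (fun t => c * g t).
Proof.
move=> hg e e0; have c0 := rnorm_ge0 c.
have e20 : 0 < e / (rnorm c + 1) by apply: divr_gt0; lra.
have [B hB] := hg _ e20; exists B => t /hB ht; rewrite rnormM.
apply: le_trans (ler_wpM2l c0 ht) _.
rewrite mulrCA; apply: ler_piMr; first exact: ltW.
by rewrite ler_pdivrMr; lra.
Qed.

Lemma decaysB g h : decays g -> decays h -> decays (fun t => g t - h t).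
Proof.
move=> hg /(decaysM (-1)) hh; rewrite (_ : (fun t => _) = fun t => g t + -1 * h t); first exact: decaysD.
by apply/funext => t; rewrite mulN1r.
Qed.

Lemma decays_sum (N : nat) (g : 'I_N -> C -> C) : (forall j, decays (g j)) ->
  decays (fun t => \sum_(j < N) g j t).
Proof.
move=> hg; elim: N g hg => [|N IH] g hg.
  rewrite (_ : (fun t => _) = fun=> 0); first exact: decays0.
  by apply/funext => t; rewrite big_ord0.
rewrite (_ : (fun t => _) = fun t => g ord0 t + \sum_(j < N) g (lift ord0 j) t).
  by apply: decaysD => //; apply: IH.
by apply/funext => t; rewrite big_ord_recl.
Qed.

Lemma decays_eq g h : (exists B : R, forall t, B < rnorm t -> g t = h t) -> decays g -> decays h.
Proof.
move=> [B hB] hg e /hg [B' hB']; exists (Num.max B B') => t; rewrite gt_max => /andP[t1 t2].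
by rewrite -hB // hB'.
Qed.

Lemma decays_cauchy_kernel (g : C -> C) p w : cseg g p w ->
  decays (fun t => cint (fun u => g u / (u - t)) p w).
Proof.
move=> cg e e0; have [M hM] := cseg_bounded cg.
have w0 := rnorm_ge0 w.
have M0 : 0 <= M.
  by have := hM 0; rewrite lexx ler01 => /(_ isT); apply: le_trans; exact: rnorm_ge0.
pose A := rnorm w * M.
have A0 : 0 <= A by rewrite mulr_ge0.
(* Beyond this radius the kernel is at most [1 / (A / e + 1)], and [A / (A / e + 1) <= e]. *)
exists (rnorm p + rnorm w + A / e + 1) => t tB.
have Ae : 0 <= A / e by rewrite divr_ge0 // ltW.
have far s : 0 <= s <= 1 -> A / e + 1 <= rnorm (p + s%:C * w - t).
  move=> /andP[s0 s1]; have := ler_rdist t (p + s%:C * w); rewrite rdistC.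
  have := ler_rnormD p (s%:C * w); rewrite rnormM rnormR ger0_norm //.
  have : s * rnorm w <= rnorm w by rewrite ler_piMl.
  lra.
have D0 : 0 < A / e + 1 by lra.
apply: (le_trans (cint_le (M := M / (A / e + 1)) _ _)).
- move=> s s01; apply: ctnM; first exact: cg.
  apply: cdiff_ctn; apply: cdiff_kernel.
  by rewrite -subr_eq0 -rnorm_gt0; apply: lt_le_trans (far _ s01).
- move=> s s01; rewrite rnormM rnormV ler_pM ?invr_ge0 ?rnorm_ge0 ?hM //.
  by rewrite lef_pV2 ?posrE ?far //; apply: lt_le_trans (far _ s01).
rewrite mulrA -/A ler_pdivrMr // mulrDr mulr1 mulrC divfK ?gt_eqF // lerDl; exact: ltW.
Qed.

End Decay.

(** * Decomposition near a slice *)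

Section Distance.
Context {R : realType} {n : nat}.
Local Notation V := ('rV[R[i]]_n).
Implicit Types x y z : V.

Definition vdist x y : R := rnorm (x - y).

Lemma vdistC x y : vdist x y = vdist y x. Proof. exact: rdistC. Qed.

Lemma vdistD z x y : vdist x y <= vdist x z + vdist z y. Proof. exact: ler_rdistD. Qed.

Lemma vdistxx x : vdist x x = 0. Proof. by rewrite /vdist subrr rnorm0. Qed.

Lemma vdist_setc (i0 : 'I_n) y z u t :
  vdist (setc i0 y u) (setc i0 z t) <= 2 * vdist y z + rnorm (u - t).
Proof. exact: rnorm_setcB. Qed.

Lemma vdist_coord i y z : rnorm (y 0 i - z 0 i) <= vdist y z.
Proof. by have := rnorm_coord (y - z) i; rewrite !mxE. Qed.

End Distance.

(* Abstracting the distances first keeps [lra] from comparing matrix expressions by conversion. *)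
Ltac rlra := intros; repeat match goal with
  | |- context [@vdist ?R ?n ?x ?y] => let r := fresh "r" in set (r := @vdist R n x y) in *; clearbody r
  | H : context [@vdist ?R ?n ?x ?y] |- _ =>
      let r := fresh "r" in set (r := @vdist R n x y) in *; clearbody r
  end; lra.

Section Abel.
Context {C : comPzRingType}.

Lemma abel_sum (a h : nat -> C) N : a 0%N = 0 -> a N = 0 ->
  \sum_(k < N) a k * (h k - h k.+1) = \sum_(k < N) (a k.+1 - a k) * h k.+1.
Proof.
move=> a0 aN; apply/eqP; rewrite -subr_eq0 -sumrB.
rewrite (eq_bigr (fun k : 'I_N => a k * h k - a k.+1 * h k.+1)); last by move=> k _; ring.
suff -> : \sum_(k < N) (a k * h k - a k.+1 * h k.+1) = a 0%N * h 0%N - a N * h N.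
  by rewrite a0 aN !mul0r subrr.
elim: N {aN} => [|N IH]; first by rewrite big_ord0 subrr.
by rewrite big_ord_recr /= IH; ring.
Qed.

End Abel.

(** * The two contours and the splitting over a cylinder *)

Section Grid.
Context {R : realType} {n : nat} (i0 : 'I_n) (Omega K : set (Cn R n)) (f : Cn R n -> R[i]^o).
Local Notation C := (R[i]).
Local Notation V := ('rV[C]_n).
Local Notation W := (Cn R n).
Local Notation "r %:C" := (r%:C%C : C).
Local Notation I := ('i%C : C).
Local Notation setc := (setc i0).
Context (df : forall x, Omega x -> ~ K x -> differentiable f x).
Context (Uopen : forall x, Omega x -> ~ K x ->
  exists2 d : R, 0 < d & forall y, vdist y x < d -> Omega y /\ ~ K y).
(* [dl] is the mesh; [X] shifts the grid so that all relevant squares have indices in (0, N). *)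
Context (dl X B0 : R) (N : nat) (a : V).
Context (dl0 : 0 < dl) (XE : X = B0 + 4 * dl) (NE : 2 * B0 + 8 * dl < N%:R * dl).
Context (Kbd : forall x : V, K x -> rnorm x <= B0).
Context (Knear : forall x y : V, K x -> vdist y x < 16 * dl -> Omega y).

Let dl0' : 0 <= dl := ltW dl0.

Ltac glra := have := dl0; have := XE; have := NE; rlra.

(** An open cylinder about the line through [a] in direction [i0], invariant under changes of that
    coordinate. *)
Definition cyl (z : V) := vdist (setc z (a 0 i0)) a < dl.

Lemma cyl_setc z t : cyl (setc z t) <-> cyl z.
Proof. by rewrite /cyl setcC. Qed.

Lemma cyl_open z : cyl z -> exists2 d : R, 0 < d & forall y, vdist y z < d -> cyl y.
Proof.
rewrite /cyl => cz; exists ((dl - vdist (setc z (a 0 i0)) a) / 2); first by rlra.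
move=> y yz; have := vdistD (setc z (a 0 i0)) (setc y (a 0 i0)) a.
have := vdist_setc i0 y z (a 0 i0) (a 0 i0); rewrite subrr rnorm0; rlra.
Qed.

Lemma cyl_close z y u t : cyl z -> cyl y ->
  vdist (setc z u) (setc y t) <= 4 * dl + rnorm (u - t).
Proof.
rewrite /cyl => cz cy; rewrite -(setcC i0 z (a 0 i0) u) -(setcC i0 y (a 0 i0) t).
apply: le_trans (vdist_setc _ _ _ _ _) _.
have := vdistD a (setc z (a 0 i0)) (setc y (a 0 i0)).
rewrite (vdistC a (setc y _)); rlra.
Qed.

Definition gx (t : C) := complex.Re t + X.
Definition gy (t : C) := complex.Im t + X.
Definition inI (j : nat) (x : R) := j%:R * dl <= x <= j.+1%:R * dl.
Definition inQ j k t := inI j (gx t) /\ inI k (gy t).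
Definition gp j k : C := ((j%:R * dl - X) +i* (k%:R * dl - X))%C.
Local Notation w := (dl%:C).

Lemma inI_close j j' m x x' : inI j x -> inI j' x' -> `|x - x'| < m%:R * dl -> (j' <= j + m)%N.
Proof.
move=> /andP[_ h1] /andP[h2 _]; rewrite ltr_norml => /andP[h3 _].
rewrite -ltnS -addSn -(ltr_nat R) -(ltr_pM2r dl0) natrD mulrDl; glra.
Qed.

Lemma gx_close t t' : `|gx t - gx t'| <= rnorm (t - t').
Proof.
have -> : gx t - gx t' = complex.Re (t - t') by rewrite /gx; case: t t' => x y [x' y'] /=; glra.
exact: normr_Re_le.
Qed.

Lemma gy_close t t' : `|gy t - gy t'| <= rnorm (t - t').
Proof.
have -> : gy t - gy t' = complex.Im (t - t') by rewrite /gy; case: t t' => x y [x' y'] /=; glra.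
exact: normr_Im_le.
Qed.

Lemma gxy_dist t t' : rnorm (t - t') <= `|gx t - gx t'| + `|gy t - gy t'|.
Proof.
have -> : gx t - gx t' = complex.Re (t - t') by rewrite /gx; case: t t' => x y [x' y'] /=; glra.
have -> : gy t - gy t' = complex.Im (t - t') by rewrite /gy; case: t t' => x y [x' y'] /=; glra.
exact: rnorm_le_ReIm.
Qed.

Lemma inQ_pt j k (s s' : R) : 0 <= s <= 1 -> 0 <= s' <= 1 -> inQ j k (pt (gp j k) w s s').
Proof.
move=> s01 s01'; rewrite /inQ /inI /gx /gy /pt /gp /=.
rewrite -!(natr1 j) -!(natr1 k).
have : s * dl <= dl by rewrite ler_piMl //; glra.
have : 0 <= s * dl by rewrite mulr_ge0 //; glra.
have : s' * dl <= dl by rewrite ler_piMl //; glra.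
have : 0 <= s' * dl by rewrite mulr_ge0 //; glra.
by move=> *; split; glra.
Qed.

Lemma pt_grid j k t : t = pt (gp j k) w ((gx t - j%:R * dl) / dl) ((gy t - k%:R * dl) / dl).
Proof.
have wn : w != 0 by rewrite fmorph_eq0 gt_eqF.
rewrite /pt cplxE !rmorphM /= !fmorphV mulrDl divfK // mulrA -mulrA (mulrA _ w^-1) divfK //.
rewrite -cplxE /gp /gx /gy; case: t => x y /=.
by apply/eqP; rewrite eq_complex /=; apply/andP; split; apply/eqP; lra.
Qed.

Lemma floor_inI x : 0 <= x -> exists j : nat, j%:R * dl <= x /\ x < j.+1%:R * dl.
Proof.
move=> x0; have := @truncn_itv _ (x / dl) (divr_ge0 x0 (ltW dl0)).
by move=> /andP[h1 h2]; exists (Num.truncn (x / dl)); rewrite -ler_pdivlMr // -ltr_pdivrMr.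
Qed.

(** These squares depend on the cylinder but not on its points. [Ssq] adds two layers: every square
    containing a point within [2 * dl] of a square of [Tsq] then belongs to it. *)
Definition Tsq j k : bool := `[< exists z t, [/\ cyl z, inQ j k t & K (setc z t)] >].
Definition Ssq j k : bool := `[< exists j' k', Tsq j' k' /\
  [/\ (j <= j' + 2)%N, (j' <= j + 2)%N, (k <= k' + 2)%N & (k' <= k + 2)%N] >].

Lemma TsqS j k : Tsq j k -> Ssq j k.
Proof. by move=> h; apply/asboolP; exists j, k; rewrite !leq_addr. Qed.

Lemma K_coord z t : K (setc z t) -> rnorm t <= B0.
Proof. by move=> /Kbd; apply: le_trans; rewrite -{1}(setc_coord i0 z t); exact: rnorm_coord. Qed.

Lemma K_gxy z t : K (setc z t) -> 4 * dl <= gx t <= 2 * B0 + 4 * dl /\ 4 * dl <= gy t <= 2 * B0 + 4 * dl.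
Proof.
move=> /K_coord h; rewrite /gx /gy.
have := le_trans (normr_Re_le _) h; have := le_trans (normr_Im_le _) h.
by rewrite !ler_norml XE => h1 h2; split; glra.
Qed.

Lemma Tsq_bounds j k : Tsq j k -> [/\ (2 < j)%N, (2 < k)%N, (j + 2 < N)%N & (k + 2 < N)%N].
Proof.
move=> /asboolP [z [t [_ [h1 h2] /K_gxy [h3 h4]]]].
have aux m x : inI m x -> 4 * dl <= x <= 2 * B0 + 4 * dl -> (2 < m)%N /\ (m + 2 < N)%N.
  move=> /andP[m1 m2] /andP[x1 x2]; split.
    by rewrite -ltnS -(ltr_nat R) -(ltr_pM2r dl0); glra.
  by rewrite -(ltr_nat R) -(ltr_pM2r dl0) natrD mulrDl; glra.
by have [? ?] := aux _ _ h1 h3; have [? ?] := aux _ _ h2 h4.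
Qed.

Lemma Ssq_bounds j k : Ssq j k -> [/\ (0 < j)%N, (0 < k)%N, (j < N)%N & (k < N)%N].
Proof.
move=> /asboolP [j' [k' [/Tsq_bounds [h1 h2 h3 h4] [h5 h6 h7 h8]]]].
by split; lia.
Qed.

(** [4 * dl] inside the cylinder and [3 * dl] in each real direction between the squares add up to
    [10 * dl], below the margin of [Knear]. *)
Lemma Ssq_Omega j k z t : Ssq j k -> cyl z -> inQ j k t -> Omega (setc z t).
Proof.
move=> /asboolP [j' [k' [/asboolP [z' [t' [cz' [q1 q2] Kt']]] [h5 h6 h7 h8]]]] cz [q3 q4].
apply: (Knear Kt'); apply: le_lt_trans (cyl_close _ _ cz cz') _.
have aux m m' x x' : inI m x -> inI m' x' -> (m <= m' + 2)%N -> (m' <= m + 2)%N -> `|x - x'| <= 3 * dl.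
  move=> /andP[x1 x2] /andP[x3 x4]; rewrite -!(ler_nat R) !natrD => l1 l2.
  have := ler_wpM2r (ltW dl0) l1; have := ler_wpM2r (ltW dl0) l2.
  by rewrite -natr1 in x2 *; rewrite -natr1 in x4; rewrite !mulrDl in x2 x4 *; rewrite ler_norml; glra.
have := le_trans (gxy_dist t t') (lerD (aux _ _ _ _ q3 q1 h5 h6) (aux _ _ _ _ q4 q2 h7 h8)).
glra.
Qed.

Lemma nTsq_K j k z t : ~~ Tsq j k -> cyl z -> inQ j k t -> ~ K (setc z t).
Proof. by move=> /asboolP h cz q Kt; apply: h; exists z, t. Qed.

Definition phi (z : V) (t : C) := f (setc z t) / (t - z 0 i0).

(** The integral over the oriented boundary of the union of the squares [s]: each edge is weighted
    by the difference of the indicators of its two neighbours, so an edge inside the union has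
    weight 0. *)
Definition chain (s : nat -> nat -> bool) (z : V) : C := \sum_(j < N) \sum_(k < N)
  (((s j k.+1)%:R - (s j k)%:R) * cint (phi z) (gp j k.+1) w
   - ((s j.+1 k)%:R - (s j k)%:R) * cint (phi z) (gp j.+1 k) (I * w)).

Definition admissible (s : nat -> nat -> bool) :=
  (forall j k, Tsq j k -> s j k) /\ (forall j k, s j k -> Ssq j k).

Lemma admT : admissible Tsq. Proof. by split=> // j k; exact: TsqS. Qed.
Lemma admS : admissible Ssq. Proof. by split=> // j k; exact: TsqS. Qed.

(* Summation by parts: interior edges cancel formally, even those that meet [K], where the
   integrals have junk values. *)
Lemma chainE s z : admissible s ->
  chain s z = \sum_(j < N) \sum_(k < N) (s j k)%:R * sq (phi z) (gp j k) w.
Proof.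
move=> [_ sS].
have s0 j k : (j == 0) || (j == N) || (k == 0) || (k == N) -> s j k = false.
  move=> h; apply/negP => /sS /Ssq_bounds [? ? ? ?]; lia.
have gh j k : gp j k + w = gp j.+1 k.
  by apply/eqP; rewrite eq_complex /= -natr1; apply/andP; split; apply/eqP; ring.
have gv j k : gp j k + I * w = gp j k.+1.
  by apply/eqP; rewrite eq_complex /= -natr1; apply/andP; split; apply/eqP; ring.
pose H j k := cint (phi z) (gp j k) w; pose Ve j k := cint (phi z) (gp j k) (I * w).
transitivity (\sum_(j < N) \sum_(k < N) (s j k)%:R * (H j k - H j k.+1) -
    \sum_(j < N) \sum_(k < N) (s j k)%:R * (Ve j k - Ve j.+1 k)); last first.
  rewrite -sumrB; apply: eq_bigr => j _; rewrite -sumrB; apply: eq_bigr => k _.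
  by rewrite /sq gh gv /H /Ve; ring.
rewrite /chain (eq_bigr (fun j : 'I_N => \sum_(k < N) ((s j k.+1)%:R - (s j k)%:R) * H j k.+1 -
   \sum_(k < N) ((s j.+1 k)%:R - (s j k)%:R) * Ve j.+1 k)); last by move=> j _; rewrite -sumrB.
rewrite sumrB; congr (_ - _).
  apply: eq_bigr => j _.
  by rewrite (@abel_sum _ (fun k => (s j k)%:R) (H j)) // s0 // eqxx ?orbT.
rewrite exchange_big [RHS]exchange_big /=; apply: eq_bigr => k _.
by rewrite (@abel_sum _ (fun j => (s j k)%:R) (Ve^~ k)) // s0 // eqxx ?orbT.
Qed.

Lemma edgeH_inQ j k (s : R) : 0 <= s <= 1 -> inQ j k (gp j k.+1 + s%:C * w) /\ inQ j k.+1 (gp j k.+1 + s%:C * w).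
Proof.
move=> s01; rewrite /inQ /inI /gx /gy /gp /= -!(natr1 k.+1) -!(natr1 k) -!(natr1 j).
have : s * dl <= dl by rewrite ler_piMl //; glra.
have : 0 <= s * dl by rewrite mulr_ge0 //; glra.
by move=> *; split; split; glra.
Qed.

Lemma edgeV_inQ j k (s : R) : 0 <= s <= 1 ->
  inQ j k (gp j.+1 k + s%:C * (I * w)) /\ inQ j.+1 k (gp j.+1 k + s%:C * (I * w)).
Proof.
move=> s01; rewrite /inQ /inI /gx /gy /gp /= -!(natr1 j.+1) -!(natr1 k) -!(natr1 j).
have : s * dl <= dl by rewrite ler_piMl //; glra.
have : 0 <= s * dl by rewrite mulr_ge0 //; glra.
by move=> *; split; split; glra.
Qed.

(** One of the two squares is in [s], hence in [Ssq] and over [Omega]; the other is not, hence is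
    outside [Tsq] and misses [K]. *)
Lemma boundary_good s j k j' k' z t : admissible s -> s j k != s j' k' -> cyl z ->
  inQ j k t -> inQ j' k' t -> Omega (setc z t) /\ ~ K (setc z t).
Proof.
move=> [sT sS] ne cz q q'; wlog sj : j k j' k' ne q q' / s j k.
  move=> H; have [sj|nj] := boolP (s j k); first exact: (H j k j' k').
  by apply: (H j' k' j k) => //; [rewrite eq_sym|move: ne nj; case: (s j k); case: (s j' k')].
split; first exact: Ssq_Omega (sS _ _ sj) cz q.
apply: (@nTsq_K j' k') => //; apply/negP => /sT sj'.
by move: ne; rewrite sj sj'.
Qed.

Lemma coef_neq (b c : bool) : (b%:R - c%:R : C) != 0 -> b != c.
Proof. by case: b; case: c; rewrite ?subrr ?eqxx. Qed.

(** The last hypothesis keeps the pole [z 0 i0] off every edge of nonzero weight; on these edges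
    [boundary_good] makes [f] holomorphic. *)
Lemma chain_differentiable s z : admissible s -> cyl z ->
  (forall j k j' k', inQ j k (z 0 i0) -> inQ j' k' (z 0 i0) -> s j k = s j' k') ->
  differentiable (chain s : W -> C^o) (z : W).
Proof.
move=> adm cz hz.
have edge c p v : (c != 0 -> forall r : R, 0 <= r <= 1 -> p + r%:C * v != z 0 i0 /\
      (Omega (setc z (p + r%:C * v)) /\ ~ K (setc z (p + r%:C * v)))) ->
    differentiable (fun y : W => c * cint (phi y) p v : C^o) (z : W).
  move=> H; have [->|c0] := eqVneq c 0.
    rewrite (_ : (fun y : W => _) = fun=> 0); first exact: differentiable_cst.
    by apply/funext => y; rewrite mul0r.
  apply: differentiableM; first exact: differentiable_cst.
  apply: (@edge_differentiable _ _ i0 f (fun x => Omega x /\ ~ K x)).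
  - by move=> x [? ?]; exact: Uopen.
  - by move=> x [? ?]; exact: df.
  - by move=> r r01; exact: H c0 r r01.
have sumd m (g : 'I_m -> W -> C^o) : (forall j, differentiable (g j) (z : W)) ->
    differentiable (fun y : W => \sum_(j < m) g j y : C^o) (z : W).
  move=> H; rewrite (_ : (fun y => _) = \sum_(j < m) g j); first exact: differentiable_sum.
  by apply/funext => y; rewrite fct_sumE.
apply: (@sumd N (fun j y => \sum_(k < N) (((s j k.+1)%:R - (s j k)%:R) * cint (phi y) (gp j k.+1) w
   - ((s j.+1 k)%:R - (s j k)%:R) * cint (phi y) (gp j.+1 k) (I * w)))) => j.
apply: sumd => k.
apply: differentiableB; apply: edge => /coef_neq ne r r01.
  have [q1 q2] := edgeH_inQ j k r01.
  split; last exact: (boundary_good adm ne cz q2 q1).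
  by apply/eqP => e; rewrite e in q1 q2; rewrite (hz _ _ _ _ q1 q2) eqxx in ne.
have [q1 q2] := edgeV_inQ j k r01.
split; last exact: (boundary_good adm ne cz q2 q1).
by apply/eqP => e; rewrite e in q1 q2; rewrite (hz _ _ _ _ q1 q2) eqxx in ne.
Qed.

Definition inS t := forall j k, inQ j k t -> Ssq j k.
Definition outT t := forall j k, inQ j k t -> ~~ Tsq j k.

Lemma chainS_diff z : cyl z -> inS (z 0 i0) -> differentiable (chain Ssq : W -> C^o) (z : W).
Proof.
by move=> cz h; apply: chain_differentiable => //; [exact: admS|move=> j k j' k' /h -> /h ->].
Qed.

Lemma chainT_diff z : cyl z -> outT (z 0 i0) -> differentiable (chain Tsq : W -> C^o) (z : W).
Proof.
move=> cz h; apply: chain_differentiable => //; first exact: admT.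
by move=> j k j' k' /h /negPf -> /h /negPf ->.
Qed.


Lemma interior_square j k j' k' t : j%:R * dl < gx t < j.+1%:R * dl -> k%:R * dl < gy t < k.+1%:R * dl ->
  inQ j' k' t -> j' = j /\ k' = k.
Proof.
have aux m m' x : m%:R * dl < x < m.+1%:R * dl -> inI m' x -> m' = m.
  move=> /andP[h1 h2] /andP[h3 h4]; apply/eqP; rewrite eqn_leq; apply/andP; split.
    by rewrite -ltnS -(ltr_nat R) -(ltr_pM2r dl0); exact: le_lt_trans h2.
  by rewrite -ltnS -(ltr_nat R) -(ltr_pM2r dl0); exact: lt_le_trans h4.
by move=> hx hy [/(aux _ _ _ hx) -> /(aux _ _ _ hy) ->].
Qed.

(** The difference is a sum over the squares between the contours: the one around the pole gives
    Cauchy's formula, the others vanish by Goursat. *)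
Lemma chain_interior z j k : cyl z -> Ssq j k -> ~~ Tsq j k ->
  j%:R * dl < gx (z 0 i0) < j.+1%:R * dl -> k%:R * dl < gy (z 0 i0) < k.+1%:R * dl ->
  chain Ssq z - chain Tsq z = cauchy_const * f z.
Proof.
move=> cz Sjk Tjk hx hy; rewrite (chainE z admS) (chainE z admT) -sumrB.
have [_ _ jN kN] := Ssq_bounds Sjk.
have good j' k' t : Ssq j' k' -> ~~ Tsq j' k' -> inQ j' k' t -> cdiff (fun u => f (setc z u)) t.
  by move=> s1 t1 q; apply: cdiff_setc; apply: df; [exact: Ssq_Omega s1 cz q|exact: nTsq_K t1 cz q].
have term (j' k' : nat) : (Ssq j' k')%:R * sq (phi z) (gp j' k') w - (Tsq j' k')%:R * sq (phi z) (gp j' k') w =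
    if (j' == j) && (k' == k) then cauchy_const * f z else 0.
  case: ifPn => [/andP[/eqP -> /eqP ->]|ne].
    rewrite Sjk (negPf Tjk) mul1r mul0r subr0.
    have wn : w != 0 by rewrite fmorph_eq0 gt_eqF.
    have s01 : 0 < (gx (z 0 i0) - j%:R * dl) / dl < 1.
      by move: hx; rewrite -natr1 => hx; rewrite divr_gt0 /= ?ltr_pdivrMr //; glra.
    have t01 : 0 < (gy (z 0 i0) - k%:R * dl) / dl < 1.
      by move: hy; rewrite -natr1 => hy; rewrite divr_gt0 /= ?ltr_pdivrMr //; glra.
    have dg : onsq (cdiff (fun u => f (setc z u))) (gp j k) w.
      by move=> s s' h1 h2; apply: (good j k) => //; exact: inQ_pt.
    by have := cauchy_formula wn s01 t01 dg; rewrite -(pt_grid j k) setc_id.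
  have [Tjk'|Tjk'] := boolP (Tsq j' k'); first by rewrite (TsqS Tjk') subrr.
  have [Sjk'|Sjk'] := boolP (Ssq j' k'); last by rewrite !mul0r subrr.
  rewrite mul1r mul0r subr0; apply: goursat0 => s s' h1 h2.
  have q := inQ_pt j' k' h1 h2; apply: cdiff_div_kernel; last exact: (good j' k').
  apply/eqP => e; rewrite e in q; have [e1 e2] := interior_square hx hy q.
  by rewrite e1 e2 !eqxx in ne.
rewrite (bigD1 (Ordinal jN)) //= -sumrB (bigD1 (Ordinal kN)) //= term !eqxx.
rewrite big1 => [|k' ne]; last by rewrite term; case: ifP => // /andP[_]; rewrite -val_eqE /= in ne; rewrite (negPf ne).
rewrite addr0 big1 ?addr0 // => j' ne; rewrite -sumrB big1 // => k' _.
by rewrite term; case: ifP => // /andP[]; rewrite -val_eqE /= in ne; rewrite (negPf ne).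
Qed.

Lemma exists_square t : 0 <= gx t -> 0 <= gy t -> exists j k,
  [/\ inQ j k t, gx t < j.+1%:R * dl & gy t < k.+1%:R * dl].
Proof.
move=> /floor_inI [j [j1 j2]] /floor_inI [k [k1 k2]]; exists j, k.
by split=> //; split; apply/andP; split=> //; exact: ltW.
Qed.

(** Covers poles on grid lines by continuity: no edge of nonzero weight passes through the pole. *)
Lemma chain_jump z : cyl z -> inS (z 0 i0) -> outT (z 0 i0) -> 0 <= gx (z 0 i0) -> 0 <= gy (z 0 i0) ->
  chain Ssq z = cauchy_const * f z + chain Tsq z.
Proof.
move=> cz hS hT x0 y0; set t := z 0 i0 in hS hT x0 y0.
have [j [k [q jx ky]]] := exists_square x0 y0.
have Sjk := hS _ _ q; have Tjk := hT _ _ q.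
have Oz : Omega z by rewrite -(setc_id i0 z); exact: Ssq_Omega Sjk cz q.
have Kz : ~ K z by rewrite -(setc_id i0 z); exact: nTsq_K Tjk cz q.
pose D y := chain Ssq y - chain Tsq y - cauchy_const * f y.
have cD : ctn (D : W -> C) (z : W).
  apply: ctnB; first by apply: ctnB; apply: diff_ctn; [exact: chainS_diff|exact: chainT_diff].
  by apply: ctnM; [exact: ctn_cst|apply: diff_ctn; exact: df].
suff D0 : D z = 0 by apply/eqP; rewrite -subr_eq0 -D0 /D; apply/eqP; ring.
apply: rnorm_small => e e0; have [d d0 hd] := cD _ e0.
(* The chosen square has strict upper bounds, so a small shift along 1 + i leads into its
   interior. *)
pose eta := Num.min (d / 4) (Num.min ((j.+1%:R * dl - gx t) / 2) ((k.+1%:R * dl - gy t) / 2)).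
have eta0 : 0 < eta by rewrite !lt_min; apply/and3P; split; glra.
have eta1 : eta <= d / 4 by rewrite ge_min lexx.
have eta2 : eta <= (j.+1%:R * dl - gx t) / 2 by rewrite !ge_min lexx orbT.
have eta3 : eta <= (k.+1%:R * dl - gy t) / 2 by rewrite !ge_min lexx !orbT.
pose u := t + (eta +i* eta)%C.
have gxu : gx u = gx t + eta by rewrite /u /gx; case: (t) => a1 a2 /=; ring.
have gyu : gy u = gy t + eta by rewrite /u /gy; case: (t) => a1 a2 /=; ring.
have Du : D (setc z u) = 0.
  have cu : cyl (setc z u) by apply/cyl_setc.
  have hxu : j%:R * dl < gx (setc z u 0 i0) < j.+1%:R * dl.
    by rewrite setc_coord gxu; case: q => /andP[q1 _] _; glra.
  have hyu : k%:R * dl < gy (setc z u 0 i0) < k.+1%:R * dl.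
    by rewrite setc_coord gyu; case: q => _ /andP[q1 _]; glra.
  by rewrite /D (chain_interior cu Sjk Tjk hxu hyu) subrr.
have zu : vdist (setc z u) z < d.
  rewrite -{2}(setc_id i0 z); apply: le_lt_trans (vdist_setc _ _ _ _ _) _.
  rewrite vdistxx mulr0 add0r -/t /u addrC addKr.
  apply: le_lt_trans (rnorm_le_ReIm _) _; rewrite /= gtr0_norm //; glra.
by have := hd _ zu; rewrite Du sub0r rnormN.
Qed.

(** The margin [dl] makes both this condition and its negation yield a single formula on a whole
    neighbourhood: [outT] here, [inS] by [caseA_near]. *)
Definition caseB t := forall t', rnorm (t' - t) < dl -> outT t'.

(** Some square of [Tsq] has a point within [2 * dl] of [t'], that is, at most two index steps away.
    Its indices exceed 2, which keeps the shifted coordinates of [t'] nonnegative. *)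
Lemma caseA_near t t' : ~ caseB t -> rnorm (t' - t) < dl -> [/\ inS t', 0 <= gx t' & 0 <= gy t'].
Proof.
move=> /existsNP [u /not_implyP [ut /existsNP [j /existsNP [k /not_implyP [[q1 q2] /negP/negPn Tjk]]]]] tt'.
have du : rnorm (u - t') < 2 * dl.
  by have := ler_rdistD t u t'; rewrite (rdistC t); glra.
have dx := le_lt_trans (gx_close u t') du; have dy := le_lt_trans (gy_close u t') du.
have [j2 k2 _ _] := Tsq_bounds Tjk.
have pos m x x' : (2 < m)%N -> inI m x -> `|x - x'| < 2 * dl -> 0 <= x'.
  move=> m2 /andP[h1 _]; rewrite ltr_norml => /andP[_ h2].
  have : 3%:R * dl <= m%:R * dl by rewrite ler_pM2r // ler_nat.
  glra.
split; [|exact: pos j2 q1 dx|exact: pos k2 q2 dy].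
move=> j' k' [q1' q2']; apply/asboolP; exists j, k; split => //.
have dx' : `|gx t' - gx u| < 2 * dl by rewrite distrC.
have dy' : `|gy t' - gy u| < 2 * dl by rewrite distrC.
by split; [exact: inI_close q1 q1' dx|exact: inI_close q1' q1 dx'|
  exact: inI_close q2 q2' dy|exact: inI_close q2' q2 dy'].
Qed.

Lemma caseB_outT t : caseB t -> outT t.
Proof. by apply; rewrite subrr rnorm0. Qed.

(** The local version of the principal part u; by [chain_jump] the two formulas agree where both
    make sense. *)
Definition Gpart (z : V) : C := if `[< caseB (z 0 i0) >] then cauchy_const^-1 * chain Tsq z
  else cauchy_const^-1 * chain Ssq z - f z.

(** The part that extends over [K]: near [Tsq] the term [f] cancels, and with it the arbitrary
    values of [f] on [K]. *)
Definition Hpart (z : V) : C := f z + Gpart z.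

Lemma GpartT z : cyl z -> outT (z 0 i0) -> Gpart z = cauchy_const^-1 * chain Tsq z.
Proof.
move=> cz hT; rewrite /Gpart; case: asboolP => // hB.
have h0 : rnorm (z 0 i0 - z 0 i0) < dl by rewrite subrr rnorm0.
have [hS x0 y0] := caseA_near hB h0.
by rewrite (chain_jump cz hS hT x0 y0) mulrDr mulKf ?cauchy_const_neq0 //; ring.
Qed.

Lemma HpartS z : cyl z -> inS (z 0 i0) -> 0 <= gx (z 0 i0) -> 0 <= gy (z 0 i0) ->
  Hpart z = cauchy_const^-1 * chain Ssq z.
Proof.
move=> cz hS x0 y0; rewrite /Hpart /Gpart; case: asboolP => hB; last by ring.
by rewrite (chain_jump cz hS (caseB_outT hB) x0 y0) mulrDr mulKf ?cauchy_const_neq0.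
Qed.

Lemma near_cyl (P : C -> Prop) z : cyl z -> (forall t', rnorm (t' - z 0 i0) < dl -> P t') ->
  exists2 d : R, 0 < d & forall y : V, vdist y z < d -> cyl y /\ P (y 0 i0).
Proof.
move=> /cyl_open [d d0 hd] hP; exists (Num.min d dl); first by rewrite lt_min d0.
move=> y; rewrite lt_min => /andP[y1 y2]; split; first exact: hd.
by apply: hP; apply: le_lt_trans (vdist_coord _ _ _) y2.
Qed.

Lemma Gpart_differentiable_far z : cyl z -> caseB (z 0 i0) -> differentiable (Gpart : W -> C^o) (z : W).
Proof.
move=> cz hB; have [d d0 hd] := near_cyl cz hB.
apply: (@near_eq_differentiable R W (fun y : W => cauchy_const^-1 * chain Tsq y : C^o)).
  by exists d => // y /hd [cy hy]; rewrite GpartT.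
apply: differentiableM; first exact: differentiable_cst.
exact: chainT_diff cz (caseB_outT hB).
Qed.

Lemma Hpart_differentiable_near z : cyl z -> ~ caseB (z 0 i0) -> differentiable (Hpart : W -> C^o) (z : W).
Proof.
move=> cz hB; have [d d0 hd] := near_cyl cz (fun t' => caseA_near hB (t' := t')).
apply: (@near_eq_differentiable R W (fun y : W => cauchy_const^-1 * chain Ssq y : C^o)).
  by exists d => // y /hd [cy [h1 h2 h3]]; rewrite HpartS.
apply: differentiableM; first exact: differentiable_cst.
have h0 : rnorm (z 0 i0 - z 0 i0) < dl by rewrite subrr rnorm0.
by have [hS _ _] := caseA_near hB h0; exact: chainS_diff.
Qed.

Lemma outT_K z : cyl z -> outT (z 0 i0) -> ~ K z.
Proof.
move=> cz hT Kz; have Kz' : K (setc z (z 0 i0)) by rewrite setc_id.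
have [x1 y1] := K_gxy Kz'.
have x0 : 0 <= gx (z 0 i0) by glra.
have y0 : 0 <= gy (z 0 i0) by glra.
have [j [k [q _ _]]] := exists_square x0 y0.
by have /negP := hT _ _ q; apply; apply/asboolP; exists z, (z 0 i0).
Qed.

Lemma caseA_Omega z : cyl z -> ~ caseB (z 0 i0) -> Omega z.
Proof.
move=> cz hB; have h0 : rnorm (z 0 i0 - z 0 i0) < dl by rewrite subrr rnorm0.
have [hS x0 y0] := caseA_near hB h0; have [j [k [q _ _]]] := exists_square x0 y0.
by rewrite -(setc_id i0 z); exact: Ssq_Omega (hS _ _ q) cz q.
Qed.

Lemma Gpart_differentiable z : cyl z -> ~ K z -> differentiable (Gpart : W -> C^o) (z : W).
Proof.
move=> cz Kz; have [hB|hB] := pselect (caseB (z 0 i0)); first exact: Gpart_differentiable_far.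
rewrite (_ : (Gpart : W -> C^o) = fun y : W => Hpart y - f y : C^o); last first.
  by apply/funext => y; rewrite /Hpart; ring.
apply: differentiableB; first exact: Hpart_differentiable_near.
exact: df (caseA_Omega cz hB) Kz.
Qed.

Lemma Hpart_differentiable z : cyl z -> Omega z -> differentiable (Hpart : W -> C^o) (z : W).
Proof.
move=> cz Oz; have [hB|hB] := pselect (caseB (z 0 i0)); last exact: Hpart_differentiable_near.
apply: differentiableD; last exact: Gpart_differentiable_far.
by apply: df => //; apply: outT_K => //; exact: caseB_outT.
Qed.

Lemma Gpart_decays z : cyl z -> decays (fun t => Gpart (setc z t)).
Proof.
move=> cz.
apply: (@decays_eq _ (fun t => cauchy_const^-1 * chain Tsq (setc z t))).
  (* A square of [Tsq] contains a point of modulus at most [B0] and has diameter at most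
     [2 * dl]. *)
  exists (B0 + 3 * dl) => t tB; rewrite (@GpartT (setc z t)) ?setc_coord; [by []|by apply/cyl_setc|].
  move=> j k [q1 q2]; apply/negP => /asboolP [y [u [_ [p1 p2] Ku]]].
  have aux m x x' : inI m x -> inI m x' -> `|x - x'| <= dl.
    by rewrite /inI -natr1 => h1 h2; rewrite ler_norml; glra.
  have := le_trans (gxy_dist t u) (lerD (aux _ _ _ q1 p1) (aux _ _ _ q2 p2)).
  by have := ler_rdist t u; have := K_coord Ku; glra.
apply: decaysM; rewrite /chain.
have edge (c : C) p v : (c != 0 -> forall r : R, 0 <= r <= 1 ->
      Omega (setc z (p + r%:C * v)) /\ ~ K (setc z (p + r%:C * v))) ->
    decays (fun t => c * cint (phi (setc z t)) p v).
  move=> H; have [->|c0] := eqVneq c 0.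
    rewrite (_ : (fun t => _) = fun=> 0); first exact: decays0.
    by apply/funext => t; rewrite mul0r.
  apply: decaysM.
  rewrite (_ : (fun t => _) = fun t => cint (fun u => f (setc z u) / (u - t)) p v).
    apply: decays_cauchy_kernel => r r01; apply: cdiff_ctn; apply: cdiff_setc.
    by have [? ?] := H c0 r r01; exact: df.
  by apply/funext => t; apply: cint_ext => r _; rewrite /phi setcC setc_coord.
apply: decays_sum => j; apply: decays_sum => k; apply: decaysB; apply: edge => /coef_neq ne r r01.
  by have [q1 q2] := edgeH_inQ j k r01; exact: (boundary_good admT ne cz q2 q1).
by have [q1 q2] := edgeV_inQ j k r01; exact: (boundary_good admT ne cz q2 q1).
Qed.

End Grid.

(** * The extension theorem *)

Section Compactness.
Context {R : realType} {n : nat}.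
Local Notation C := (R[i]).
Local Notation V := ('rV[C]_n).
Local Notation W := (Cn R n).
Implicit Types (K A : set W) (x y : V).

(** The near-covering form of compactness, for the filter of large [m], merges the local thresholds
    into one. *)
Lemma compact_uniform K (P : nat -> V -> Prop) : compact K ->
  (forall x, K x -> exists2 d : R, 0 < d & exists m0, forall m y, (m0 <= m)%N -> vdist y x < d -> P m y) ->
  exists m, forall x, K x -> P m x.
Proof.
move=> /compact_near_coveringP cK H.
have [m0 _ hm] : \forall m \near \oo, K `<=` P m.
  apply: (cK nat \oo P _) => x Kx; have [d d0 [m0 hd]] := H x Kx.
  exists ([set y | vdist y x < d], [set m | (m0 <= m)%N]); last by move=> [y m] /= [h1 h2]; exact: hd.
  by split; [apply/nbhs_rnormP; exists d|exists m0].
by exists m0; apply: hm => /=.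
Qed.

Lemma compact_rnorm_bounded K : compact K -> exists B : R, forall x, K x -> rnorm x <= B.
Proof.
move=> cK; have [|m hm] := @compact_uniform K (fun m x => vdist x 0 <= m%:R) cK; last first.
  by exists m%:R => x /hm; rewrite /vdist subr0.
move=> x _; exists 1 => //.
exists (Num.truncn (vdist x 0 + 1)).+1 => m y hm yx.
have := vdistD x y 0; have /truncn_itv /andP[_] : 0 <= vdist x 0 + 1 by rewrite addr_ge0 ?rnorm_ge0.
move: hm; rewrite -(ler_nat R); rlra.
Qed.

Lemma open_vdist A : open A -> forall x, A x -> exists2 d : R, 0 < d & forall y, vdist y x < d -> A y.
Proof. by move=> oA x Ax; apply/nbhs_rnormP; exact: open_nbhs_nbhs. Qed.

Lemma vdist_open A : (forall x, A x -> exists2 d : R, 0 < d & forall y, vdist y x < d -> A y) -> open A.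
Proof. by move=> H; rewrite openE => x /H hx; apply/nbhs_rnormP. Qed.

Lemma compact_margin K A : compact K -> open A -> K `<=` A ->
  exists2 e : R, 0 < e & forall x y, K x -> vdist y x < e -> A y.
Proof.
move=> cK oA KA.
have [|m hm] := @compact_uniform K (fun m x => forall y, vdist y x < m.+1%:R^-1 -> A y) cK; last first.
  by exists m.+1%:R^-1 => [|x y /hm]; [rewrite invr_gt0|exact].
move=> x /KA /(open_vdist oA) [d d0 hd]; exists (d / 2); first by rewrite divr_gt0.
exists (Num.truncn (2 / d)) => m y hm yx z zy; apply: hd.
have d20 : 0 <= 2 / d by rewrite divr_ge0 // ltW.
have h : m.+1%:R^-1 < d / 2.
  rewrite -[d / 2]invrK ltf_pV2 ?posrE ?invr_gt0 ?divr_gt0 // invf_div.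
  have /truncn_itv /andP[_ h1] := d20; apply: lt_le_trans h1 _.
  by rewrite ler_nat ltnS.
have := lt_trans zy h; have := vdistD y z x; clear h zy; rlra.
Qed.

Lemma compact_closedC K : compact K -> open (~` K).
Proof. by move=> cK; apply: closed_openC; apply: compact_closed => //; exact: norm_hausdorff. Qed.

End Compactness.

(** * Entire functions and the identity theorem *)

Section Entire.
Context {R : realType} {n : nat}.
Local Notation C := (R[i]).
Local Notation V := ('rV[C]_n).
Local Notation W := (Cn R n).
Implicit Types (f g u : W -> C^o) (x y z : V).

(** On each line in direction [i0] the function vanishes outside a disc, so Liouville applies. *)
Lemma entire_compact_support (i0 : 'I_n) (K : set W) u : compact K ->
  (forall x : W, differentiable u x) -> (forall x, ~ K x -> u x = 0) -> forall x, u x = 0.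
Proof.
move=> cK du u0 x; have [B hB] := compact_rnorm_bounded cK.
rewrite -(setc_id i0 x); apply: (@liouville0 _ (fun t => u (setc i0 x t))).
  by move=> t; apply: cdiff_setc.
move=> e e0; exists B => t tB; rewrite u0 ?rnorm0 ?ltW // => /hB h.
have := rnorm_coord (setc i0 x t) i0; rewrite setc_coord => h'.
by have := lt_le_trans tB (le_trans h' h); rewrite ltxx.
Qed.

Lemma vdist_eq_differentiable f g x : (exists2 d : R, 0 < d & forall y, vdist y x < d -> f y = g y) ->
  differentiable f (x : W) -> differentiable g (x : W).
Proof. exact: (@near_eq_differentiable R W). Qed.

(** The set of points near which [u] vanishes is open, and closed in [A] because [zero_propagation]
    spreads the zeros along complex lines. *)
Lemma identity_theorem (A : set W) u : open A -> connected A -> (forall x : W, A x -> differentiable u x) ->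
  (exists2 x, A x & exists2 d : R, 0 < d & forall y, vdist y x < d -> u y = 0) ->
  forall x, A x -> u x = 0.
Proof.
move=> oA cA du [x0 Ax0 hx0].
pose Z : set W := [set x | exists2 d : R, 0 < d & forall y, vdist y x < d -> u y = 0].
suff -> : A = A `&` Z by move=> x [_ [d d0]]; apply; rewrite vdistxx.
apply/esym/cA.
- by exists x0; split.
- exists Z => //; apply: vdist_open => x [d d0 hd]; exists (d / 2); first by rewrite divr_gt0.
  move=> y yx; exists (d / 2); first by rewrite divr_gt0.
  by move=> z zy; apply: hd; have := vdistD y z x; rlra.
exists (closure (A `&` Z)); first exact: closed_closure.
apply/seteqP; split=> [x [Ax Zx]|x [Ax cx]]; first by split=> //; apply: subset_closure.
split => //; have [r r0 hr] := open_vdist oA Ax.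
have r80 : 0 < r / 8 by rewrite divr_gt0.
have [y [[Ay [d d0 hd]] yx]] : (A `&` Z) `&` [set y | vdist y x < r / 8] !=set0.
  by apply: cx; apply/nbhs_rnormP; exists (r / 8).
rewrite /= in yx; exists (r / 8) => // w wx.
have wy : rnorm (w - y) <= r / 4.
  by have := vdistD x w y; rewrite (vdistC x) => h; apply: le_trans h _; rlra.
have w0 := rnorm_ge0 (w - y).
have dd0 : 0 < d / (r / 4 + 1) by apply: divr_gt0; lra.
(* The target [t = 1] lies within [3 / 2], and for [rnorm t <= 3] the line stays within
   [3 * (r / 4) + r / 8 < r] of [x]. *)
have r32 : 0 < 3 / 2 :> R by lra.
have dg (t : C) : rnorm t <= 2 * (3 / 2) -> cdiff (fun t => u (y + t *: (w - y))) t.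
  move=> ht; apply: cdiff_line; apply: du; apply: hr.
  have h1 : vdist (y + t *: (w - y)) y <= 3 * (r / 4).
    rewrite /vdist addrC addKr rnormZ; apply: ler_pM => //; rewrite ?rnorm_ge0 //; lra.
  apply: le_lt_trans (vdistD y _ x) _; apply: le_lt_trans (lerD h1 (lexx _)) _; rlra.
have g0 (t : C) : rnorm t < d / (r / 4 + 1) -> u (y + t *: (w - y)) = 0.
  rewrite ltr_pdivlMr; last by lra.
  move=> ht; apply: hd; rewrite /vdist addrC addKr rnormZ; apply: le_lt_trans ht.
  by rewrite ler_wpM2l ?rnorm_ge0 //; lra.
have := zero_propagation r32 dd0 dg g0 (t := 1).
by rewrite rnorm1 scale1r addrC subrK; apply; lra.
Qed.

End Entire.

(** * Globalization of the principal part *)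

Section Hartogs.
Context {R : realType} {n : nat} (i0 i1 : 'I_n).
Local Notation C := (R[i]).
Local Notation V := ('rV[C]_n).
Local Notation W := (Cn R n).
Local Notation setc := (setc i0).
Implicit Types (f : W -> C^o) (Omega K : set W).

Lemma hartogs_extension Omega K f : i1 != i0 -> open Omega -> compact K -> K `<=` Omega ->
  connected (~` K) -> holomorphic_on (Omega `\` K) f ->
  exists F : W -> C^o, holomorphic_on Omega F /\ {in Omega `\` K, F =1 f}.
Proof.
move=> i10 oO cK KO conK hf.
have df x : Omega x -> ~ K x -> differentiable f x by move=> Ox Kx; apply: hf.
have oK := compact_closedC cK.
have Uopen x : Omega x -> ~ K x ->
    exists2 d : R, 0 < d & forall y, vdist y x < d -> Omega y /\ ~ K y.
  by move=> Ox Kx; apply: (open_vdist (openI oO oK)).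
have [B hB] := compact_rnorm_bounded cK.
have [e e0 he] := compact_margin cK oO KO.
(* [16 * dl = e] turns the margin of [K] in [Omega] into [Knear], and [N > 2 * B / dl + 8] makes the
   grid large enough. *)
pose dl := e / 16; pose X := B + 4 * dl; pose N := (Num.truncn `|2 * B / dl + 8|).+1.
have dl0 : 0 < dl by rewrite divr_gt0.
have NE : 2 * B + 8 * dl < N%:R * dl.
  rewrite -ltr_pdivrMr // mulrDl mulfK ?gt_eqF //.
  apply: le_lt_trans (ler_norm _) _.
  by have /truncn_itv /andP[_] := normr_ge0 (2 * B / dl + 8).
have Knear (x y : V) : K x -> vdist y x < 16 * dl -> Omega y.
  by move=> Kx h; apply: he Kx _; apply: lt_le_trans h _; rewrite /dl mulrC divfK.
pose G (a : V) : V -> C := Gpart i0 K f dl X N a.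
pose cy (a z : V) := cyl i0 dl a z.
have cyxx a : cy a a by rewrite /cy /cyl setc_id vdistxx.
have cy_open a z : cy a z -> exists2 d : R, 0 < d & forall y, vdist y z < d -> cy a y.
  exact: cyl_open.
have cyS a z t : cy a z -> cy a (setc z t) by rewrite /cy /cyl setcC.
have dG a z : cy a z -> ~ K z -> differentiable (G a : W -> C^o) (z : W).
  exact: (Gpart_differentiable df Uopen dl0 erefl NE hB Knear).
have dH a z : cy a z -> Omega z -> differentiable ((fun y => f y + G a y) : W -> C^o) (z : W).
  exact: (Hpart_differentiable df Uopen dl0 erefl NE hB Knear).
have decG a z : cy a z -> decays (fun t => G a (setc z t)).
  exact: (Gpart_decays df Uopen dl0 erefl NE hB Knear).
(* From here on the grid is forgotten: [G] and [cy] are known only through the facts above. *)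
clearbody G cy.
(* On [K] neither principal part need be holomorphic, but their difference is also that of [f + G a]
   and [f + G b]. *)
have dGB a b z : cy a z -> cy b z -> differentiable ((fun y => G a y - G b y) : W -> C^o) (z : W).
  move=> ca cb; have [Kz|Kz] := pselect (K z); last first.
    by apply: differentiableB; [exact: dG ca Kz|exact: dG cb Kz].
  have -> : ((fun y => G a y - G b y) : W -> C^o) = fun y : W => (f y + G a y) - (f y + G b y).
    by apply/funext => y; rewrite opprD addrACA subrr add0r.
  by apply: differentiableB; [exact: dH ca (KO _ Kz)|exact: dH cb (KO _ Kz)].
have Guniq a b z : cy a z -> cy b z -> G a z = G b z.
  move=> ca cb; apply/eqP; rewrite -subr_eq0 -(setc_id i0 z); apply/eqP.
  apply: (@liouville0 _ (fun t => G a (setc z t) - G b (setc z t))).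
    by move=> t; apply: (@cdiff_setc _ _ i0 (fun y => G a y - G b y)); apply: dGB; exact: cyS.
  exact: decaysB (decG _ _ ca) (decG _ _ cb).
(* Each point uses its own cylinder; by [Guniq] this agrees with [G a] near [a]. *)
pose u (z : V) : C := G z z.
have uG a : exists2 d : R, 0 < d & forall y, vdist y a < d -> G a y = u y.
  by have [d d0 hd] := cy_open _ _ (cyxx a); exists d => // y /hd cay; exact: Guniq.
have du (z : V) : ~ K z -> differentiable (u : W -> C^o) (z : W).
  by move=> Kz; apply: vdist_eq_differentiable (uG z) _; exact: dG.
have u0 : forall z, (~` K) z -> u z = 0.
  apply: (identity_theorem oK conK du).
  (* The second coordinate [i1] is fixed along lines in direction [i0]; if it exceeds [B], the whole
     line misses [K]. The value [|B| + 2] ensures this within distance 1 of [x0]. *)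
  have hi1 (y : V) t : B < rnorm (y 0 i1) -> ~ K (setc y t).
    move=> hy /hB h; have := rnorm_coord (setc y t) i1; rewrite setc_other // => h'.
    by have := lt_le_trans hy (le_trans h' h); rewrite ltxx.
  pose x0 : V := (`|B| + 2)%:C%C *: delta_mx 0 i1.
  have near1 y : vdist y x0 < 1 -> B < rnorm (y 0 i1).
    move=> yx; have := vdist_coord i1 y x0.
    have -> : x0 0 i1 = (`|B| + 2)%:C%C by rewrite /x0 !mxE !eqxx mulr1.
    have := ler_rdist ((`|B| + 2)%:C%C : C) (y 0 i1); rewrite rdistC rnormR.
    have -> : `| `|B| + 2 | = `|B| + 2 by rewrite ger0_norm // addr_ge0.
    have := ler_norm B; rlra.
  exists x0.
    by rewrite /= -[x0](setc_id i0); apply: hi1; apply: near1; rewrite vdistxx.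
  exists 1 => // y /near1 hy; rewrite /u -{2}(setc_id i0 y).
  apply: (@liouville0 _ (fun t => G y (setc y t))); last exact: decG.
  by move=> t; apply: (@cdiff_setc _ _ i0 (G y : W -> C^o)); apply: dG; [exact: cyS|exact: hi1].
exists (fun z => f z + u z); split.
  move=> z Oz; apply: (@vdist_eq_differentiable _ _ (fun y => f y + G z y)).
    by have [d d0 hd] := uG z; exists d => // y /hd ->.
  exact: dH.
by move=> z /set_mem [_ Kz]; rewrite u0 // addr0.
Qed.

End Hartogs.

(** * The equivalences *)

Section Equivalences.
Context {R : realType} {n : nat} (i0 : 'I_n) (Omega K : set (Cn R n)).
Local Notation C := (R[i]).
Local Notation W := (Cn R n).
Implicit Types (f g F G : W -> C^o).
Context (oO : open Omega) (cK : compact K) (KO : K `<=` Omega).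

(** The difference, extended by 0 outside [Omega], is entire and vanishes off [K]. *)
Lemma hol_extension_unique F G : holomorphic_on Omega F -> holomorphic_on Omega G ->
  {in Omega `\` K, G =1 F} -> {in Omega, G =1 F}.
Proof.
move=> hF hG FG.
pose D (x : W) : C^o := if `[< Omega x >] then G x - F x else 0.
have D0 (x : W) : ~ K x -> D x = 0.
  by move=> Kx; rewrite /D; case: asboolP => // Ox; rewrite FG ?subrr //; apply: mem_set.
suff D00 : forall x : W, D x = 0.
  move=> x /set_mem Ox; apply/eqP; rewrite -subr_eq0; apply/eqP.
  by have := D00 x; rewrite /D asboolT.
apply: (entire_compact_support i0 cK) => // x; have [Ox|Ox] := pselect (Omega x).
  apply: (@vdist_eq_differentiable _ _ (fun y => G y - F y)).
    have [d d0 hd] := open_vdist oO Ox; exists d => // y /hd Oy.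
    by rewrite /D asboolT.
  by apply: differentiableB; [exact: hG|exact: hF].
apply: (@vdist_eq_differentiable _ _ (fun=> 0)); last exact: differentiable_cst.
have Kx : (~` K) x by move=> Kx; apply: Ox; exact: KO.
have [d d0 hd] := open_vdist (compact_closedC cK) Kx.
by exists d => // y /hd Ky; rewrite D0.
Qed.

Lemma locally_constant_holomorphic (D : set W) g : locally_constant_on D g -> holomorphic_on D g.
Proof.
move=> lg x Dx; apply: (@vdist_eq_differentiable _ _ (fun=> g x)); last exact: differentiable_cst.
by have /nbhs_rnormP [d d0 hd] := lg x Dx; exists d => // y /hd.
Qed.

(** The values are 0 and 1, and on a short piece they differ by at most 1/2, hence not at all;
    bisection carries this along the segment from [x] to [y]. *)
Lemma entire_idempotent_const (h : W -> C^o) : (forall x : W, differentiable h x) ->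
  (forall x, h x * (h x - 1) = 0) -> forall x y, h x = h y.
Proof.
move=> dh h01 x y.
have val z : h z = 0 \/ h z = 1.
  by have /eqP := h01 z; rewrite mulf_eq0 subr_eq0 => /orP[] /eqP ->; [left|right].
pose g (s : C) : C := h (x + s *: (y - x)).
have gval s : g s = 0 \/ g s = 1 by exact: val.
have cg : cseg g 0 1.
  by move=> s _; apply: cdiff_ctn; apply: cdiff_line; exact: dh.
have <- : g 0 = h x by rewrite /g scale0r addr0.
have <- : g 1 = h y by rewrite /g scale1r addrC subrK.
clearbody g.
pose P (s k : R) := forall t : R, 0 <= t <= 1 -> g (0 + s%:C%C * 1 + t%:C%C * (k%:C%C * 1)) = g (0 + s%:C%C * 1).
have : P 0 1.
  apply: cousin1.
    move=> s k k0 h1 h2 t t01.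
    have e1 := h1 1; have o1 : 0 <= (1 : R) <= 1 by rewrite ler01 lexx.
    have {}e1 := h1 1 o1.
    have [th|th] := leP t (1 / 2).
      have t2 : 0 <= 2 * t <= 1 by lra.
      by rewrite -(h1 _ t2); congr g; rewrite !rmorphM /= rmorph_nat halfC; field.
    have t2 : 0 <= 2 * t - 1 <= 1 by lra.
    rewrite -e1; have e2 := h2 _ t2.
    have -> : 0 + s%:C%C * 1 + 1%:C%C * ((k / 2)%:C%C * 1) = 0 + (s + k / 2)%:C%C * 1 :> C.
      by rewrite rmorph1 rmorphD /=; ring.
    by rewrite -e2; congr g; rewrite rmorphB rmorph1 !rmorphD !rmorphM /= rmorph_nat halfC; field.
  move=> s0 s01; have e0 : 0 < 1 / 4 :> R by lra.
  have [d d0 hd] := seg_small (cg _ s01) e0; exists d => // s k _ _ ss k0 kd t t01.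
  have h1 := hd s k ss k0 kd t t01.
  have z01 : 0 <= (0 : R) <= 1 by rewrite lexx ler01.
  have h2 := hd s k ss k0 kd 0 z01; rewrite rmorph0 mul0r addr0 in h2.
  move: h1 h2; set a := g _; set b := g _; set c := g _ => h1 h2.
  have aP : a = 0 \/ a = 1 by exact: gval.
  have cP : c = 0 \/ c = 1 by exact: gval.
  clearbody a b c.
  have hab : rnorm (a - c) <= 1 / 2.
    by have := ler_rdistD b a c; rewrite (rdistC b c); lra.
  case: aP hab => ->; case: cP => -> // hab; exfalso; move: hab;
    rewrite ?subr0 ?sub0r ?rnormN rnorm1; lra.
move=> /(_ 1); rewrite lexx ler01 => /(_ isT).
by rewrite rmorph0 rmorph1 mul0r !mul1r addr0 add0r => <-.
Qed.

Lemma extension_connected :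
  (forall g, locally_constant_on (Omega `\` K) g ->
     exists G, holomorphic_on Omega G /\ {in Omega `\` K, G =1 g}) ->
  connected (~` K).
Proof.
move=> ext; apply/connectedP => E [E0 EU [sE1 sE2]].
have oK := compact_closedC cK.
have Eb b x : E b x -> ~ K x.
  by move=> Ex; have : (~` K) x by rewrite EU; case: b Ex; [right|left].
have disj b x : E b x -> ~ E (~~ b) x.
  move=> Ex Ex'; have : set0 x by rewrite -sE1; case: b Ex Ex' => Ex Ex'; split=> //; apply: subset_closure.
  by [].
(* The complement of [K] is open and [x] avoids the closure of the other piece. *)
have oE b x : E b x -> exists2 d : R, 0 < d & forall y, vdist y x < d -> E b y.
  move=> Ex.
  have nc : ~ closure (E (~~ b)) x.
    move=> cx; case: b Ex cx => Ex cx.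
      by have : set0 x by rewrite -sE1.
    by have : set0 x by rewrite -sE2.
  have : open (~` K `&` ~` closure (E (~~ b))).
    by apply: openI => //; apply: closed_openC; exact: closed_closure.
  move=> /open_vdist /(_ x (conj (Eb _ _ Ex) nc)) [d d0 hd]; exists d => // y /hd [Ky ncy].
  have : (~` K) y by [].
  by rewrite EU; case: b {Ex hd nc} ncy => ncy -[] // Ey; case: ncy; apply: subset_closure.
pose chi (x : W) : C^o := if `[< E true x >] then 1 else 0.
have chiE b x : E b x -> chi x = b%:R.
  rewrite /chi; case: b => Ex; first by rewrite asboolT.
  by rewrite asboolF // => Ex'; exact: (disj _ _ Ex).
have chi_loc b x : E b x -> exists2 d : R, 0 < d & forall y, vdist y x < d -> chi y = b%:R.
  by move=> /oE [d d0 hd]; exists d => // y /hd /chiE.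
have cover x : ~ K x -> exists b, E b x.
  by move=> Kx; have : (~` K) x by []; rewrite EU => -[?|?]; [exists false|exists true].
have lchi : locally_constant_on (Omega `\` K) chi.
  move=> x [_ /cover [b Ex]]; have [d d0 hd] := chi_loc _ _ Ex.
  by apply/nbhs_rnormP; exists d => // y /hd ->; rewrite (chiE _ _ Ex).
(* As [K] lies in [Omega], each point is in [Omega] or off [K], and off [K] the glued function is
   [chi]. *)
have [G [hG Gchi]] := ext _ lchi.
pose h (x : W) : C^o := if `[< Omega x >] then G x else chi x.
have hchi (x : W) : ~ K x -> h x = chi x.
  by move=> Kx; rewrite /h; case: asboolP => // Ox; rewrite Gchi //; apply: mem_set.
have dh (x : W) : differentiable h x.
  have [Ox|Ox] := pselect (Omega x).
    apply: (@vdist_eq_differentiable _ _ G); last exact: hG.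
    by have [d d0 hd] := open_vdist oO Ox; exists d => // y /hd Oy; rewrite /h asboolT.
  have [b Ex] : exists b, E b x by apply: cover => Kx; apply: Ox; exact: KO.
  apply: (@vdist_eq_differentiable _ _ (fun=> b%:R)); last exact: differentiable_cst.
  have [d d0 hd] := oE _ _ Ex; exists d => // y /hd Ey.
  by rewrite (hchi _ (Eb _ _ Ey)) (chiE _ _ Ey).
have q0 (x : W) : h x * (h x - 1) = 0.
  apply: (@entire_compact_support _ _ i0 K (fun x => h x * (h x - 1)) cK) => {x}.
    move=> x; apply: differentiableM; first exact: dh.
    by apply: differentiableB; [exact: dh|exact: differentiable_cst].
  move=> x Kx; have [b Ex] := cover _ Kx; rewrite (hchi _ Kx) (chiE _ _ Ex).
  by case: b {Ex}; rewrite ?subrr ?mulr0 ?mul0r.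
have [x Ex] := E0 true; have [y Ey] := E0 false.
have := entire_idempotent_const dh q0 x y.
rewrite (hchi _ (Eb _ _ Ex)) (hchi _ (Eb _ _ Ey)) (chiE _ _ Ex) (chiE _ _ Ey).
by move/eqP; rewrite oner_eq0.
Qed.

End Equivalences.

Theorem mainTheorem3 (R : realType) (n : nat) (Omega K : set (Cn R n)) :
  (2 <= n)%N -> open Omega -> compact K -> K `<=` Omega ->
  [<->
   (* (i) *)
   (forall f : Cn R n -> (R[i])^o, holomorphic_on (Omega `\` K) f ->
      exists F : Cn R n -> (R[i])^o,
        [/\ holomorphic_on Omega F,
            {in Omega `\` K, F =1 f} &
            forall G : Cn R n -> (R[i])^o, holomorphic_on Omega G ->
              {in Omega `\` K, G =1 f} -> {in Omega, G =1 F}]);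
   (* (i') *)
   (forall g : Cn R n -> (R[i])^o, locally_constant_on (Omega `\` K) g ->
      exists G : Cn R n -> (R[i])^o,
        holomorphic_on Omega G /\ {in Omega `\` K, G =1 g});
   (* (ii) *)
   (set_bij (Hol Omega) (Hol (Omega `\` K)) (restr (Omega `\` K)) /\
    [/\ forall f g, Hol Omega f -> Hol Omega g ->
          restr (Omega `\` K) (f \+ g) = restr (Omega `\` K) f \+ restr (Omega `\` K) g,
        forall f g, Hol Omega f -> Hol Omega g ->
          restr (Omega `\` K) (f \* g) = restr (Omega `\` K) f \* restr (Omega `\` K) g,
        forall (c : R[i]) f, Hol Omega f ->
          restr (Omega `\` K) (fun x => c * f x) = (fun x => c * restr (Omega `\` K) f x) &
        restr (Omega `\` K) (Hol_one Omega) = Hol_one (Omega `\` K)]);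
   (* (iii) *)
   connected (~` K)]
  /\
  (connected (~` K) ->
     forall f : Cn R n -> (R[i])^o, holomorphic_on Omega f ->
       f @` Omega = f @` (Omega `\` K)).
Proof.
move=> n2 oO cK KO.
have n0 : (0 < n)%N by exact: ltnW.
pose i0 : 'I_n := Ordinal n0; pose i1 : 'I_n := Ordinal n2.
have i10 : i1 != i0 by [].
have OK x : (Omega `\` K) x -> Omega x by case.
have uniq := hol_extension_unique i0 oO cK KO.
have ext := fun con f => @hartogs_extension R n i0 i1 Omega K f i10 oO cK KO con.
have con := extension_connected i0 oO cK KO.
have oU : open (Omega `\` K) by apply: openI => //; exact: compact_closedC.
have restr_hol (V : set (Cn R n)) (f g : Cn R n -> R[i]^o) : open V -> {in V, g =1 f} ->
    holomorphic_on V f -> holomorphic_on V g.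
  move=> oV gf hf x Vx; apply: (@vdist_eq_differentiable _ _ f); last exact: hf.
  by have [d d0 hd] := open_vdist oV Vx; exists d => // y /hd Vy; rewrite gf //; apply: mem_set.
have restrE (V : set (Cn R n)) f : {in V, restr V f =1 f}.
  by move=> x /set_mem Vx; rewrite /restr asboolT.
have full : connected (~` K) -> forall f : Cn R n -> R[i]^o, holomorphic_on (Omega `\` K) f ->
      exists F : Cn R n -> R[i]^o, [/\ holomorphic_on Omega F, {in Omega `\` K, F =1 f} &
            forall G : Cn R n -> R[i]^o, holomorphic_on Omega G ->
              {in Omega `\` K, G =1 f} -> {in Omega, G =1 F}].
  move=> cc f /(ext cc) [F [hF Ff]]; exists F; split=> // G hG Gf.
  by apply: uniq => // x xU; rewrite Gf // Ff.
split.
  tfae.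
  - move=> H g /locally_constant_holomorphic /H [F [hF Fg _]]; by exists F.
  (* Through connectedness: surjectivity is the extension theorem, injectivity is uniqueness. *)
  - move=> /con cc; split; last first.
      split.
      + by move=> f g _ _; apply/funext => x; rewrite /restr /=; case: asboolP => // _; rewrite addr0.
      + by move=> f g _ _; apply/funext => x; rewrite /restr /=; case: asboolP => // _; rewrite mulr0.
      + by move=> c f _; apply/funext => x; rewrite /restr /=; case: asboolP => // _; rewrite mulr0.
      + apply/funext => x; rewrite /restr /Hol_one; case: asboolP => // -[Ox _].
        by rewrite asboolT.
    split.
    + move=> f [hf f0]; split; last by move=> x nx; rewrite /restr asboolF.
      apply: (restr_hol _ f) => //.
      by move=> x Ux; apply: hf; exact: OK.
    + move=> f g /set_mem [hf f0] /set_mem [hg g0] fg; apply/funext => x.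
      have [Ox|Ox] := pselect (Omega x); last by rewrite f0 // g0.
      apply: (uniq g f) => //; last exact: mem_set.
      by move=> y Uy; rewrite -(restrE _ f _ Uy) fg restrE.
    + move=> f [hf f0]; have [F [hF Ff]] := ext cc f hf.
      (* Elements of [Hol Omega] vanish outside [Omega], hence the truncation. *)
      exists (restr Omega F).
        split; last by move=> x nx; rewrite /restr asboolF.
        by apply: (restr_hol _ F).
      apply/funext => x; rewrite /restr; case: asboolP => [Ux|Ux]; last by rewrite f0.
      by rewrite asboolT; [apply: Ff; exact: mem_set|exact: OK].
  - move=> [[_ _ surj] _]; apply: con => g lg.
    have /surj [F [hF F0] Fg] : Hol (Omega `\` K) (restr (Omega `\` K) g).
      split; last by move=> x nx; rewrite /restr asboolF.
      by apply: (restr_hol _ g) => //; exact: locally_constant_holomorphic.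
    exists F; split=> // x Ux.
    by rewrite -(restrE _ F _ Ux) Fg restrE.
  - exact: full.
move=> cc f hf; apply/seteqP; split=> [w [a Oa fa]|w [a [Oa Ka] fa]]; last by exists a.
(* If [w = f a] were omitted off [K], the extension [G] of [1 / (f - w)] would satisfy
   [G * (f - w) = 1] on [Omega] by uniqueness, which fails at [a]. *)
apply: contrapT => nw.
have fw x : (Omega `\` K) x -> f x - w != 0.
  by move=> Ux; rewrite subr_eq0; apply/eqP => fxw; apply: nw; exists x.
have hg : holomorphic_on (Omega `\` K) (fun x => (f x - w)^-1 : R[i]^o).
  move=> x Ux; apply: differentiableV; last exact: fw.
  by apply: differentiableB; [apply: hf; exact: OK|exact: differentiable_cst].
have [G [hG Gg]] := ext cc _ hg.
have : {in Omega, (fun x => G x * (f x - w) : R[i]^o) =1 (fun=> 1)}.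
  apply: uniq.
  - by move=> x _; exact: differentiable_cst.
  - move=> x Ox; apply: differentiableM; first exact: hG.
    by apply: differentiableB; [exact: hf|exact: differentiable_cst].
  - by move=> x Ux; rewrite Gg // mulVf //; apply: fw; exact: set_mem.
move=> /(_ a (mem_set Oa)) /eqP.
by rewrite fa subrr mulr0 eq_sym oner_eq0.
Qed.
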